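(* Let $n\ge 6$ and run the CDCL solver described below on $OP_n$. Then the sequence of clauses learned by the solver is exactly the following, in this exact order. (Head) $C(1,n-2)$, $C(1,n-3)$. (Descending Cascade) For each $j$ descending from $n-2$ to $2$, the block $C(j,n-2), C(j,n-3),\dots,C(j,j-1)$. (Tail) $C(1,n-4), C(1,n-5),\dots,C(1,2)$. After learning these clauses, the solver derives that $OP_n$ is unsatisfiable.
   Context: Ordering principle: for $n\ge 1$, the variables are $P_{i,j}$ for $1\le i,j\le n$ with $i\ne j$. The formula $OP_n$ is the conjunction of three families of clauses. - Transitivity clauses: $A(i,j,k)=\neg P_{i,j}\lor\neg P_{j,k}\lor P_{i,k}$ for pairwise distinct $i,j,k$. - Antisymmetry clauses: $B(i,j)=\neg P_{i,j}\lor\neg P_{j,i}$ for $i\ne j$. - Non-minimality clauses: $D(j)=\bigvee_{i\ne j}P_{i,j}$ for each $j$. For a column $j$, let $\mathcal{L}_j=\langle P_{1,j},\dots,P_{j-1,j},P_{j+1,j},\dots,P_{n,j}\rangle$ be the variables of column $j$ in increasing row order. $C(j,k)$ denotes the disjunction of the first $k$ variables of $\mathcal{L}_j$ (all positive). CDCL configuration: - Propagation and conflicts: unit propagation; on a conflict, 1UIP clause learning. Learned clauses are kept forever (no deletion). The solver restarts (backtracks to decision level 0) after every conflict. A conflict reached with no decisions yields UNSAT. - Branching: VSIDS. Scores start at $0$, and after the $t$-th conflict $q(x,t)=b(x,t)+\delta q(x,t-1)$, where $b(x,t)=1$ iff $x$ occurs in the clause learned at conflict $t$. The decay factor is $\delta\le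 1/2$. Each decision picks an unassigned variable of highest score. Ties are broken by taking the first such variable in the column-major order $P_{2,1},\dots,P_{n,1},P_{1,2},\dots,P_{n,2},\dots,P_{1,n},\dots,P_{n-1,n}$. - Phase: decided variables are always assigned false.
   Formalization: Unit propagation is taken to be breadth-first (FIFO queue, arbitrary order of clause visits), since for arbitrary propagation orders the third learned clause can differ; the decay factor is assumed positive, 0 < δ ≤ 1/2, since the sequence fails for δ = 0. *)

(* Defs.v *)
From mathcomp Require Import all_boot all_order all_algebra.
From Stdlib Require Import Relations.

Set Implicit Arguments.
Unset Strict Implicit.
Unset Printing Implicit Defensive.

Import Order.TTheory GRing.Theory Num.Theory.

(* A CDCL solver over an arbitrary finite type [V] of variables, as a
   transition system.  Unit propagation is breadth first: assigned literals are
   taken off a FIFO queue, and a clause is visited when the negation of the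
   literal just dequeued occurs in it.  The order of these visits, and hence the
   choice among several reasons or conflict clauses, is nondeterministic.  A
   visit may be postponed as long as a false literal of the clause is still in
   the queue, which covers both watched-literal and counter-based propagation. *)

(* [(x, true)] is the positive literal of [x], [(x, false)] the negative one. *)
Definition literal (V : Type) : Type := (V * bool)%type.

Definition negl (V : Type) (l : literal V) : literal V := (l.1, ~~ l.2).

Definition clause (V : finType) : Type := {set V * bool}.

(* An assignment on the trail: the literal made true, its decision level, and
   the clause that forced it ([None] for a decision). *)
Record entry (V : finType) := Entry {
  elit : literal V;
  elevel : nat;
  ereason : option (clause V)
}.

(* The trail and the learned clauses are in chronological order.  The first
   [qhead] entries of the trail are those already taken off the FIFO
   propagation queue; the others are still waiting in it. *)
Record state (V : finType) := State {
  trail : seq (entry V);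
  qhead : nat;
  learned : seq (clause V)
}.

Inductive config (V : finType) : Type :=
  | Running of state V
  | Unsat of seq (clause V)
  | Sat of seq (clause V).

Section Solver.

Variables (V : finType) (R : realFieldType).
(* [delta] is the decay factor, [F] the input formula, and [ord] lists the
   variables in the order used to break ties between equal scores. *)
Variables (delta : R) (F : {set clause V}) (ord : seq V).

Implicit Types (tr : seq (entry V)) (C D : clause V) (l : literal V) (x y : V).
Implicit Types (s : state V) (cs : seq (clause V)).

Definition lits tr : seq (literal V) := [seq elit e | e <- tr].

Definition assigned tr x : bool := x \in [seq l.1 | l <- lits tr].

Definition dlevel tr : nat := count (fun e => ~~ isSome (ereason e)) tr.

Definition false_under tr C : bool := [forall l in C, negl l \in lits tr].

Definition unit_under tr C l : bool :=
  [&& l \in C, ~~ assigned tr l.1 & false_under tr (C :\ l)].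

Definition clause_of s C : bool := (C \in F) || (C \in learned s).

Definition processed s : seq (entry V) := take (qhead s) (trail s).

(* [C] is falsified or unit, and all its false literals are off the queue:
   nothing can be dequeued or decided before [C] is dealt with. *)
Definition due s C : bool :=
  false_under (processed s) C ||
  [exists l, unit_under (trail s) C l && false_under (processed s) (C :\ l)].

(* [C] contains the negation of the literal taken off the queue last. *)
Definition visited s C : bool :=
  if rev (processed s) is e :: _ then negl (elit e) \in C else false.

Definition quiescent s : Prop := forall C, clause_of s C -> ~~ due s C.

Definition resolvent D C l : clause V := (D :\ negl l) :|: (C :\ l).

Definition at_level tr (d : nat) D : {set literal V} :=
  [set l in D | negl l \in lits [seq e <- tr | elevel e == d]].

(* Resolve [D] with the reasons met on the reversed trail [rtr] until a single
   literal of the current decision level remains. *)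
Fixpoint uip_rec tr rtr D : clause V :=
  if #|at_level tr (dlevel tr) D| <= 1 then D else
  match rtr with
  | [::] => D
  | e :: rtr' =>
    if negl (elit e) \in D then
      if ereason e is Some C then uip_rec tr rtr' (resolvent D C (elit e))
      else D
    else uip_rec tr rtr' D
  end.

Definition uip1 tr D : clause V := uip_rec tr (rev tr) D.

Definition occurs x C : bool := ((x, true) \in C) || ((x, false) \in C).

(* [vsids cs x] is q(x,t), where [cs] is the sequence of the first [t]
   learned clauses. *)
Definition vsids cs x : R :=
  foldl (fun q C => (occurs x C)%:R + delta * q)%R 0%R cs.

Definition top_score s x : bool :=
  ~~ assigned (trail s) x &&
  [forall y, ~~ assigned (trail s) y ==>
             (vsids (learned s) y <= vsids (learned s) x)%R].

Definition branch s : option V := ohead [seq x <- ord | top_score s x].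

Definition push s (e : entry V) : state V :=
  State (rcons (trail s) e) (qhead s) (learned s).

Definition restart s D : state V :=
  let tr0 := [seq e <- trail s | elevel e == 0] in
  State tr0 (size tr0) (rcons (learned s) D).

Inductive cdcl_step : config V -> config V -> Prop :=
  | Propagate s C l :
      clause_of s C -> due s C || visited s C -> unit_under (trail s) C l ->
      cdcl_step (Running s)
        (Running (push s (Entry l (dlevel (trail s)) (Some C))))
  | Dequeue s :
      quiescent s -> qhead s < size (trail s) ->
      cdcl_step (Running s)
        (Running (State (trail s) (qhead s).+1 (learned s)))
  | Learn s C :
      clause_of s C -> due s C || visited s C -> false_under (trail s) C ->
      0 < dlevel (trail s) ->
      cdcl_step (Running s) (Running (restart s (uip1 (trail s) C)))
  | Refute s C :
      clause_of s C -> due s C || visited s C -> false_under (trail s) C ->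
      dlevel (trail s) = 0 ->
      cdcl_step (Running s) (Unsat (learned s))
  | Decide s x :
      quiescent s -> qhead s = size (trail s) -> branch s = Some x ->
      cdcl_step (Running s)
        (Running (push s (Entry (x, false) (dlevel (trail s)).+1 None)))
  | Model s :
      quiescent s -> qhead s = size (trail s) ->
      (forall x, assigned (trail s) x) ->
      cdcl_step (Running s) (Sat (learned s)).

Definition init : config V := Running (State [::] 0 [::]).

Definition reachable : config V -> Prop := clos_refl_trans _ cdcl_step init.

Definition halted (c : config V) : Prop := forall c', ~ cdcl_step c c'.

(* Every execution from the initial configuration is finite. *)
Definition terminating : Prop := Acc (fun c' c => cdcl_step c c') init.

End Solver.

(* The ordering principle.  Rows and columns are represented by ['I_n], so the
   variable P_{i,j} with 1 <= i, j <= n is the pair (i - 1, j - 1). *)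

Notation opvar n := {p : 'I_n * 'I_n | p.1 != p.2}.

Section OrderingPrinciple.

Variable n : nat.

Definition op_clause (s : seq (('I_n * 'I_n) * bool)) : clause (opvar n) :=
  [set l : opvar n * bool | (val l.1, l.2) \in s].

Definition op_trans (i j k : 'I_n) : clause (opvar n) :=
  op_clause [:: ((i, j), false); ((j, k), false); ((i, k), true)].

Definition op_antisym (i j : 'I_n) : clause (opvar n) :=
  op_clause [:: ((i, j), false); ((j, i), false)].

Definition op_nonmin (j : 'I_n) : clause (opvar n) :=
  op_clause [seq ((i, j), true) | i <- enum 'I_n & i != j].

Definition OP : {set clause (opvar n)} :=
  [set C | [exists i, exists j, exists k,
             [&& i != j, j != k, i != k & C == op_trans i j k]]]
  :|: [set C | [exists i, exists j, (i != j) && (C == op_antisym i j)]]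
  :|: [set C | [exists j, C == op_nonmin j]].

(* P_{2,1}, ..., P_{n,1}, P_{1,2}, ..., P_{n,2}, ..., P_{n-1,n}; the partial
   map [insub] skips the diagonal. *)
Definition col_major : seq (opvar n) :=
  pmap insub [seq (i, j) | j <- enum 'I_n, i <- enum 'I_n].

(* L_j and C(j,k), with [j] ranging over 1, ..., n. *)
Definition column (j : nat) : seq (opvar n) :=
  [seq x <- col_major | ((val x).2 : 'I_n).+1 == j].

Definition colclause (j k : nat) : clause (opvar n) :=
  [set (x, true) | x in take k (column j)].

(* a, a - 1, ..., b *)
Definition downto (a b : nat) : seq nat := rev (iota b (a.+1 - b)).

Definition op_learned : seq (clause (opvar n)) :=
  [:: colclause 1 (n - 2); colclause 1 (n - 3)]
  ++ [seq colclause j k | j <- downto (n - 2) 2, k <- downto (n - 2) (j - 1)]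
  ++ [seq colclause 1 k | k <- downto (n - 4) 2].

End OrderingPrinciple.

(* Main.v *)
(* Number rows and columns from 1.  The clause C(j,k), that is P(i,j) for i < m
   and i <> j where m > j is k + 2, is learned as follows.  The decisions falsify
   these P(i,j) one after the other, until C(j,k+1) (which is D(j) when m = n)
   makes P(m,j) true.  Transitivity and antisymmetry then make P(i,m) false for
   all i < m, which falsifies C(m,m-1): learned before, or equal to D(n) when
   m = n.  When m = n - 1 that clause is missing, but D(m) now yields P(n,m),
   which makes every P(i,n) false and falsifies D(n).  Let q be the last row
   below m.  The conflict is reached from P(q,j) along two disjoint families of
   implications, one inside row q and one through P(m,j); so P(q,j) is the first
   UIP and the resolvents end with C(j,k).

   In the first round of each block but the very first, and of the tail, the
   decisions are made in the column x worked on before, where P(j,x) has become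
   true: deciding P(i,x) false propagates P(i,j) false.

   Before the last decision the assigned literals form a set closed under unit
   propagation, so the order of propagation does not matter.  After it the queue
   discipline matters: all P(i,m) are assigned before any of them is dequeued.
   Since delta <= 1/2, VSIDS compares two variables by the most recent learned
   clause that contains exactly one of them. *)

Require Import Defs.
From mathcomp Require Import all_boot all_order all_algebra zify.
From Stdlib Require Import Relations.

Set Implicit Arguments.
Unset Strict Implicit.
Unset Printing Implicit Defensive.

(** * Trails and conflict analysis *)

Section Trails.

Variables (V : finType) (DB : pred (clause V)).
Implicit Types (tr t : seq (entry V)) (C D : clause V) (l : literal V).

Lemma negl_neq l : negl l != l.
Proof. by case: l => x []; rewrite /negl xpair_eqE /= andbF. Qed.

Lemma neglK : involutive (@negl V).
Proof. by case=> x b; rewrite /negl /= negbK. Qed.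

Definition wft tr := forall t1 e t2, tr = t1 ++ e :: t2 ->
  [/\ ~~ assigned t1 (elit e).1,
      elevel e = dlevel t1 + ~~ isSome (ereason e)
    & forall C, ereason e = Some C ->
        [/\ DB C, elit e \in C & false_under t1 (C :\ elit e)]].

Lemma rcons_split tr e t1 e' t2 : rcons tr e = t1 ++ e' :: t2 ->
  [/\ t1 = tr, e' = e & t2 = [::]] \/
  exists2 t2', t2 = rcons t2' e & tr = t1 ++ e' :: t2'.
Proof.
case/lastP: t2 => [|t2 e2].
  by rewrite cats1 => /rcons_inj [-> ->]; left.
rewrite -rcons_cons -rcons_cat => /rcons_inj [-> ->]; right; by exists t2.
Qed.

Lemma wft_nil : wft [::].
Proof. by case. Qed.

Lemma wft_rcons tr e : wft tr ->
  [/\ ~~ assigned tr (elit e).1,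
      elevel e = dlevel tr + ~~ isSome (ereason e)
    & forall C, ereason e = Some C ->
        [/\ DB C, elit e \in C & false_under tr (C :\ elit e)]] ->
  wft (rcons tr e).
Proof.
move=> wt he t1 e' t2 /rcons_split [[-> -> _]//|[t2' _ E]]; exact: (wt _ _ _ E).
Qed.

Lemma wft_catl t1 t2 : wft (t1 ++ t2) -> wft t1.
Proof. move=> w a e b E; apply: (w a e (b ++ t2)); by rewrite E -catA. Qed.

Lemma lits_cat t1 t2 : lits (t1 ++ t2) = lits t1 ++ lits t2.
Proof. exact: map_cat. Qed.

Lemma lits_rcons t e : lits (rcons t e) = rcons (lits t) (elit e).
Proof. exact: map_rcons. Qed.

Lemma lits_split tr l : l \in lits tr ->
  exists t1 e t2, tr = t1 ++ e :: t2 /\ elit e = l.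
Proof.
elim: tr => //= e tr IH; rewrite inE => /orP[/eqP ->|/IH [t1 [e' [t2 [-> <-]]]]].
  by exists [::], e, tr.
by exists (e :: t1), e', t2.
Qed.

Lemma all_split (P : pred (entry V)) tr :
  (forall t1 e t2, tr = t1 ++ e :: t2 -> P e) -> all P tr.
Proof.
elim: tr => //= e tr IH h; rewrite (h [::] e tr) //=; apply: IH => t1 e' t2 E.
by apply: (h (e :: t1) e' t2); rewrite E.
Qed.

Lemma filter_all_false (P : pred (entry V)) tr :
  all (fun e => ~~ P e) tr -> [seq e <- tr | P e] = [::].
Proof. by elim: tr => //= e tr IH /andP[/negbTE -> /IH ->]. Qed.

Lemma assignedE tr l : assigned tr l.1 = (l \in lits tr) || (negl l \in lits tr).
Proof.
apply/idP/orP.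
  move=> /mapP[l' hl' E]; case: l E => x b /= ->; case: l' hl' => y b' hl' /=.
  case: (eqVneq b b') => [->|nb]; [by left|right].
  by rewrite /negl /= (_ : ~~ b = b') //; case: b b' nb {hl'} => [] [].
by case=> h; apply/mapP; [exists l|exists (negl l)].
Qed.

Lemma dlevel_cat t1 t2 : dlevel (t1 ++ t2) = dlevel t1 + dlevel t2.
Proof. exact: count_cat. Qed.

Lemma wft_uniq tr t1 e t2 l : wft tr -> tr = t1 ++ e :: t2 ->
  l.1 = (elit e).1 -> l \in lits t1 -> False.
Proof.
move=> w E el hl; case: (w _ _ _ E) => /negP h _ _; apply: h; by rewrite -el assignedE hl.
Qed.

Lemma wft_consistent tr l : wft tr -> l \in lits tr -> negl l \in lits tr -> False.
Proof.
move=> w /lits_split [t1 [e [t2 [E el]]]].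
rewrite E lits_cat mem_cat => /orP[h|].
  by apply: (wft_uniq w E _ h); rewrite el.
rewrite inE => /orP[/eqP h|h].
  by move: (negl_neq l); rewrite h -el eqxx.
have /lits_split [u1 [e' [u2 [E2 el2]]]] := h.
apply: (wft_uniq (t1 := t1 ++ e :: u1) (e := e') (t2 := u2) (l := l) w).
- by rewrite E E2 -catA.
- by rewrite el2.
- by rewrite lits_cat mem_cat inE el eqxx orbT.
Qed.

Lemma false_underP tr C : reflect (forall l, l \in C -> negl l \in lits tr) (false_under tr C).
Proof. exact: forall_inP. Qed.

Lemma false_under_cat t1 t2 C : false_under t1 C -> false_under (t1 ++ t2) C.
Proof. move/false_underP=> h; apply/false_underP=> l /h; by rewrite lits_cat mem_cat => ->. Qed.

Lemma wft_reason tr t1 e t2 C : wft tr -> tr = t1 ++ e :: t2 -> ereason e = Some C ->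
  [/\ DB C, elit e \in C & forall l, l \in C -> l <> elit e -> negl l \in lits t1].
Proof.
move=> w E r; case: (w _ _ _ E) => _ _ /(_ _ r) [h1 h2 /false_underP h3]; split=> //.
by move=> l lC /eqP ne; apply: h3; rewrite !inE ne.
Qed.

Lemma dlevel_all_some t : all (fun e => isSome (ereason e)) t -> dlevel t = 0.
Proof.
by elim: t => //= e t IH /andP[-> /IH ->].
Qed.

Lemma wft_level_le tr t1 e t2 : wft tr -> tr = t1 ++ e :: t2 ->
  elevel e <= dlevel tr.
Proof.
move=> w E; case: (w _ _ _ E) => _ -> _; rewrite E dlevel_cat /= addnA; apply: leq_addr.
Qed.

Section LastLevel.

Variables (tr0 post : seq (entry V)) (d : entry V).
Let tr := tr0 ++ d :: post.
Hypotheses (w : wft tr) (rd : ereason d = None)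
  (rp : all (fun e => isSome (ereason e)) post).

Lemma dlevel_last : dlevel tr = (dlevel tr0).+1.
Proof. by rewrite dlevel_cat /= rd /= (dlevel_all_some rp) addn0 addn1. Qed.

Lemma filter_last_level : [seq e <- tr | elevel e == dlevel tr] = d :: post.
Proof.
rewrite filter_cat filter_all_false /=; last first.
  apply: all_split => t1 e t2 E.
  have := wft_level_le (wft_catl w) E.
  by rewrite dlevel_last neq_ltn ltnS => ->.
case: (w erefl) => _ -> _; rewrite rd dlevel_last /= addn1 eqxx; congr cons.
apply/all_filterP; apply: all_split => p1 e p2 E.
have := rp; rewrite E all_cat => /andP[/dlevel_all_some h /=/andP[re _]].
case: (w (t1 := tr0 ++ d :: p1) (e := e) (t2 := p2)).
  by rewrite /tr E -catA.
by move=> _ -> _; rewrite re dlevel_cat /= rd h /= !addn0 addn1.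
Qed.

End LastLevel.

Lemma filter_level0 tr0 d post : wft (tr0 ++ d :: post) ->
  all (fun e => isSome (ereason e)) tr0 -> ereason d = None ->
  [seq e <- tr0 ++ d :: post | elevel e == 0] = tr0.
Proof.
move=> w h0 rd; rewrite filter_cat [X in _ ++ X]filter_all_false ?cats0.
  apply/all_filterP; apply: all_split => t1 e t2 E.
  have := wft_level_le (wft_catl w) E; by rewrite (dlevel_all_some h0) leqn0.
apply: all_split => -[|e1 p1] e p2 /= [].
  move=> <- _; case: (w _ _ _ erefl) => _ -> _; by rewrite rd addn1.
move=> _ E; case: (w (tr0 ++ d :: p1) e p2); first by rewrite E -catA.
by move=> _ -> _; rewrite dlevel_cat /= rd -lt0n addn_gt0 addn_gt0 orbT.
Qed.

Lemma wft_disjoint t1 t2 l : wft (t1 ++ t2) -> l \in lits t1 -> l \in lits t2 -> False.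
Proof.
move=> w h /lits_split [u1 [e [u2 [E el]]]].
apply: (wft_uniq (t1 := t1 ++ u1) (e := e) (t2 := u2) (l := l) w).
- by rewrite E catA.
- by rewrite el.
- by rewrite lits_cat mem_cat h.
Qed.

(* Resolving a literal of [S1], or of [S2], with its reason leaves a literal of
   the same set.  So two literals of the last level survive until the pivot [p],
   which precedes the rest of [S2] on the trail, is resolved and leaves [G]. *)
Section Uip.

Variables (tr0 mid post : seq (entry V)) (d p : entry V).
Variables (Cf Cp S1 S2 G : clause V) (u : literal V).
Let tr := tr0 ++ d :: (mid ++ p :: post).
Hypotheses (w : wft tr) (rd : ereason d = None)
  (rp : all (fun e => isSome (ereason e)) (mid ++ p :: post))
  (rCp : ereason p = Some Cp) (GE : Cp :\ elit p = G)
  (dis : forall l, l \in S1 -> l \in S2 -> False)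
  (lev : forall l, l \in S1 :|: S2 -> negl l \notin lits tr0)
  (S2mid : forall l, l \in S2 -> negl l \notin lits (d :: mid))
  (S1mid : forall l, l \in S1 -> negl l \in lits (d :: mid) -> l \in G)
  (Gu : forall l, l \in G -> negl l \in lits (d :: mid) -> l = u)
  (step : forall S p1 e p2 C, S = S1 \/ S = S2 -> post = p1 ++ e :: p2 ->
     ereason e = Some C -> negl (elit e) \in S ->
     (forall l, l \in C -> l <> elit e -> l \in S1 :|: S2 :|: G) /\
     exists l, [/\ l \in C, l <> elit e & l \in S]).

Let good D := (forall l, l \in D -> l \in S1 :|: S2 :|: G) /\
  (forall S, S = S1 \/ S = S2 -> exists2 l, l \in D & l \in S).

Let at_levelE D l : (l \in at_level tr (dlevel tr) D) =
  (l \in D) && (negl l \in lits (d :: mid ++ p :: post)).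
Proof. by rewrite inE (filter_last_level w rd rp). Qed.

Let at_level_good D : false_under tr D -> good D ->
  (#|at_level tr (dlevel tr) D| <= 1) = false.
Proof.
move=> /false_underP fD [_ h]; apply/negbTE; rewrite -ltnNge; apply/card_gt1P.
have [l1 l1D l1S] := h _ (or_introl erefl).
have [l2 l2D l2S] := h _ (or_intror erefl).
exists l1, l2; rewrite !at_levelE l1D l2D /=.
have aux l : l \in D -> l \in S1 :|: S2 -> negl l \in lits (d :: mid ++ p :: post).
  by move=> /fD; rewrite lits_cat mem_cat => /orP[h1|//] /lev; rewrite h1.
split; try by apply: aux; rewrite // inE ?l1S ?l2S ?orbT.
by apply/eqP=> E; apply: (dis l1S); rewrite E.
Qed.

Let uip_rec_good post1 post2 : post = post1 ++ post2 -> forall D,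
  false_under (tr0 ++ d :: (mid ++ p :: post1)) D -> good D ->
  uip_rec tr (rev (tr0 ++ d :: (mid ++ p :: post1))) D = G.
Proof.
elim/last_ind: post1 post2 => [|post1 e IH] post2 E D fD gD.
  have fD' : false_under tr D.
    have -> : tr = (tr0 ++ d :: mid ++ [:: p]) ++ post2.
      by rewrite /tr E -!catA /= -!catA.
    exact: false_under_cat.
  have -> : tr0 ++ d :: mid ++ [:: p] = rcons (tr0 ++ d :: mid) p.
    by rewrite -cats1 -catA.
  rewrite rev_rcons /= at_level_good //.
  have wp := w; rewrite /tr -cat_cons catA in wp.
  have [_ pC fCp] := wft_reason wp erefl rCp.
  have fDp l : l \in D -> l <> negl (elit p) -> negl l \in lits (tr0 ++ d :: mid).
    move=> lD ne; have /false_underP/(_ l lD) := fD.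
    rewrite -[tr0 ++ d :: mid ++ [:: p]]/(tr0 ++ (d :: mid) ++ [:: p]) catA.
    rewrite lits_cat mem_cat inE => /orP[//|/eqP E'].
    by case: ne; rewrite -E' neglK.
  have key l : l \in D -> l \in S1 :|: S2 -> l <> negl (elit p) ->
      negl l \in lits (d :: mid).
    move=> lD /lev lS /(fDp _ lD); rewrite lits_cat mem_cat => /orP[h|//].
    by rewrite h in lS.
  have pD : negl (elit p) \in D.
    have [l lD lS] := gD.2 _ (or_intror erefl).
    have [<- //|/eqP ne] := eqVneq l (negl (elit p)).
    by have := key _ lD; rewrite inE lS orbT => /(_ isT ne) h; have := S2mid lS; rewrite h.
  rewrite pD rCp.
  have -> : resolvent D Cp (elit p) = G.
    rewrite /resolvent GE; apply/setUidPr/subsetP=> l; rewrite !inE => /andP[/eqP ne lD].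
    have := gD.1 _ lD; rewrite !inE -orbA => /or3P[lS|lS|//].
      apply: (S1mid lS); apply: key => //; by rewrite inE lS.
    have := S2mid lS; rewrite key // inE lS orbT //.
  suff le1 : #|at_level tr (dlevel tr) G| <= 1.
    by case: (rev _) => [|e r] /=; rewrite le1.
  apply/card_le1_eqP=> l1 l2.
  have aux l : l \in at_level tr (dlevel tr) G -> l = u.
    rewrite at_levelE => /andP[lG lt]; apply: Gu => //.
    move: lG; rewrite -GE !inE => /andP[/eqP ne lC]; have := fCp _ lC ne.
    rewrite lits_cat mem_cat => /orP[h|//].
    by case: (wft_disjoint w h lt).
  by move=> /aux -> /aux ->.
have E' : post = post1 ++ e :: post2 by rewrite E cat_rcons.
have trE : tr = (tr0 ++ d :: mid ++ p :: post1) ++ e :: post2.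
  by rewrite /tr E' -!catA /= -!catA.
have fD' : false_under tr D.
  suff -> : tr = (tr0 ++ d :: mid ++ p :: rcons post1 e) ++ post2 by exact: false_under_cat.
  by rewrite trE -!cats1 -!catA /= -!catA /= -!catA.
have -> : tr0 ++ d :: mid ++ p :: rcons post1 e = rcons (tr0 ++ d :: mid ++ p :: post1) e.
  by rewrite -!cats1 -!catA /= -!catA.
rewrite rev_rcons /= at_level_good //.
have we := w; rewrite -/tr trE in we.
have fD'' l : l \in D -> l <> negl (elit e) -> negl l \in lits (tr0 ++ d :: mid ++ p :: post1).
  move=> lD ne; have /false_underP/(_ l lD) := fD.
  have -> : tr0 ++ d :: mid ++ p :: rcons post1 e = rcons (tr0 ++ d :: mid ++ p :: post1) e.
    by rewrite -!cats1 -!catA /= -!catA.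
  rewrite lits_rcons mem_rcons inE => /orP[/eqP E2|//].
  by case: ne; rewrite -E2 neglK.
case: ifP => eD; last first.
  apply: (IH (e :: post2)) => //; apply/false_underP=> l lD; apply: fD'' => // E2.
  by rewrite -E2 lD in eD.
have [C rC] : exists C, ereason e = Some C.
  have := rp; rewrite E' all_cat /= all_cat /= => /and4P[_ _ _ /andP[]].
  by case: (ereason e) => // C _; exists C.
rewrite rC; apply: (IH (e :: post2)) => //.
  have [_ eC fC] := wft_reason we erefl rC.
  apply/false_underP=> l; rewrite !inE => /orP[]/andP[/eqP ne lD]; first exact: fD''.
  exact: fC.
have [eU meets] := gD.
have eS : negl (elit e) \in S1 :|: S2.
  have := eU _ eD; rewrite inE => /orP[//|].
  rewrite -GE !inE => /andP[ne nC].
  have wp := w; rewrite /tr -cat_cons catA in wp.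
  have [_ _ /(_ _ nC (elimN eqP ne))] := wft_reason wp erefl rCp.
  rewrite neglK => h; exfalso; apply: (wft_uniq we erefl (l := elit e)) => //.
  by rewrite -[tr0 ++ d :: _]/(tr0 ++ (d :: mid) ++ p :: post1) catA lits_cat mem_cat h.
have st S : S = S1 \/ S = S2 -> negl (elit e) \in S -> _ := fun hS => step hS E' rC.
split=> [l|S hS].
  rewrite inE => /orP[]; rewrite !inE => /andP[/eqP ne lD]; first by have := eU _ lD; rewrite !inE.
  by move: eS; rewrite inE => /orP[h|h];
    [have [/(_ l lD ne)] := st _ (or_introl erefl) h|have [/(_ l lD ne)] := st _ (or_intror erefl) h];
    rewrite !inE.
have [l lD lS] := meets _ hS.
have [El|ne] := eqVneq l (negl (elit e)).
  rewrite El in lS; have [_ [l' [l'C ne' l'S]]] := st _ hS lS; exists l' => //.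
  by rewrite !inE l'C (introN eqP ne') orbT.
by exists l => //; rewrite !inE ne lD.
Qed.

Lemma uip1_pivot : false_under tr Cf ->
  (forall l, l \in Cf -> l \in S1 :|: S2 :|: G) ->
  (exists2 l, l \in Cf & l \in S1) -> (exists2 l, l \in Cf & l \in S2) ->
  uip1 tr Cf = G.
Proof.
move=> fC sC h1 h2; apply: (@uip_rec_good post [::]); rewrite ?cats0 //.
by split=> // S [->|->].
Qed.

End Uip.
End Trails.

Lemma wft_sub (V : finType) (DB DB' : pred (clause V)) tr :
  (forall C, DB C -> DB' C) -> wft DB tr -> wft DB' tr.
Proof.
move=> sub w t1 e t2 E; case: (w _ _ _ E) => h1 h2 h3; split=> // C /h3 [a b c].
by split=> //; apply: sub.
Qed.

Section Steps.

Variables (V : finType) (R : realFieldType).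
Variables (delta : R) (F : {set clause V}) (ord : seq V).
Implicit Types (s : state V) (C : clause V) (l : literal V).

Definition wfs s := wft (clause_of F s) (trail s) /\ qhead s <= size (trail s).

Lemma processed_lits s l : l \in lits (processed s) -> l \in lits (trail s).
Proof. by rewrite -[in lits (trail s)](cat_take_drop (qhead s) (trail s)) lits_cat mem_cat /processed => ->. Qed.

Lemma unit_underP tr C l : unit_under tr C l ->
  [/\ l \in C, ~~ assigned tr l.1 & forall l', l' \in C -> l' <> l -> negl l' \in lits tr].
Proof.
case/and3P=> h1 h2 /false_underP h3; split=> // l' h /eqP ne.
by apply: h3; rewrite !inE ne.
Qed.

Lemma visitedP s C : visited s C ->
  exists pr e, processed s = rcons pr e /\ negl (elit e) \in C.
Proof.
rewrite /visited; case: (lastP (processed s)) => // pr e; rewrite rev_rcons => h.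
by exists pr, e.
Qed.

Lemma used_unit s C l : due s C || visited s C -> unit_under (trail s) C l ->
  (forall l', l' \in C -> l' <> l -> negl l' \in lits (processed s)) \/ visited s C.
Proof.
move=> /orP[|]; last by right.
move=> du /unit_underP [lC un _]; left => l' l'C ne.
case/orP: du => [/false_underP h|/existsP [l0 /andP[/unit_underP [l0C un0 fa] /false_underP h]]].
  exact: h.
have [E|ne0] := eqVneq l l0.
  by apply: h; rewrite !inE -E l'C (introN eqP ne).
have := processed_lits (h l _); rewrite !inE ne0 lC => /(_ isT) h1.
by case/negP: un; rewrite assignedE h1 orbT.
Qed.

Lemma used_false s C : due s C || visited s C -> false_under (trail s) C ->
  (forall l', l' \in C -> negl l' \in lits (processed s)) \/ visited s C.
Proof.
move=> /orP[|]; last by right.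
move=> du /false_underP fa; left.
case/orP: du => [/false_underP //|/existsP [l0 /andP[/unit_underP [l0C un0 _] _]]].
by case/negP: un0; rewrite assignedE (fa _ l0C) orbT.
Qed.

Lemma quiescent_notfalse s C : quiescent F s -> clause_of F s C ->
  ~ (forall l, l \in C -> negl l \in lits (processed s)).
Proof.
by move=> q /q /negP h /false_underP f; apply: h; rewrite /due f.
Qed.

Lemma quiescent_assigned s C l : quiescent F s -> clause_of F s C -> l \in C ->
  (forall l', l' \in C -> l' <> l -> negl l' \in lits (processed s)) ->
  assigned (trail s) l.1.
Proof.
move=> q dC lC h; apply: contraT => un; case/negP: (q _ dC); apply/orP; right.
apply/existsP; exists l; rewrite /unit_under lC un /=.
have f : false_under (processed s) (C :\ l).
  by apply/false_underP=> l'; rewrite !inE => /andP[/eqP ne l'C]; apply: h.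
rewrite f andbT; apply/false_underP=> l' /(false_underP _ _ f).
exact: processed_lits.
Qed.

Lemma wfs_push s l C : wfs s -> clause_of F s C -> unit_under (trail s) C l ->
  wfs (push s (Entry l (dlevel (trail s)) (Some C))).
Proof.
move=> [w q] dC /and3P [lC un fa]; split; last by rewrite size_rcons (leq_trans q).
apply: wft_rcons => //=; split=> //; first by rewrite addn0.
by move=> _ [<-]; split.
Qed.

Lemma wfs_decide s x : wfs s -> ~~ assigned (trail s) x ->
  wfs (push s (Entry (x, false) (dlevel (trail s)).+1 None)).
Proof.
move=> [w q] un; split; last by rewrite size_rcons (leq_trans q).
by apply: wft_rcons => //=; split=> //; rewrite addn1.
Qed.

Lemma halted_cases s : wfs s -> (forall x, x \in ord) ->
  exists c, cdcl_step delta F ord (Running s) c.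
Proof.
move=> [w q] ordT.
have [/forallP quie|] := boolP [forall C, clause_of F s C ==> ~~ due s C]; last first.
  rewrite negb_forall => /existsP [C]; rewrite negb_imply negbK => /andP[dC du].
  have us : due s C || visited s C by rewrite du.
  have [fa|nfa] := boolP (false_under (trail s) C).
    have [z|nz] := posnP (dlevel (trail s)).
      by exists (Unsat (learned s)); apply: Refute dC us fa z.
    by eexists; apply: Learn dC us fa nz.
  case/orP: du => [/false_underP h|/existsP [l /andP[un _]]].
    case/negP: nfa; apply/false_underP=> l /h; exact: processed_lits.
  by eexists; apply: Propagate dC us un.
have qu : quiescent F s by move=> C dC; have := quie C; rewrite dC.
move: q; rewrite leq_eqVlt => /orP[/eqP E|lt]; last by eexists; apply: Dequeue.
have [x0 un0|all] := pickP (fun x => ~~ assigned (trail s) x); last first.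
  exists (Sat (learned s)); apply: Model => // x; exact: negbFE (all x).
pose x := [arg max_(x > x0 | ~~ assigned (trail s) x) vsids delta (learned s) x]%O.
have [b bE] : exists b, branch delta ord s = Some b.
  have : has (top_score delta s) ord.
    apply/hasP; exists x => //; rewrite /x; case: Order.TotalTheory.arg_maxP => // i Pi mi.
    by rewrite /top_score Pi; apply/forallP=> y; apply/implyP=> /mi.
  rewrite has_filter /branch; case: [seq _ <- _ | _] => // b r _; by exists b.
by eexists; apply: Decide qu E bE.
Qed.

End Steps.

(** * The ordering principle with natural-number indices *)

Section Coding.

Variable n : nat.
Notation V := (opvar n).
Implicit Types (x y : V) (l : literal V).

Definition vrow x : nat := (val x).1.
Definition vcol x : nat := (val x).2.

Lemma vrow_lt x : vrow x < n. Proof. exact: ltn_ord. Qed.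
Lemma vcol_lt x : vcol x < n. Proof. exact: ltn_ord. Qed.
Lemma vrow_neq_vcol x : vrow x != vcol x.
Proof. by case: x => -[i j] /= ne; rewrite /vrow /vcol. Qed.

Lemma opvar_eq x y : vrow x = vrow y -> vcol x = vcol y -> x = y.
Proof.
by case: x y => -[i j] p [[i' j'] q]; rewrite /vrow /vcol /= => /val_inj E1 /val_inj E2;
  apply: val_inj; rewrite /= E1 E2.
Qed.

Lemma lit_eq l l' : vrow l.1 = vrow l'.1 -> vcol l.1 = vcol l'.1 -> l.2 = l'.2 -> l = l'.
Proof. by case: l l' => x b [y c] /= h1 h2 ->; rewrite (opvar_eq h1 h2). Qed.

Lemma opvar_ex a b : a < n -> b < n -> a != b -> exists x, vrow x = a /\ vcol x = b.
Proof.
move=> ha hb ne.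
have p : (Ordinal ha, Ordinal hb).1 != (Ordinal ha, Ordinal hb).2 by [].
by exists (Sub (Ordinal ha, Ordinal hb) p).
Qed.

(* A(i,j,k), B(i,j) and C(j,k) with rows and columns counted from 0; D(j) is
   [NC j n.-1]. *)
Inductive nclause := NA of nat & nat & nat | NB of nat & nat | NC of nat & nat.

(* Row [r] is among the first [k] of column [j]; [j < r] accounts for the missing
   diagonal entry. *)
Definition inrows (j k r : nat) : bool := (r != j) && (r < k + (j < r)).

Definition nin (N : nclause) (a b : nat) (v : bool) : bool :=
  match N with
  | NA i j k => [|| [&& a == i, b == j & ~~ v], [&& a == j, b == k & ~~ v]
                  | [&& a == i, b == k & v]]
  | NB i j => [|| [&& a == i, b == j & ~~ v] | [&& a == j, b == i & ~~ v]]
  | NC j k => [&& b == j, inrows j k a & v]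
  end.

Definition cls (N : nclause) : clause V :=
  [set l : V * bool | nin N (vrow l.1) (vcol l.1) l.2].

Lemma in_cls N l : (l \in cls N) = nin N (vrow l.1) (vcol l.1) l.2.
Proof. by rewrite inE. Qed.

Lemma col_major_mem x : x \in col_major n.
Proof.
rewrite mem_pmap_sub; apply/allpairsP; exists ((val x).2, (val x).1).
by rewrite !mem_enum; split=> //=; case: (val x).
Qed.

Definition colmajor_lt x y := (vcol x < vcol y) || (vcol x == vcol y) && (vrow x < vrow y).

Lemma col_major_pairwise : pairwise colmajor_lt (col_major n).
Proof.
pose r (p q : 'I_n * 'I_n) := (p.2 < q.2) || (p.2 == q.2) && (p.1 < q.1).
have -> : pairwise colmajor_lt (col_major n) = pairwise r [seq val x | x <- col_major n].
  by rewrite pairwise_map; apply: eq_pairwise => x y.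
rewrite (pmap_filter (insubK _)); apply: (subseq_pairwise (filter_subseq _ _)).
have so : pairwise (fun i j : 'I_n => i < j) (enum 'I_n).
  rewrite -(pairwise_map val ltn) val_enum_ord.
  by rewrite -sorted_pairwise ?iota_ltn_sorted //; apply: ltn_trans.
suff aux (s t : seq 'I_n) : pairwise (fun i j : 'I_n => i < j) s ->
    pairwise (fun i j : 'I_n => i < j) t -> pairwise r [seq (i, j) | j <- s, i <- t].
  exact: aux.
move=> ps pt; elim: s ps => //= j s IH /andP[js ps].
rewrite pairwise_cat IH // andbT pairwise_map; apply/andP; split; last first.
  by apply: etrans pt; apply: eq_pairwise => i i'; rewrite /r /= ltnn eqxx.
rewrite allrel_mapl; apply/allrelP=> i p _ /allpairsP [[j' i'] /= [j's _ ->]].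
by rewrite /r /= (allP js _ j's).
Qed.

Lemma in_column j x : (x \in column n j.+1) = (vcol x == j).
Proof. by rewrite mem_filter col_major_mem andbT eqSS. Qed.

Lemma map_row_column (j : nat) : j < n ->
  [seq vrow x | x <- column n j.+1] = [seq i <- iota 0 n | i != j].
Proof.
move=> jn; apply: (irr_sorted_eq ltn_trans ltnn).
- rewrite sorted_pairwise; last exact: ltn_trans.
  rewrite pairwise_map.
  have : pairwise colmajor_lt (column n j.+1).
    exact: subseq_pairwise (filter_subseq _ _) col_major_pairwise.
  have : all (fun x => vcol x == j) (column n j.+1).
    by apply/allP=> x; rewrite in_column.
  elim: (column n j.+1) => //= x s IH /andP[/eqP cx cs] /andP[lx ps].
  rewrite IH // andbT; apply/allP=> y ys /=.
  have := allP lx _ ys; rewrite /colmajor_lt cx (eqP (allP cs _ ys)) ltnn eqxx //.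
- by rewrite sorted_filter ?iota_ltn_sorted //; apply: ltn_trans.
move=> r; rewrite mem_filter mem_iota /=; apply/mapP/andP.
  by case=> x; rewrite in_column => /eqP <- ->; rewrite vrow_neq_vcol vrow_lt.
case=> ne rn; have [x [<- cx]] := opvar_ex rn jn ne.
by exists x => //; rewrite in_column cx.
Qed.

Lemma in_take_column j k x : j < n ->
  (x \in take k (column n j.+1)) = (vcol x == j) && inrows j k (vrow x).
Proof.
move=> jn; have [cx|cx] /= := eqVneq (vcol x) j; last first.
  by apply: contraNF cx => /mem_take; rewrite in_column.
have -> : (x \in take k (column n j.+1)) = (vrow x \in take k [seq vrow x | x <- column n j.+1]).
  rewrite -map_take; apply/idP/mapP=> [h|[y yt E]]; first by exists x.
  suff -> : x = y by [].
  by apply: opvar_eq E _; rewrite cx; apply/esym/eqP; rewrite -in_column (mem_take yt).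
rewrite map_row_column //.
have -> : [seq i <- iota 0 n | i != j] = iota 0 j ++ iota j.+1 (n - j.+1).
  rewrite -[X in iota 0 X](subnKC jn) addSnnS iotaD filter_cat /= add0n eqxx /=.
  congr (_ ++ _); apply/all_filterP/allP=> i; rewrite mem_iota; lia.
rewrite take_cat size_iota /inrows; have := vrow_lt x; have := vrow_neq_vcol x; rewrite cx => ne lt.
have [kj|jk] := ltnP k j; first by rewrite take_iota mem_iota; lia.
by rewrite mem_cat take_iota !mem_iota; lia.
Qed.

Lemma colclauseE j k : j < n -> colclause n j.+1 k = cls (NC j k).
Proof.
move=> jn; apply/setP=> -[x v]; rewrite in_cls /=; apply/imsetP/and3P.
  by case=> y; rewrite in_take_column // => /andP[h1 h2] [-> ->].
by case=> h1 h2 hv; exists x; rewrite ?hv // in_take_column // h1.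
Qed.

Lemma in_op_clause (s : seq (('I_n * 'I_n) * bool)) l :
  (l \in op_clause s) = ((val l.1, l.2) \in s).
Proof. by rewrite inE. Qed.

Lemma op_transE (i j k : 'I_n) : op_trans i j k = cls (NA i j k).
Proof.
apply/setP=> -[[[a b] p] v]; rewrite /op_trans in_op_clause in_cls /= /vrow /vcol /=.
rewrite !inE !xpair_eqE -!val_eqE /=.
by case: v; rewrite ?(andbF, andbT, orbF) -?andbA.
Qed.

Lemma op_antisymE (i j : 'I_n) : op_antisym i j = cls (NB i j).
Proof.
apply/setP=> -[[[a b] p] v]; rewrite /op_antisym in_op_clause in_cls /= /vrow /vcol /=.
rewrite !inE !xpair_eqE -!val_eqE /=.
by case: v; rewrite ?(andbF, andbT, orbF) -?andbA.
Qed.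

Lemma op_nonminE (j : 'I_n) : op_nonmin j = cls (NC j n.-1).
Proof.
apply/setP=> -[[[a b] p] v]; rewrite /op_nonmin in_op_clause in_cls /= /inrows /vrow /vcol /=.
have an := ltn_ord a; move: (p) => /= ne; apply/mapP/and3P.
  case=> i; rewrite mem_filter => /andP[ij _] [-> -> ->].
  by rewrite eqxx (_ : (i != j :> nat) = true) //=; split=> //; have := ltn_ord i; have := ltn_ord j; move: ij; rewrite -val_eqE /=; lia.
case=> /eqP/val_inj E h hv; exists a; rewrite ?E ?hv // mem_filter mem_enum andbT.
by move: h; rewrite -E => /andP[].
Qed.

Definition okN (h : seq (nat * nat)) (N : nclause) : Prop :=
  match N with
  | NA i j k => [/\ i < n, j < n & k < n] /\ [/\ i <> j, j <> k & i <> k]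
  | NB i j => [/\ i < n, j < n & i <> j]
  | NC a k => a < n /\ (k = n.-1 \/ (a, k) \in h)
  end.

Definition goodh (h : seq (nat * nat)) : Prop :=
  forall a k, (a, k) \in h -> [/\ a < n, 0 < k & k < n].

Definition learnt (h : seq (nat * nat)) : seq (clause V) :=
  [seq colclause n p.1.+1 p.2 | p <- h].

Lemma nin_code h N a b v : 1 < n -> goodh h -> okN h N -> nin N a b v ->
  [/\ a < n, b < n & a != b].
Proof.
move=> n1 gh; case: N => [i j k|i j|j k] /=; rewrite /inrows.
- by case=> [[? ? ?] [? ? ?]] ?; split; lia.
- by case=> ? ? ? ?; split; lia.
by case=> jn [->|/gh [? ? ?]] ?; split; lia.
Qed.

Lemma nin_ex h N : 1 < n -> goodh h -> okN h N -> exists a b v, nin N a b v.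
Proof.
move=> n1 gh; case: N => [i j k _|i j _|j k] /=.
- by exists i, j, false; rewrite !eqxx.
- by exists i, j, false; rewrite !eqxx.
case=> jn hk; exists (nat_of_bool (j == 0)), j, true; rewrite eqxx /inrows.
have : 0 < k by case: hk => [->|/gh [? ? ?]]; lia.
lia.
Qed.

Lemma clause_ofP h (s : state V) C : goodh h -> learned s = learnt h ->
  clause_of (OP n) s C <-> exists2 N, okN h N & C = cls N.
Proof.
move=> gh E; rewrite /clause_of E !inE; split.
  case/orP=> [/orP[/orP[]|]|].
  - move=> /existsP[i /existsP[j /existsP[k /and4P[h1 h2 h3 /eqP ->]]]].
    exists (NA i j k); last exact: op_transE.
    by split; split; rewrite ?ltn_ord //; apply/eqP.
  - move=> /existsP[i /existsP[j /andP[h1 /eqP ->]]].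
    exists (NB i j); last exact: op_antisymE.
    by split; rewrite ?ltn_ord //; apply/eqP.
  - move=> /existsP[j /eqP ->]; exists (NC j n.-1); last exact: op_nonminE.
    by split; [|left].
  case/mapP=> -[a k] hk ->; have [an _ _] := gh _ _ hk.
  exists (NC a k); last exact: colclauseE.
  by split; [|right].
case=> -[i j k|i j|a k] ok ->.
- case: ok => [[hi hj hk] [/eqP h1 /eqP h2 /eqP h3]]; apply/orP; left; apply/orP; left; apply/orP; left.
  apply/existsP; exists (Ordinal hi); apply/existsP; exists (Ordinal hj); apply/existsP; exists (Ordinal hk).
  by rewrite op_transE eqxx -!val_eqE /= h1 h2 h3.
- case: ok => hi hj /eqP h1; apply/orP; left; apply/orP; left; apply/orP; right.
  apply/existsP; exists (Ordinal hi); apply/existsP; exists (Ordinal hj).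
  by rewrite op_antisymE eqxx -!val_eqE /= h1.
case: ok => an [->|hk].
  apply/orP; left; apply/orP; right; apply/existsP; exists (Ordinal an).
  by rewrite op_nonminE.
by apply/orP; right; apply/mapP; exists (a, k); rewrite // colclauseE.
Qed.

Implicit Types (tr : seq (entry V)) (s : state V).

Definition code l a b v := [/\ vrow l.1 = a, vcol l.1 = b & l.2 = v].

Definition on tr a b v : bool :=
  has (fun l => [&& vrow l.1 == a, vcol l.1 == b & l.2 == v]) (lits tr).

Lemma onP tr a b v : reflect (exists2 l, l \in lits tr & code l a b v) (on tr a b v).
Proof.
apply: (iffP hasP) => -[l hl]; first by case/and3P=> /eqP ? /eqP ? /eqP ?; exists l.
by case=> <- <- <-; exists l; rewrite ?eqxx.
Qed.

Lemma code_inj l l' a b v : code l a b v -> code l' a b v -> l = l'.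
Proof. by case=> <- <- <- [? ? ?]; apply: lit_eq. Qed.

Lemma on_lit tr l a b v : code l a b v -> on tr a b v = (l \in lits tr).
Proof.
move=> c; apply/onP/idP => [[l' hl' c']|hl]; last by exists l.
by rewrite (code_inj c c').
Qed.

Lemma code_negl l a b v : code l a b v -> code (negl l) a b (~~ v).
Proof. by case=> <- <- <-. Qed.

Lemma codeE l : code l (vrow l.1) (vcol l.1) l.2.
Proof. by []. Qed.

Lemma code_ex a b v : a < n -> b < n -> a != b -> exists l, code l a b v.
Proof. by move=> ha hb ne; have [x [<- <-]] := opvar_ex ha hb ne; exists (x, v). Qed.

Lemma on_code tr a b v : on tr a b v -> [/\ a < n, b < n & a != b].
Proof. by case/onP=> l _ [<- <- _]; split; rewrite ?vrow_lt ?vcol_lt ?vrow_neq_vcol. Qed.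

Lemma on_cat t1 t2 a b v : on (t1 ++ t2) a b v = on t1 a b v || on t2 a b v.
Proof. by rewrite /on lits_cat has_cat. Qed.

Lemma on_rcons tr e a b v : on (rcons tr e) a b v <-> on tr a b v \/ code (elit e) a b v.
Proof.
rewrite -cats1 on_cat /on /= orbF; split.
  by case/orP; [left|case/and3P=> /eqP ? /eqP ? /eqP ?; right].
by case=> [->//|[-> -> ->]]; rewrite !eqxx orbT.
Qed.

Lemma on_processed s a b v : on (processed s) a b v -> on (trail s) a b v.
Proof. by case/onP=> l /processed_lits hl c; apply/onP; exists l. Qed.

Lemma on_consistent DB tr a b : wft DB tr -> on tr a b true -> on tr a b false -> False.
Proof.
move=> w /onP [l hl c]; have := on_lit tr (code_negl c) => /= -> h.
exact: wft_consistent w hl h.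
Qed.

Lemma assigned_on tr l a b v : code l a b v ->
  assigned tr l.1 = on tr a b true || on tr a b false.
Proof.
move=> c; rewrite assignedE -(on_lit _ c) -(on_lit _ (code_negl c)).
by case: v c => // _; rewrite orbC.
Qed.

Definition nfalse (A : nat -> nat -> bool -> bool) N :=
  forall a b v, nin N a b v -> A a b (~~ v).

Definition nothers (A : nat -> nat -> bool -> bool) N a b v := forall a' b' v',
  nin N a' b' v' -> (a', b', v') <> (a, b, v) -> A a' b' (~~ v').

Definition nunit (A : nat -> nat -> bool -> bool) N a b v :=
  [/\ nin N a b v, ~~ A a b true, ~~ A a b false & nothers A N a b v].

Definition lastp s a b v := exists pr e, processed s = rcons pr e /\ code (elit e) a b v.

Definition nvisited (L : nat -> nat -> bool -> Prop) N :=
  exists a b v, nin N a b v /\ L a b (~~ v).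

Section OpStep.

Variables (R : realFieldType) (delta : R) (h : seq (nat * nat)).
Hypotheses (n1 : 1 < n) (gh : goodh h).

Inductive op_step s : config V -> Prop :=
  | OpPropagate N l : okN h N -> nunit (on (trail s)) N (vrow l.1) (vcol l.1) l.2 ->
      nothers (on (processed s)) N (vrow l.1) (vcol l.1) l.2 \/ nvisited (lastp s) N ->
      op_step s (Running (push s (Entry l (dlevel (trail s)) (Some (cls N)))))
  | OpDequeue : quiescent (OP n) s -> qhead s < size (trail s) ->
      op_step s (Running (State (trail s) (qhead s).+1 (learned s)))
  | OpLearn N : okN h N -> nfalse (on (trail s)) N ->
      nfalse (on (processed s)) N \/ nvisited (lastp s) N -> 0 < dlevel (trail s) ->
      op_step s (Running (restart s (uip1 (trail s) (cls N))))
  | OpRefute N : okN h N -> nfalse (on (trail s)) N ->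
      nfalse (on (processed s)) N \/ nvisited (lastp s) N -> dlevel (trail s) = 0 ->
      op_step s (Unsat (learned s))
  | OpDecide x : quiescent (OP n) s -> qhead s = size (trail s) ->
      branch delta (col_major n) s = Some x ->
      op_step s (Running (push s (Entry (x, false) (dlevel (trail s)).+1 None)))
  | OpModel : quiescent (OP n) s -> qhead s = size (trail s) ->
      (forall x, assigned (trail s) x) -> op_step s (Sat (learned s)).

Lemma nothersP tr N l : okN h N -> nothers (on tr) N (vrow l.1) (vcol l.1) l.2 <->
  (forall l', l' \in cls N -> l' <> l -> negl l' \in lits tr).
Proof.
move=> ok; split=> [H l'|H a b v nn ne].
  rewrite in_cls => nn ne; rewrite -(on_lit tr (code_negl (codeE l'))); apply: H => //.
  by case=> ? ? ?; apply: ne; apply: lit_eq.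
have [ha hb hab] := nin_code n1 gh ok nn; have [l' c] := code_ex v ha hb hab.
rewrite (on_lit tr (code_negl c)); apply: H.
  by rewrite in_cls; case: c => -> -> ->.
by move=> E; apply: ne; case: c; rewrite E => -> -> ->.
Qed.

Lemma nfalseP tr N : okN h N -> nfalse (on tr) N <->
  (forall l', l' \in cls N -> negl l' \in lits tr).
Proof.
move=> ok; split=> [H l'|H a b v nn].
  by rewrite in_cls => nn; rewrite -(on_lit tr (code_negl (codeE l'))); apply: H.
have [ha hb hab] := nin_code n1 gh ok nn; have [l' c] := code_ex v ha hb hab.
rewrite (on_lit tr (code_negl c)); apply: H.
by rewrite in_cls; case: c => -> -> ->.
Qed.

Lemma nvisitedP s N : visited s (cls N) -> nvisited (lastp s) N.
Proof.
case/visitedP=> pr [e [E]]; rewrite in_cls => nn.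
exists (vrow (elit e).1), (vcol (elit e).1), (~~ (elit e).2); split=> //.
by exists pr, e; rewrite negbK.
Qed.

Variable s : state V.
Hypotheses (ls : learned s = learnt h).

Let DBP C := clause_ofP C gh ls.

Lemma op_stepP c : cdcl_step delta (OP n) (col_major n) (Running s) c -> op_step s c.
Proof.
move E: (Running s) => c0 st; case: st E ls => {c}.
- move=> s' C l dC us un [E] _; subst s'.
  have [N ok EC] := (DBP C).1 dC; subst C.
  have [lC una fa] := unit_underP un.
  apply: OpPropagate => //.
    split; [by rewrite -in_cls| | |by apply/nothersP];
    by apply: contra una; rewrite (assigned_on _ (codeE l)) => ->; rewrite ?orbT.
  by case: (used_unit us un) => [H|/nvisitedP]; [left; apply/nothersP|right].
- by move=> s' q lt [E] _; subst s'; apply: OpDequeue.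
- move=> s' C dC us fa lv [E] _; subst s'.
  have [N ok EC] := (DBP C).1 dC; subst C.
  apply: OpLearn => //; first by apply/nfalseP=> // l; apply/false_underP.
  by case: (used_false us fa) => [H|/nvisitedP]; [left; apply/nfalseP|right].
- move=> s' C dC us fa lv [E] _; subst s'.
  have [N ok EC] := (DBP C).1 dC; subst C.
  apply: (OpRefute ok) => //; first by apply/nfalseP=> // l; apply/false_underP.
  by case: (used_false us fa) => [H|/nvisitedP]; [left; apply/nfalseP|right].
- by move=> s' x q E' b [E] _; subst s'; apply: OpDecide.
- by move=> s' q E' b [E] _; subst s'; apply: OpModel.
Qed.

Lemma wfs_push_cls N l : wfs (OP n) s -> okN h N ->
  nunit (on (trail s)) N (vrow l.1) (vcol l.1) l.2 ->
  wfs (OP n) (push s (Entry l (dlevel (trail s)) (Some (cls N)))).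
Proof.
move=> ws ok [nn u1 u2 no]; apply: wfs_push => //; first by apply/DBP; exists N.
apply/and3P; split; rewrite ?in_cls ?(assigned_on _ (codeE l)) ?negb_or ?u1 //.
by apply/false_underP=> l'; rewrite in_setD1 => /andP[/eqP ne lC]; apply: (nothersP (trail s) l ok).1.
Qed.

Hypotheses (q : quiescent (OP n) s).

Lemma nq_notfalse N : okN h N -> ~ nfalse (on (processed s)) N.
Proof.
move=> ok /(nfalseP _ ok); apply: quiescent_notfalse q _.
by apply/DBP; exists N.
Qed.

Lemma nq_assigned N a b v : okN h N -> nin N a b v -> nothers (on (processed s)) N a b v ->
  on (trail s) a b true || on (trail s) a b false.
Proof.
move=> ok nn no; have [ha hb hab] := nin_code n1 gh ok nn.
have [l c] := code_ex v ha hb hab; rewrite -(assigned_on _ c).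
apply: (quiescent_assigned (C := cls N) q).
- by apply/DBP; exists N.
- by rewrite in_cls; case: c => -> -> ->.
by apply/nothersP => //; case: c => -> -> ->.
Qed.

Lemma nq_full N a b v : qhead s = size (trail s) -> okN h N -> nin N a b v ->
  nothers (on (trail s)) N a b v -> on (trail s) a b v.
Proof.
move=> qs ok nn no.
have E : processed s = trail s by rewrite /processed qs take_size.
have := nq_assigned ok nn; rewrite E => /(_ no).
suff : ~~ on (trail s) a b (~~ v) by case: v {nn no} => /negbTE ->; rewrite ?orbF.
apply/negP=> nv; apply: (nq_notfalse ok); rewrite E => a' b' v' nn'.
have [[-> -> ->]//|/eqP ne] := eqVneq (a', b', v') (a, b, v).
exact: no.
Qed.

End OpStep.

Section Scores.

Variables (R : realFieldType) (delta : R).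
Hypotheses (d0 : (0 < delta)%R) (d2 : (delta <= 2^-1)%R).

Definition occ a b (p : nat * nat) := (b == p.1) && inrows p.1 p.2 a.

Lemma occursE h x : goodh h -> forall p, p \in h ->
  occurs x (colclause n p.1.+1 p.2) = occ (vrow x) (vcol x) p.
Proof.
move=> gh [a k] /gh [an _ _]; rewrite /occurs colclauseE // !in_cls /= /occ /=.
by rewrite !andbF !andbT orbF.
Qed.

Import Order.TTheory GRing.Theory Num.Theory.
Local Open Scope ring_scope.

Definition score h a b : R := foldl (fun q p => (occ a b p)%:R + delta * q) 0 h.

Lemma vsidsE h x : goodh h -> vsids delta (learnt h) x = score h (vrow x) (vcol x).
Proof.
rewrite /vsids /score /learnt; elim/last_ind: h => // h p IH gh.
rewrite map_rcons !foldl_rcons IH ?(occursE _ gh) // ?mem_rcons ?inE ?eqxx //.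
by move=> a k hk; apply: gh; rewrite mem_rcons inE hk orbT.
Qed.

Lemma score_bounds h a b : 0 <= score h a b < 2.
Proof.
rewrite /score; elim/last_ind: h => [|h p /andP[]]; first by rewrite lexx ltr0n.
rewrite foldl_rcons; set q := foldl _ _ _ => q0 q2.
have dq0 : 0 <= delta * q by rewrite mulr_ge0 // ltW.
have dq1 : delta * q < 1.
  apply: le_lt_trans (_ : 2^-1 * q < 1); first exact: ler_wpM2r.
  by rewrite mulrC ltr_pdivrMr ?ltr0n // mul1r.
rewrite addr_ge0 ?ler0n //= (_ : 2 = 1 + 1) // ler_ltD //.
by case: (occ _ _ _); rewrite ?ler01.
Qed.

Lemma score_eq h a b a' b' : {in h, forall p, occ a b p = occ a' b' p} ->
  score h a b = score h a' b'.
Proof.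
rewrite /score; elim/last_ind: h => // h p IH H.
rewrite !foldl_rcons H ?mem_rcons ?inE ?eqxx // IH // => p' hp.
by apply: H; rewrite mem_rcons inE hp orbT.
Qed.

Lemma score_lt h1 p h2 a b a' b' : occ a b p -> ~~ occ a' b' p ->
  {in h2, forall p, occ a b p = occ a' b' p} ->
  score (h1 ++ p :: h2) a' b' < score (h1 ++ p :: h2) a b.
Proof.
move=> o1 /negbTE o2; rewrite /score !foldl_cat /= o1 o2.
rewrite -/(score h1 a b) -/(score h1 a' b').
set q := score h1 a' b'; set q' := score h1 a b.
have dq1 : delta * q < 1.
  have /andP[q0 q2] : 0 <= q < 2 := score_bounds h1 a' b'.
  apply: le_lt_trans (_ : 2^-1 * q < 1); first exact: ler_wpM2r.
  by rewrite mulrC ltr_pdivrMr ?ltr0n // mul1r.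
have q'0 : 0 <= delta * q'.
  have /andP[q0 q2] : 0 <= q' < 2 := score_bounds h1 a b.
  by rewrite mulr_ge0 // ltW.
have : 0%:R + delta * q < 1%:R + delta * q'.
  by rewrite add0r (lt_le_trans dq1) // lerDl.
move: (_ + _) (_ + _) => x y; elim: h2 x y => //= p' h2 IH x y xy H.
apply: IH; first by rewrite H ?inE ?eqxx // ltrD2l ltr_pM2l.
by move=> p2 hp; apply: H; rewrite inE hp orbT.
Qed.

End Scores.

End Coding.

(** * Levels without conflict *)

Section Branch.

Variables (n : nat) (R : realFieldType) (delta : R).
Notation V := (opvar n).
Variables (h : seq (nat * nat)).
Hypotheses (gh : goodh n h).
Import Order.TTheory GRing.Theory Num.Theory.

Lemma branch_some (s : state V) x : learned s = learnt n h -> ~~ assigned (trail s) x ->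
  (forall y, ~~ assigned (trail s) y -> y <> x ->
     (score delta h (vrow y) (vcol y) < score delta h (vrow x) (vcol x))%R \/
     score delta h (vrow y) (vcol y) = score delta h (vrow x) (vcol x) /\ colmajor_lt x y) ->
  branch delta (col_major n) s = Some x.
Proof.
move=> ls ux H.
have tx : top_score delta s x.
  rewrite /top_score ux; apply/forallP=> y; apply/implyP=> uy.
  rewrite ls !(vsidsE delta _ gh).
  have [->//|/eqP ne] := eqVneq y x.
  by case: (H y uy ne) => [/ltW//|[-> _]].
rewrite /branch.
have xf : x \in [seq x <- col_major n | top_score delta s x] by rewrite mem_filter tx col_major_mem.
have : pairwise (@colmajor_lt n) [seq x <- col_major n | top_score delta s x].
  exact: subseq_pairwise (filter_subseq _ _) (col_major_pairwise n).
have : all (top_score delta s) [seq x <- col_major n | top_score delta s x] by apply: filter_all.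
case: [seq _ <- _ | _] xf => // z t; rewrite inE => xz /= /andP[tz _] /andP[/allP zt _].
congr Some; have [//|/eqP ne] := eqVneq z x.
have {}xz : x \in t by case/orP: xz => // /eqP E; rewrite E in ne.
have lzx := zt _ xz.
case/andP: tz => uz /forallP/(_ x)/implyP/(_ ux); rewrite ls !(vsidsE delta _ gh).
case: (H z uz ne) => [lt|[_ lxz]]; first by rewrite leNgt lt.
by exfalso; move: lzx lxz; rewrite /colmajor_lt; lia.
Qed.

End Branch.

Definition consistent (A : nat -> nat -> bool -> Prop) :=
  forall a b, A a b true -> A a b false -> False.

Section Plan.

Variables (n : nat) (R : realFieldType) (delta : R).
Notation V := (opvar n).
Variables (h : seq (nat * nat)).
Hypotheses (n1 : 1 < n) (gh : goodh n h).

Definition upc (A : nat -> nat -> bool -> Prop) := forall N, okN n h N ->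
  forall a b v, nin N a b v ->
  (forall a' b' v', nin N a' b' v' -> (a', b', v') <> (a, b, v) -> A a' b' (~~ v')) ->
  A a b v.

Lemma upc_notfalse A N : upc A -> consistent A -> okN n h N ->
  (forall a b v, nin N a b v -> A a b (~~ v)) -> False.
Proof.
move=> uA cA ok H; have [a [b [v nn]]] := nin_ex n1 gh ok.
have h1 := uA _ ok _ _ _ nn (fun a' b' v' nn' _ => H _ _ _ nn').
by have h2 := H _ _ _ nn; case: v h1 h2 {nn} => h1 h2; apply: (cA a b).
Qed.

Lemma upc_trail (s : state V) : quiescent (OP n) s -> qhead s = size (trail s) ->
  learned s = learnt n h -> upc (on (trail s)).
Proof. by move=> q qs ls N ok a b v nn no; apply: (nq_full n1 gh ls q qs ok nn). Qed.

Lemma upc_A A i j k : upc A -> i < n -> j < n -> k < n -> i <> j -> j <> k -> i <> k ->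
  [/\ A i j true -> A j k true -> A i k true,
      A i j true -> A i k false -> A j k false
    & A j k true -> A i k false -> A i j false].
Proof.
move=> uA hi hj hk ij jk ik; have ok : okN n h (NA i j k) by [].
split=> h1 h2; apply: (uA _ ok); rewrite /= ?eqxx ?orbT // => a' b' v' /or3P[];
  case/and3P=> /eqP -> /eqP -> hv //; case: v' hv => // _; tauto.
Qed.

Lemma upc_B A i j : upc A -> i < n -> j < n -> i <> j -> A i j true -> A j i false.
Proof.
move=> uA hi hj ij h1; apply: (uA (NB i j)); rewrite /= ?eqxx ?orbT // => a' b' v' /orP[];
  case/and3P=> /eqP -> /eqP -> hv //; case: v' hv => // _; tauto.
Qed.

Lemma upc_C A a k r : upc A -> okN n h (NC a k) -> inrows a k r ->
  (forall r', inrows a k r' -> r' <> r -> A r' a false) -> A r a true.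
Proof.
move=> uA ok hr H; apply: (uA _ ok); rewrite /= ?eqxx ?hr // => a' b' v' /and3P[/eqP -> hr' hv].
by case: v' hv => // _ ne; apply: H => // E; rewrite E in ne.
Qed.

Lemma upc_intro (A : nat -> nat -> bool -> Prop) :
  (forall i j k, i < n -> j < n -> k < n -> i <> j -> j <> k -> i <> k ->
   [/\ A i j true -> A j k true -> A i k true,
      A i j true -> A i k false -> A j k false
    & A j k true -> A i k false -> A i j false]) ->
  (forall i j, i < n -> j < n -> i <> j -> A i j true -> A j i false) ->
  (forall a k r, okN n h (NC a k) -> inrows a k r ->
    (forall r', inrows a k r' -> r' <> r -> A r' a false) -> A r a true) ->
  upc A.
Proof.
move=> hA hB hC [i j k|i j|a k] ok a' b' v' /=.
- case: ok => [[hi hj hk] [ij jk ik]]; have [H1 H2 H3] := hA _ _ _ hi hj hk ij jk ik.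
  case/or3P=> /and3P[/eqP -> /eqP -> hv] H; case: v' hv H => // _ H.
  + apply: H3; [apply: (H j k false)|apply: (H i k true)]; rewrite /= ?eqxx ?orbT //; congruence.
  + apply: H2; [apply: (H i j false)|apply: (H i k true)]; rewrite /= ?eqxx ?orbT //; congruence.
  + apply: H1; [apply: (H i j false)|apply: (H j k false)]; rewrite /= ?eqxx ?orbT //; congruence.
- case: ok => hi hj ij.
  case/orP=> /and3P[/eqP -> /eqP -> hv] H; case: v' hv H => // _ H; apply: hB => //; try congruence.
  + by apply: (H j i false); rewrite /= ?eqxx ?orbT //; congruence.
  + by apply: (H i j false); rewrite /= ?eqxx ?orbT //; congruence.
case/and3P=> /eqP -> hr hv H; case: v' hv H => // _ H; apply: hC ok hr _ => r' hr' ne.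
by apply: (H r' a true); rewrite /= ?eqxx ?hr' //; congruence.
Qed.

Variables (f : nat) (Bs : nat -> nat -> nat -> bool -> Prop) (dr dc : nat -> nat).

(* With [i <= f] decisions made, propagation ends in the assignment [Bs i]; the
   next decision is P(dr i, dc i), and it leads to a conflict when [i = f]. *)
Record plan : Prop := Plan {
  plan_upc : forall i, i <= f -> upc (Bs i);
  plan_consistent : forall i, i <= f -> consistent (Bs i);
  plan_sub : forall i, i < f -> forall a b v, Bs i a b v -> Bs i.+1 a b v;
  plan_dec : forall i, i < f -> Bs i.+1 (dr i) (dc i) false;
  plan_gen : forall i, i <= f -> forall A : nat -> nat -> bool -> Prop,
    upc A -> consistent A -> (forall a b v, A a b v -> Bs i a b v) ->
    (0 < i -> (forall a b v, Bs i.-1 a b v -> A a b v) /\ A (dr i.-1) (dc i.-1) false) ->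
    forall a b v, Bs i a b v -> A a b v;
  plan_branch : forall i, i <= f -> forall s : state V, learned s = learnt n h ->
    (forall a b v, on (trail s) a b v <-> Bs i a b v) ->
    exists x, [/\ branch delta (col_major n) s = Some x, ~~ assigned (trail s) x,
                  vrow x = dr i & vcol x = dc i]
}.

Definition snap (tr : seq (entry V)) := forall t1 e t2, tr = t1 ++ e :: t2 ->
  ereason e = None ->
  (forall a b v, on t1 a b v <-> Bs (dlevel t1) a b v) /\
  code (elit e) (dr (dlevel t1)) (dc (dlevel t1)) false.

Definition base_inv (s : state V) := dlevel (trail s) <= f /\
  forall a b v, on (trail s) a b v -> Bs (dlevel (trail s)) a b v.

Definition final_start (s' : state V) := exists s x,
  [/\ [/\ quiescent (OP n) s, qhead s = size (trail s) & dlevel (trail s) = f],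
      forall a b v, on (trail s) a b v <-> Bs f a b v,
      code (x, false) (dr f) (dc f) false &
      s' = push s (Entry (x, false) (dlevel (trail s)).+1 None)].

Lemma last_decision (tr : seq (entry V)) d : dlevel tr = d.+1 ->
  exists t1 e t2, [/\ tr = t1 ++ e :: t2, ereason e = None, dlevel t1 = d
                    & all (fun e => isSome (ereason e)) t2].
Proof.
elim/last_ind: tr => // tr e IH; rewrite -cats1 dlevel_cat /= addn0.
case re: (ereason e) => [C|] /=.
  rewrite addn0 => /IH [t1 [e' [t2 [-> h1 h2 h3]]]].
  by exists t1, e', (t2 ++ [:: e]); rewrite -catA all_cat h3 /= re.
by rewrite addn1 => -[E]; exists tr, e, [::].
Qed.

Lemma snap_push (s : state V) l lev C : snap (trail s) ->
  snap (trail (push s (Entry l lev (Some C)))).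
Proof.
move=> sn t1 e t2 /= /rcons_split [[_ -> _] //|[t2' _ E]]; exact: sn E.
Qed.

Hypothesis P : plan.

Lemma base_step (s : state V) c : wfs (OP n) s -> learned s = learnt n h ->
  snap (trail s) -> base_inv s -> op_step delta h s c ->
  exists s', [/\ c = Running s', wfs (OP n) s', learned s' = learnt n h, snap (trail s')
    & base_inv s' \/ final_start s'].
Proof.
move=> ws ls sn [df bs] st.
have uB := plan_upc P df; have cB := plan_consistent P df.
have nof N : okN n h N -> ~ nfalse (on (trail s)) N.
  by move=> ok nf; apply: (upc_notfalse uB cB ok) => a b v /nf; apply: bs.
have full : quiescent (OP n) s -> qhead s = size (trail s) ->
    forall a b v, on (trail s) a b v <-> Bs (dlevel (trail s)) a b v.
  move=> q qs a b v; split; first exact: bs.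
  apply: (plan_gen P df (A := on (trail s))) => //.
  + exact: upc_trail.
  + move=> a' b'; apply: on_consistent; exact: ws.1.
  move=> dl; case dE : (dlevel (trail s)) dl => [//|d] _.
  have [t1 [e [t2 [tE re d1 _]]]] := last_decision dE.
  have [h1 h2] := sn _ _ _ tE re; rewrite d1 in h1 h2; split=> /= [a' b' v'|].
    by rewrite tE on_cat => /h1 ->.
  by rewrite (on_lit _ h2) tE lits_cat mem_cat inE eqxx orbT.
case: st ls => {c}.
- move=> N l ok [nn u1 u2 no] us ls; eexists; split; first reflexivity; last left.
  + apply: wfs_push => //; first by apply/(clause_ofP _ gh ls); exists N.
    apply/and3P; split; rewrite ?in_cls ?(assigned_on _ (codeE l)) ?negb_or ?u1 //.
    apply/false_underP=> l'; rewrite in_setD1 => /andP[/eqP ne lC].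
    by apply: (nothersP n1 gh (trail s) l ok).1.
  + by [].
  + exact: snap_push.
  rewrite /base_inv /= -cats1 dlevel_cat /= !addn0; split=> // a b v.
  rewrite cats1 => /on_rcons [/bs//|/= [<- <- <-]]; apply: (uB _ ok) => // a' b' v' nn' ne.
  by apply: bs; apply: no.
- move=> q lt ls; eexists; split; first reflexivity; try by [].
  + by case: ws => w _; split.
  by left.
- by move=> N ok /(nof N ok).
- by move=> N ok /(nof N ok).
- move=> x q qs br ls.
  have onB := full q qs.
  have [x' [br' ux rx cx]] := plan_branch P df ls onB.
  move: br'; rewrite br => -[E]; subst x'.
  eexists; split; first reflexivity.
  + exact: wfs_decide.
  + by [].
  + move=> t1 e t2 /= /rcons_split [[-> -> _] //|[t2' _ E]]; exact: sn E.
  case: (ltnP (dlevel (trail s)) f) => [lt|ge]; [left|right].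
    rewrite /base_inv /= -cats1 dlevel_cat /= !addn0 addn1; split=> // a b v.
    rewrite cats1 => /on_rcons [/bs|/= [<- <- <-]]; first exact: plan_sub.
    by rewrite /= rx cx; apply: plan_dec.
  have dE : dlevel (trail s) = f by lia.
  by exists s, x; rewrite -dE.
move=> q qs al ls.
have onB := full q qs.
have [x' [br' ux rx cx]] := plan_branch P df ls onB.
by rewrite al in ux.
Qed.

End Plan.

(** * The conflict level when C(m,m-1) is available *)

Section GammaNat.

Variables (n : nat) (h : seq (nat * nat)) (j m x q : nat) (ind : bool).
Hypotheses (n1 : 1 < n) (gh : goodh n h).

(* [m] is the row of the pivot P(m,j) and [q] the last row below it.  P(j,x) is
   the variable true before the last decision, with [x >= n] when there is none.
   The last decision is P(q,x) if [ind] holds, and P(q,j) otherwise.  [core]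
   describes the assignment when the pivot becomes unit. *)
Definition coreF a b := b = j /\ a < m /\ a <> j \/ ind /\ b = x /\ a < m /\ a <> x /\ a <> j.
Definition coreT a b := x < n /\ a = j /\ b = x.
Definition gcore a b (v : bool) := if v then coreT a b else coreF a b.
(* Once all P(i,m) with [i < m] are false, literals of node [m.+1] may still be
   propagated before the conflict is taken up; they are never dequeued. *)
Definition gjunk a b (v : bool) := if v then a = m.+1 else b = m.+1.
(* Literals propagated when the pivot is dequeued. *)
Definition late_lit a b (v : bool) := if v then x < n /\ a = m /\ b = x else b = m /\ a < m.

Record gamma_params : Prop := GammaParams {
  jm : j < m; mn : m < n; m2 : 1 < m; qm : q < m; qj : q <> j;
  qmax : forall r, r < m -> r <> j -> r <= q;
  xm : x < n -> x < m /\ x <> j /\ x <> q;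
  indx : ind -> x < n;
  Kpivot : okN n h (NC j m);
  Kconfl : okN n h (NC m m);
  Km : forall k, okN n h (NC m k) -> m <= k;
  Kj' : forall k, okN n h (NC m.+1 k) -> 1 < k;
  Kother : forall a k r, okN n h (NC a k) -> a <> m -> inrows a k r ->
    (forall r', inrows a k r' -> r' <> r -> coreF r' a) ->
    [/\ a = j, k = m & r = m] \/ coreT r a
}.

Hypothesis G : gamma_params.

Variables (t p : nat -> nat -> bool -> bool) (lp : nat -> nat -> bool -> Prop).

Definition late := exists a b v, p a b v /\ late_lit a b v.

Record gamma_facts : Prop := GammaFacts {
  g_code : forall a b v, t a b v -> [/\ a < n, b < n & a != b];
  g_in : forall a b v, t a b v -> gcore a b v \/ a = m /\ b = j /\ v \/ late_lit a b v \/ gjunk a b v;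
  g_p : forall a b v, p a b v -> t a b v;
  g_pjunk : forall a b v, p a b v -> ~ gjunk a b v;
  g_dec : late \/ ~ late;
  g_full : late -> forall i, i < m -> t i m false;
  g_junk : forall a b v, t a b v -> gjunk a b v -> late;
  g_pivot : (x < n /\ t m x true) \/ t j m false -> p m j true;
  g_last : ~ late -> p m j true -> forall a b v, lp a b v -> [/\ a = m, b = j & v];
  g_lp : forall a b v, lp a b v -> p a b v;
  g_lpx : x < n -> ~ lp j x true;
  g_pivotF : t m j true -> forall r, r < m -> r <> j -> t r j false;
  g_x : x < n -> t j x true;
  g_F : forall r, r < m -> r <> j -> r <> q -> t r j false
}.

Hypothesis H : gamma_facts.

Inductive gamma_alw : nclause -> nat -> nat -> bool -> Prop :=
  | AlwU N : ind -> gamma_alw N q j false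
  | AlwPivot : gamma_alw (NC j m) m j true
  | AlwLay i : i < m -> i <> j -> gamma_alw (NA i m j) i m false
  | AlwLayJ : p m j true -> gamma_alw (NB m j) j m false
  | AlwLayJ' : p m j true -> gamma_alw (NB j m) j m false
  | AlwX : x < n -> p m j true -> gamma_alw (NA m j x) m x true
  | AlwJunk N a b v : late -> gjunk a b v -> gamma_alw N a b v.

Lemma gamma_alw_inv N a b v : gamma_alw N a b v ->
  (ind /\ [/\ a = q, b = j & v = false]) \/
  (N = NC j m /\ [/\ a = m, b = j & v = true]) \/
  ([/\ a < m, a <> j, N = NA a m j, b = m & v = false]) \/
  (p m j true /\ (N = NB m j \/ N = NB j m) /\ [/\ a = j, b = m & v = false]) \/
  (p m j true /\ x < n /\ [/\ N = NA m j x, a = m, b = x & v = true]) \/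
  (late /\ gjunk a b v).
Proof.
case=> [N' i||i im ij|P|P|xn P|N' a' b' v' L J].
- by left.
- by right; left.
- by right; right; left.
- by do 3 right; left; split=> //; split; [left|].
- by do 3 right; left; split=> //; split; [right|].
- by do 4 right; left.
- by do 5 right.
Qed.

Lemma alw_junk_late N a b v : gamma_alw N a b v -> gjunk a b v -> late.
Proof.
have [jm mn m2 qm qj qmax xm indx _ _ _ _ _] := G.
by case/gamma_alw_inv => [[_ []]|[[_ []]|[[_ _ _]|[[_ [_ []]]|[[_ [xn []]]|[]]]]]] //;
  move=> *; exfalso; subst; match goal with J : gjunk _ _ _ |- _ => rewrite /gjunk in J end;
  try (have := xm xn); lia.
Qed.

Lemma tT a b : t a b true ->
  [/\ a < n, b < n & a != b] /\
  [\/ x < n /\ a = j /\ b = x, a = m /\ b = j, x < n /\ a = m /\ b = x | a = m.+1].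
Proof.
move=> T; split; first exact: g_code T.
by case: (g_in H T) => [?|[[? []]|[?|?]]]; [constructor 1|constructor 2|constructor 3|constructor 4].
Qed.

Lemma tF a b : t a b false ->
  [/\ a < n, b < n & a != b] /\
  [\/ b = j /\ a < m /\ a <> j, ind /\ b = x /\ a < m /\ a <> x /\ a <> j, b = m /\ a < m | b = m.+1].
Proof.
move=> T; split; first exact: g_code T.
case: (g_in H T) => [[?|?]|[[? []]|[?|?]]] //; by [constructor 1|constructor 2|constructor 3|constructor 4].
Qed.

Lemma NA_others (A : nat -> nat -> bool -> bool) i k l a b v : nothers A (NA i k l) a b v ->
  [/\ (a, b, v) <> (i, k, false) -> A i k true, (a, b, v) <> (k, l, false) -> A k l true
    & (a, b, v) <> (i, l, true) -> A i l false].
Proof.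
move=> no; split=> ne.
- by apply: (no i k false); rewrite /= ?eqxx //; congruence.
- by apply: (no k l false); rewrite /= ?eqxx ?orbT //; congruence.
- by apply: (no i l true); rewrite /= ?eqxx ?orbT //; congruence.
Qed.

Lemma NA_visited (L : nat -> nat -> bool -> Prop) i k l : nvisited L (NA i k l) ->
  [\/ L i k true, L k l true | L i l false].
Proof.
by case=> a [b [v [/= /or3P[]/and3P[/eqP -> /eqP -> hv]]]]; case: v hv => // _ ?;
  [constructor 1|constructor 2|constructor 3].
Qed.

Lemma NB_others (A : nat -> nat -> bool -> bool) i k a b v : nothers A (NB i k) a b v ->
  ((a, b, v) <> (i, k, false) -> A i k true) /\ ((a, b, v) <> (k, i, false) -> A k i true).
Proof.
move=> no; split=> ne.
- by apply: (no i k false); rewrite /= ?eqxx //; congruence.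
- by apply: (no k i false); rewrite /= ?eqxx ?orbT //; congruence.
Qed.

Lemma NB_visited (L : nat -> nat -> bool -> Prop) i k : nvisited L (NB i k) ->
  L i k true \/ L k i true.
Proof.
by case=> a [b [v [/= /orP[]/and3P[/eqP -> /eqP -> hv]]]]; case: v hv => // _ ?; [left|right].
Qed.

Lemma NC_others (A : nat -> nat -> bool -> bool) a k r : nothers A (NC a k) r a true ->
  forall r', inrows a k r' -> r' <> r -> A r' a false.
Proof.
by move=> no r' hr ne; apply: (no r' a true); rewrite /= ?eqxx ?hr //; congruence.
Qed.

Lemma NC_visited (L : nat -> nat -> bool -> Prop) a k : nvisited L (NC a k) ->
  exists2 r, inrows a k r & L r a false.
Proof. by case=> r [b [v [/= /and3P[/eqP -> hr ->]]]]; exists r. Qed.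

Lemma late_pivot : late -> p m j true.
Proof.
move=> L; have [jm mn m2 qm qj qmax xm indx _ _ _ _ _] := G.
have hx : ind -> x < m /\ x <> j /\ x <> q by move=> /indx/xm.
by apply: (g_pivot H); right; apply: (g_full H).
Qed.

Lemma unit_NC a k r : okN n h (NC a k) -> inrows a k r -> ~~ t r a true -> ~~ t r a false ->
  (forall r', inrows a k r' -> r' <> r -> t r' a false) ->
  (forall r', inrows a k r' -> r' <> r -> p r' a false) \/
    (exists2 r, inrows a k r & lp r a false) ->
  gamma_alw (NC a k) r a true.
Proof.
have [jm mn m2 qm qj qmax xm indx _ _ hKm hKj' hKo] := G.
move=> ok hr u1 u2 no us.
have core_case : a <> m -> (forall r', inrows a k r' -> r' <> r -> coreF r' a) ->
    gamma_alw (NC a k) r a true.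
  move=> am cF; case: (hKo _ _ _ ok am hr cF) => [[-> -> ->]|[xn [E1 E2]]]; first exact: AlwPivot.
  by move: u1; rewrite E1 E2 (g_x H xn).
case: (g_dec H) => L.
  have pv := late_pivot L; have full := g_full H L.
  have [am|am] := eqVneq a m.
    subst a; have km := hKm _ ok.
    have rm : ~ r < m by move=> rm; move: u2; rewrite full.
    suff -> : r = m.+1 by apply: AlwJunk.
    case: (ltngtP r m.+1) => // [|lt]; first by move: hr; rewrite /inrows; lia.
    have T : t m.+1 m false by apply: no; [move: hr; rewrite /inrows; lia|lia].
    by have [_ []] := tF T; lia.
  have [am1|am1] := eqVneq a m.+1.
    subst a; exfalso; case: us => [us|[r' hr' /(g_lp H) /(g_pjunk H)]]; last exact.
    have k2 := hKj' _ ok.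
    have [r' h1 h2] : exists2 r', inrows m.+1 k r' & r' <> r.
      by have [r0|r0] := eqVneq r 0; [exists 1|exists 0]; rewrite /inrows; lia.
    by apply: (g_pjunk H (us _ h1 h2)).
  apply: core_case => [|r' h1 h2]; first by apply/eqP.
  by have [_ []] := tF (no _ h1 h2); rewrite /coreF; lia.
have nj r' : t r' a false -> a <> m.+1 by move=> T E; apply: L; apply: (g_junk H T).
have [am|am] := eqVneq a m.
  subst a; exfalso; have km := hKm _ ok.
  have [r' [h0 h1 h2]] : exists r', [/\ r' < m, inrows m k r' & r' <> r].
    by have [r0|r0] := eqVneq r 0; [exists 1|exists 0]; split; rewrite /inrows; lia.
  have lt r2 : p r2 m false -> late.
    move=> P; exists r2, m, false; split=> //; split=> //.
    by have := nj r2 (g_p H P); have [_ []] := tF (g_p H P); lia.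
  by case: us => [us|[r2 h3 /(g_lp H)/lt]] //; apply: L; apply: lt (us _ h1 h2).
apply: core_case => [|r' h1 h2]; first by apply/eqP.
by have T := no _ h1 h2; have [_ []] := tF T; have := nj _ T; rewrite /coreF; lia.
Qed.

Lemma unit_NA1 i k l : i < n -> k < n -> l < n -> i <> k -> k <> l -> i <> l ->
  ~~ t i k false -> t k l true -> t i l false ->
  p k l true /\ p i l false \/ nvisited lp (NA i k l) ->
  gamma_alw (NA i k l) i k false.
Proof.
have [jm mn m2 qm qj qmax xm indx _ _ _ _ _] := G.
have hx : ind -> x < m /\ x <> j /\ x <> q by move=> /indx/xm.
move=> hi hk hl ik kl il u T1 T2 us.
have [_ C1] := tT T1; have [_ C2] := tF T2.
case: C1 => [[xn [Ek El]]|[Ek El]|[xn [Ek El]]|Ek].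
- have ? := xm xn; subst k l.
  have [iq|iq] := eqVneq i q; last first.
    exfalso; suff : t i j false by apply/negP.
    by apply: (g_F H) => //; [case: C2; lia|apply/eqP].
  by subst i; apply: AlwU; case: C2; lia.
- subst k l; have im : i < m by case: C2; lia.
  by apply: AlwLay.
- have ? := xm xn; subst k l; have im : i < m by case: C2; lia.
  case: (g_dec H) => L; first by move: u; rewrite (g_full H L).
  exfalso; have pv : p m j true by apply: (g_pivot H); left.
  have last := g_last H L pv.
  case: us => [[P _]|/NA_visited [|/last|/last]].
  + by apply: L; exists m, x, true.
  + by move=> /last []; lia.
  + by case; lia.
  + by case.
subst k; case: (g_dec H) => L; last by case: L; apply: (g_junk H T1).
exact: AlwJunk.
Qed.

Lemma unit_NA2 i k l : i < n -> k < n -> l < n -> i <> k -> k <> l -> i <> l ->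
  ~~ t k l false -> t i k true -> t i l false ->
  p i k true /\ p i l false \/ nvisited lp (NA i k l) ->
  gamma_alw (NA i k l) k l false.
Proof.
have [jm mn m2 qm qj qmax xm indx _ _ _ _ _] := G.
have hx : ind -> x < m /\ x <> j /\ x <> q by move=> /indx/xm.
move=> hi hk hl ik kl il u T1 T2 us.
have jk : l = m.+1 -> gamma_alw (NA i k l) k l false.
  move=> El; subst l; apply: AlwJunk => //; apply: (g_junk H T2) => //.
have [_ C1] := tT T1; have [_ C2] := tF T2.
case: C1 => [[xn [Ei Ek]]|[Ei Ek]|[xn [Ei Ek]]|Ei].
- have ? := xm xn; subst i k.
  have [?|/eqP lm1] := eqVneq l m.+1; first exact: jk.
  have lm : l = m by case: C2; lia.
  subst l; case: (g_dec H) => L; first by move: u; rewrite (g_full H L) //; lia.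
  exfalso; have pv : p m j true by apply: (g_pivot H); right.
  have last := g_last H L pv.
  case: us => [[_ P]|/NA_visited [|/last|/last]].
  + by apply: L; exists j, m, false.
  + by move=> /last []; lia.
  + by case; lia.
  + by case.
- by apply: jk; case: C2; lia.
- by apply: jk; case: C2; lia.
- by apply: jk; case: C2; lia.
Qed.

Lemma unit_NA3 i k l : i < n -> k < n -> l < n -> i <> k -> k <> l -> i <> l ->
  t i k true -> t k l true ->
  p i k true /\ p k l true \/ nvisited lp (NA i k l) ->
  gamma_alw (NA i k l) i l true.
Proof.
have [jm mn m2 qm qj qmax xm indx _ _ _ _ _] := G.
have hx : ind -> x < m /\ x <> j /\ x <> q by move=> /indx/xm.
move=> hi hk hl ik kl il T1 T2 us.
have [_ C1] := tT T1; have [_ C2] := tT T2.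
have [?|/eqP im1] := eqVneq i m.+1.
  by subst i; apply: AlwJunk => //; apply: (g_junk H T1).
have [xn Ei Ek El] : [/\ x < n, i = m, k = j & l = x].
  by case: C1; case: C2; split; lia.
have ? := xm xn; subst i k l; apply: AlwX => //.
case: us => [[]//|/NA_visited [/(g_lp H)//|/(g_lpx H xn)//|/(g_lp H) P]].
by have [_ []] := tF (g_p H P); lia.
Qed.

Lemma unit_NB i k : i < n -> k < n -> i <> k -> ~~ t k i false -> t i k true ->
  forall N, (N = NB i k \/ N = NB k i) ->
  p i k true \/ nvisited lp N -> gamma_alw N k i false.
Proof.
have [jm mn m2 qm qj qmax xm indx _ _ _ _ _] := G.
have hx : ind -> x < m /\ x <> j /\ x <> q by move=> /indx/xm.
move=> hi hk ik u T1 N EN us.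
have {}us : p i k true \/ p k i true.
  case: us => [?|]; first by left.
  by case: EN => ->; case/NB_visited => /(g_lp H); auto.
have {}us : p i k true.
  case: us => // /(g_p H) T2; exfalso.
  by have [_ C1] := tT T1; have [_ C2] := tT T2; case: C1; case: C2; lia.
have [_ C1] := tT T1.
case: C1 => [[xn [Ei Ek]]|[Ei Ek]|[xn [Ei Ek]]|Ei].
- have [x1 [x2 x3]] := xm xn; subst i k; exfalso; move: u; rewrite (g_F H) //.
- by subst i k; case: EN => ->; [apply: AlwLayJ|apply: AlwLayJ'].
- have ? := xm xn; subst i k; exfalso.
  have L : late by exists m, x, true.
  by move: u; rewrite (g_full H L) //; lia.
by subst i; apply: AlwJunk => //; apply: (g_junk H T1).
Qed.

Lemma gamma_unit N a b v : okN n h N -> nunit t N a b v ->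
  nothers p N a b v \/ nvisited lp N -> gamma_alw N a b v.
Proof.
case: N => [i k l|i k|c k] ok [nn u1 u2 no] us.
- have [[hi hk hl] [ik kl il]] := ok; have [n1' n2 n3] := NA_others no.
  have {}us : [/\ (a, b, v) <> (i, k, false) -> p i k true, (a, b, v) <> (k, l, false) -> p k l true
    & (a, b, v) <> (i, l, true) -> p i l false] \/ nvisited lp (NA i k l).
    by case: us => [/NA_others|]; [left|right].
  case/or3P: nn => /and3P[/eqP E1 /eqP E2]; case: v {no} n1' n2 n3 us => // n2' n3' n4' us _; subst a b.
  + apply: unit_NA1 => //; try by [apply: n3'; congruence|apply: n4'; congruence].
    by case: us => [[P1 P2 P3]|]; [left; split; [apply: P2|apply: P3]; congruence|right].
  + apply: unit_NA2 => //; try by [apply: n2'; congruence|apply: n4'; congruence].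
    by case: us => [[P1 P2 P3]|]; [left; split; [apply: P1|apply: P3]; congruence|right].
  + apply: unit_NA3 => //; try by [apply: n2'; congruence|apply: n3'; congruence].
    by case: us => [[P1 P2 P3]|]; [left; split; [apply: P1|apply: P2]; congruence|right].
- have [hi hk ik] := ok; have [n2 n3] := NB_others no.
  have {}us : (((a, b, v) <> (i, k, false) -> p i k true) /\ ((a, b, v) <> (k, i, false) -> p k i true))
     \/ nvisited lp (NB i k).
    by case: us => [/NB_others|]; [left|right].
  case/orP: nn => /and3P[/eqP E1 /eqP E2]; case: v {no} n2 n3 us => // n2' n3' us _; subst a b.
  + apply: (@unit_NB k i) => //; [congruence|by apply: n3'; congruence|by right|].
    by case: us => [[P1 P2]|]; [left; apply: P2; congruence|right].
  + apply: (@unit_NB i k) => //; [by apply: n2'; congruence|by left|].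
    by case: us => [[P1 P2]|]; [left; apply: P1; congruence|right].
case/and3P: nn => /eqP E hr; case: v u1 no us => // u1 no us _; subst b.
apply: unit_NC => //; first exact: NC_others.
by case: us => [/NC_others|/NC_visited]; [left|right].
Qed.

Lemma gamma_false N : okN n h N -> nfalse t N -> nfalse p N \/ nvisited lp N ->
  N = NC m m /\ forall i, i < m -> t i m false.
Proof.
have [jm mn m2 qm qj qmax xm indx _ _ hKm hKj' hKo] := G.
case: N => [i k l|i k|a k] ok nf us.
- have [[hi hk hl] [ik kl il]] := ok; exfalso.
  have [_ C1] := tT (nf i k false ltac:(by rewrite /= !eqxx)).
  have [_ C2] := tT (nf k l false ltac:(by rewrite /= !eqxx orbT)).
  have [_ C3] := tF (nf i l true ltac:(by rewrite /= !eqxx !orbT)).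
  by case: C1; case: C2; case: C3; lia.
- have [hi hk ik] := ok; exfalso.
  have [_ C1] := tT (nf i k false ltac:(by rewrite /= !eqxx)).
  have [_ C2] := tT (nf k i false ltac:(by rewrite /= !eqxx orbT)).
  by case: C1; case: C2; lia.
have {}nf r : inrows a k r -> t r a false.
  by move=> hr; apply: (nf r a true); rewrite /= eqxx hr.
have [r0 hr0] : exists r, inrows a k r.
  by have [r [b [v /= /and3P[_ hr _]]]] := nin_ex n1 gh ok; exists r.
have [am|/eqP am] := eqVneq a m.
  subst a; have km := hKm _ ok.
  have full i : i < m -> t i m false by move=> im; apply: nf; rewrite /inrows; lia.
  split=> //; congr NC; apply/eqP; case: (ltngtP k m) => // [|lt]; first lia.
  have [_ []] := tF (nf m.+1 ltac:(rewrite /inrows; lia)); lia.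
have [am1|/eqP am1] := eqVneq a m.+1.
  subst a; exfalso; case: us => [us|/NC_visited [r hr /(g_lp H) P]].
    by apply: (g_pjunk H (us r0 m.+1 true _)); rewrite //= eqxx hr0.
  exact: (g_pjunk H P).
exfalso; case: (hKo _ _ r0 ok am hr0).
- by move=> r hr _; have [_ []] := tF (nf r hr); rewrite /coreF; lia.
- case=> E1 E2 E3; subst a k r0; have [_ []] := tF (nf m hr0); lia.
case=> xn [E1 E2]; subst r0 a; have := xm xn; have [_ []] := tF (nf j hr0); lia.
Qed.

End GammaNat.

Lemma gamma_alw_mono n j m x q ind (p p' : nat -> nat -> bool -> bool) N a b v :
  (forall a b v, p a b v -> p' a b v) ->
  gamma_alw n j m x q ind p N a b v -> gamma_alw n j m x q ind p' N a b v.
Proof.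
move=> pp; case=> [N' i||i im ij|P|P|xn P|N' a' b' v' [a1 [b1 [v1 [P L]]]] J].
- exact: AlwU.
- exact: AlwPivot.
- exact: AlwLay.
- exact/AlwLayJ/pp.
- exact/AlwLayJ'/pp.
- by apply: AlwX => //; apply: pp.
by apply: AlwJunk => //; exists a1, b1, v1; split=> //; apply: pp.
Qed.

Section Positions.

Variable n : nat.
Notation V := (opvar n).
Implicit Types (tr t : seq (entry V)).

Lemma on_split tr a b v : on tr a b v ->
  exists t1 e t2, tr = t1 ++ e :: t2 /\ code (elit e) a b v.
Proof. by case/onP=> l /lits_split [t1 [e [t2 [-> <-]]]] c; exists t1, e, t2. Qed.

Lemma on_mid t1 e t2 a b v : code (elit e) a b v -> on (t1 ++ e :: t2) a b v.
Proof. by move=> c; rewrite (on_lit _ c) lits_cat mem_cat inE eqxx orbT. Qed.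

Lemma code_fun (l : literal V) a b v a' b' v' : code l a b v -> code l a' b' v' ->
  [/\ a = a', b = b' & v = v'].
Proof. by case=> <- <- <- [<- <- <-]. Qed.

Lemma cat_split (T : Type) (A B t1 t2 : seq T) e : A ++ B = t1 ++ e :: t2 ->
  (exists u, A = t1 ++ e :: u /\ t2 = u ++ B) \/
  (exists u, t1 = A ++ u /\ B = u ++ e :: t2).
Proof.
elim: A t1 => [|a A IH] [|b t1] /=.
- by move=> ->; right; exists [::].
- by move=> ->; right; exists (b :: t1).
- by case=> -> <-; left; exists A.
case=> -> /IH [[u [-> ->]]|[u [-> ->]]]; first by left; exists u.
by right; exists u.
Qed.

Lemma pos_uniq DB tr t1 e t2 a b v : wft DB tr -> tr = t1 ++ e :: t2 ->
  code (elit e) a b v -> on t1 a b v -> False.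
Proof.
move=> w E c; rewrite (on_lit _ c) => hl.
exact: (wft_uniq w E _ hl).
Qed.

Lemma reason_others h N DB tr t1 e t2 a b v : 1 < n -> goodh n h -> okN n h N ->
  wft DB tr -> tr = t1 ++ e :: t2 -> ereason e = Some (cls n N) -> code (elit e) a b v ->
  nothers (on t1) N a b v.
Proof.
move=> n1 gh ok w E r [<- <- <-]; apply/(nothersP n1 gh t1 (elit e) ok) => l lC ne.
by have [_ _ /(_ _ lC ne)] := wft_reason w E r.
Qed.

Lemma on_prefix t1 t2 a b v : on t1 a b v -> on (t1 ++ t2) a b v.
Proof. by rewrite on_cat => ->. Qed.

Section UipCodes.

Variables (h : seq (nat * nat)) (DB : pred (clause V)).
Hypotheses (n1 : 1 < n) (gh : goodh n h).
Variables (tr0 mid post : seq (entry V)) (d e0 : entry V).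
Let tr := tr0 ++ d :: (mid ++ e0 :: post).
Variables (Nf Np Ng : nclause) (S1 S2 : nat -> nat -> bool -> bool).
Variables (pa pb ua ub : nat) (pv uv : bool).

Lemma uip1_codes :
  wft DB tr -> ereason d = None ->
  all (fun e => isSome (ereason e)) (mid ++ e0 :: post) ->
  okN n h Nf -> ereason e0 = Some (cls n Np) -> code (elit e0) pa pb pv ->
  (forall a b v, a < n -> b < n -> nin Ng a b v <-> nin Np a b v /\ (a, b, v) <> (pa, pb, pv)) ->
  (forall a b v, S1 a b v -> S2 a b v -> False) ->
  (forall a b v, S1 a b v \/ S2 a b v -> on tr0 a b (~~ v) -> False) ->
  (forall a b v, S2 a b v -> on (d :: mid) a b (~~ v) -> False) ->
  (forall a b v, S1 a b v -> on (d :: mid) a b (~~ v) -> nin Ng a b v) ->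
  (forall a b v, nin Ng a b v -> on (d :: mid) a b (~~ v) -> (a, b, v) = (ua, ub, uv)) ->
  (forall S p1 e p2 a b v, S = S1 \/ S = S2 -> post = p1 ++ e :: p2 ->
     code (elit e) a b v -> S a b (~~ v) ->
     exists N, [/\ okN n h N, ereason e = Some (cls n N),
       forall a' b' v', nin N a' b' v' -> (a', b', v') <> (a, b, v) ->
         [\/ S1 a' b' v', S2 a' b' v' | nin Ng a' b' v']
     & exists a' b' v', [/\ nin N a' b' v', (a', b', v') <> (a, b, v) & S a' b' v']]) ->
  nfalse (on tr) Nf ->
  (forall a b v, nin Nf a b v -> [\/ S1 a b v, S2 a b v | nin Ng a b v]) ->
  (exists a b v, nin Nf a b v /\ S1 a b v) -> (exists a b v, nin Nf a b v /\ S2 a b v) ->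
  uip1 tr (cls n Nf) = cls n Ng.
Proof.
move=> w rd rp okf r0 c0 HG dis lev S2mid S1mid Gu st nf sub [a1 [b1 [v1 [m1 m1']]]] [a2 [b2 [v2 [m2 m2']]]].
pose cset (P : nat -> nat -> bool -> bool) : clause V :=
  [set l : V * bool | P (vrow l.1) (vcol l.1) l.2].
have inc P l : (l \in cset P) = P (vrow l.1) (vcol l.1) l.2 by rewrite inE.
have onn t (l : literal V) : (negl l \in lits t) = on t (vrow l.1) (vcol l.1) (~~ l.2).
  by rewrite (on_lit t (code_negl (codeE l))).
have [[ha1 hb1 hab1] [ha2 hb2 hab2]] := (nin_code n1 gh okf m1, nin_code n1 gh okf m2).
have [l1 c1] := code_ex v1 ha1 hb1 hab1; have [l2 c2] := code_ex v2 ha2 hb2 hab2.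
apply: (@uip1_pivot _ DB tr0 mid post d e0 _ (cls n Np) (cset S1) (cset S2) (cls n Ng)
  (odflt (elit e0) [pick l : V * bool | [&& vrow l.1 == ua, vcol l.1 == ub & l.2 == uv]])) => //.
- apply/setP=> l; rewrite in_setD1 !in_cls; apply/andP/idP.
    case=> /eqP ne nn; apply: (HG _ _ _ (vrow_lt _) (vcol_lt _)).2; split=> // -[E1 E2 E3].
    by apply: ne; case: c0 => C1 C2 C3; apply: lit_eq; rewrite ?C1 ?C2 ?C3.
  move/(HG _ _ _ (vrow_lt _) (vcol_lt _)) => [nn ne]; split=> //; apply/eqP=> E.
  by apply: ne; rewrite E; case: c0 => -> -> ->.
- by move=> l; rewrite !inc; apply: dis.
- by move=> l; rewrite inE !inc onn => /orP hl; apply/negP; apply: lev.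
- by move=> l; rewrite inc onn => hl; apply/negP; apply: S2mid.
- by move=> l; rewrite inc onn in_cls; apply: S1mid.
- move=> l; rewrite onn in_cls => h1 /(Gu _ _ _ h1) [E1 E2 E3].
  case: pickP => /= [l' /and3P[/eqP e1 /eqP e2 /eqP e3]|/(_ l)].
    by apply: lit_eq; rewrite ?e1 ?e2 ?e3.
  by rewrite E1 E2 E3 !eqxx.
- move=> S p1 e p2 C hS E rC.
  have [P [EP hP]] : exists P, S = cset P /\ (P = S1 \/ P = S2).
    by case: hS => ->; [exists S1|exists S2]; split=> //; [left|right].
  rewrite EP inc => hl.
  have [N [okN' rN sN [a [b [v [nn ne Pa]]]]]] := st P p1 e p2 _ _ _ hP E (codeE _) hl.
  have EC : C = cls n N by congruence.
  subst C S; split=> [l|].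
    rewrite in_cls => lN ne'; rewrite !inE; case: (sN _ _ _ lN).
    + by move=> [E1 E2 E3]; apply: ne'; apply: lit_eq.
    + by move=> ->.
    + by move=> ->; rewrite orbT.
    + by move=> ->; rewrite orbT.
  have [ha hb hab] := nin_code n1 gh okN' nn; have [l [E1 E2 E3]] := code_ex v ha hb hab.
  exists l; rewrite in_cls inc E1 E2 E3; split=> // El; apply: ne.
  by rewrite -El E1 E2 E3.
- by apply/false_underP; apply/(nfalseP n1 gh _ okf).
- move=> l; rewrite in_cls !inE; case/sub => ->; rewrite ?orbT //.
- by exists l1; rewrite ?in_cls ?inc; case: c1 => -> -> ->.
- by exists l2; rewrite ?in_cls ?inc; case: c2 => -> -> ->.
Qed.

End UipCodes.

End Positions.

Section Processed.

Variables (n : nat).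
Notation V := (opvar n).
Implicit Types (s : state V) (e : entry V).

Lemma processed_push s e : qhead s <= size (trail s) ->
  processed (push s e) = processed s.
Proof. by move=> h; rewrite /processed /= -cats1 takel_cat. Qed.

Lemma processed_dequeue s : qhead s < size (trail s) -> exists e t2,
  trail s = processed s ++ e :: t2 /\
  processed (State (trail s) (qhead s).+1 (learned s)) = rcons (processed s) e.
Proof.
move=> lt; have : drop (qhead s) (trail s) <> [::].
  by move=> /(congr1 size); rewrite size_drop /=; lia.
case E: (drop _ _) => [//|e t2] _; exists e, t2.
have E2 : trail s = processed s ++ e :: t2 by rewrite -E cat_take_drop.
split=> //; rewrite /processed /= [in LHS]E2.
have sz : size (processed s) = qhead s by rewrite size_takel // ltnW.
by rewrite take_cat sz ltnNge leqnSn /= subSnn /= take0 cats1.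
Qed.

Lemma prefix_processed s t1 t2 : trail s = t1 ++ t2 -> size t1 <= qhead s ->
  exists u, processed s = t1 ++ u.
Proof.
move=> E h; exists (take (qhead s - size t1) t2).
rewrite /processed E take_cat; case: ltnP => //; lia.
Qed.

End Processed.

Section Gamma.

Variables (n : nat) (R : realFieldType) (delta : R) (h : seq (nat * nat)).
Variables (j m x q : nat) (ind : bool).
Variables (f : nat) (Bs : nat -> nat -> nat -> bool -> Prop).
Notation V := (opvar n).
Notation core := (gcore n j m x ind).
Notation junk := (gjunk m).
Hypotheses (n1 : 1 < n) (gh : goodh n h).
Hypothesis G : gamma_params n h j m x q ind.
Hypothesis BfE : forall a b v, Bs f a b v <-> core a b v /\ a <> q.
Implicit Types (s : state V) (e : entry V).

Definition ealw s e := exists N a b v, [/\ okN n h N, ereason e = Some (cls n N),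
  code (elit e) a b v & gamma_alw n j m x q ind (on (processed s)) N a b v].

Record gfin_at s tr0 d post : Prop := GfinAt {
  gf_trail : trail s = tr0 ++ d :: post;
  gf_dec : ereason d = None;
  gf_lev : dlevel tr0 = f;
  gf_base : forall a b v, on tr0 a b v <-> Bs f a b v;
  gf_code : code (elit d) q (if ind then x else j) false;
  gf_post : forall p1 e p2, post = p1 ++ e :: p2 -> ealw s e;
  gf_size : size tr0 <= qhead s;
  gf_pos : forall t1 e t2 a b v, trail s = t1 ++ e :: t2 -> code (elit e) a b v ->
    junk a b v -> forall i, i < m -> on t1 i m false;
  gf_full : late n m x (on (processed s)) -> forall i, i < m -> on (trail s) i m false;
  gf_junk : forall a b v, on (processed s) a b v -> ~ junk a b v;
  gf_last : x < n -> ~ lastp s j x true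
}.

Definition gfin s := exists tr0 d post, gfin_at s tr0 d post.

Section AtState.

Variables (s : state V) (tr0 : seq (entry V)) (d : entry V) (post : seq (entry V)).
Hypotheses (ws : wfs (OP n) s) (ls : learned s = learnt n h).
Hypothesis F : gfin_at s tr0 d post.

Let w : wft (clause_of (OP n) s) (trail s) := ws.1.

Lemma post_all_some : all (fun e => isSome (ereason e)) post.
Proof.
apply: all_split => p1 e p2 /(gf_post F) [N [a [b [v [_ -> _ _]]]]] //.
Qed.

Lemma trail_cases t1 e t2 a b v : trail s = t1 ++ e :: t2 -> code (elit e) a b v ->
  [\/ Bs f a b v, [/\ a = q, b = if ind then x else j & v = false]
    | exists p1, [/\ t1 = tr0 ++ d :: p1, post = p1 ++ e :: t2 &
        exists N, [/\ okN n h N, ereason e = Some (cls n N), nothers (on t1) N a b v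
           & gamma_alw n j m x q ind (on (processed s)) N a b v]]].
Proof.
move=> E c; have E0 := E; rewrite (gf_trail F) in E0.
case: (cat_split E0) => [[u [E1 _]]|[u [E1 E2]]].
  by constructor 1; apply/(gf_base F); rewrite E1; apply: on_mid.
case: u E1 E2 => [|d' p1] E1 /= [Ed Ep].
  by have [q1 q2 q3] := gf_code F; case: c => <- <- <-; constructor 2; split; congruence.
subst d'; constructor 3; exists p1; split=> //.
have [N [a' [b' [v' [ok r c' al]]]]] := gf_post F Ep.
have [? ? ?] : [/\ a' = a, b' = b & v' = v] by case: c => <- <- <-; case: c' => <- <- <-.
by subst a' b' v'; exists N; split=> //; apply: reason_others n1 gh ok w E r c.
Qed.

Lemma core_row_m a b v : core a b v -> a < m.
Proof.
have [jm mn m2 qm qj qmax xm indx _ _ _ _ _] := G.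
by case: v => [[? [-> ?]]|] //; case; lia.
Qed.

Lemma trail_in a b v : on (trail s) a b v ->
  core a b v \/ a = m /\ b = j /\ v \/ late_lit n m x a b v \/ junk a b v.
Proof.
have [jm mn m2 qm qj qmax xm indx _ _ _ _ _] := G.
case/on_split=> t1 [e [t2 [E c]]]; case: (trail_cases E c) => [/BfE[]|[-> -> ->]|[p1 [_ _ [N [_ _ _ al]]]]].
- by left.
- left; case: ifP => i; last by left; do ?split.
  by have [x1 [x2 x3]] := xm (indx i); right; do ?split => //; lia.
case: al => {N a b v t1 e t2 p1 E c}.
- by move=> N i; left; left.
- by right; left.
- by move=> i im ij; right; right; left.
- by right; right; left.
- by right; right; left.
- by move=> xn _; right; right; left.
by move=> N a b v _ ?; right; right; right.
Qed.

Lemma pivot_prefix t1 e t2 : trail s = t1 ++ e :: t2 -> code (elit e) m j true ->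
  exists p1, [/\ t1 = tr0 ++ d :: p1, post = p1 ++ e :: t2,
    ereason e = Some (cls n (NC j m)) & forall r, r < m -> r <> j -> on t1 r j false].
Proof.
have [jm mn m2 qm qj qmax xm indx ok _ _ _ _] := G.
move=> E c; case: (trail_cases E c) => [/BfE[/core_row_m]|[]|[p1 [E1 E2 [N [_ r no al]]]]].
- by rewrite ltnn.
- by move=> mq; move: qm; rewrite -mq ltnn.
have EN : N = NC j m.
  case: (gamma_alw_inv al) => [[_ []]//|[[//]|[[]//|[[_ [_ []]]//|[[_ [xn [_ _ Ejx _]]]|[_ Jk]]]]]].
    by have := xm xn; lia.
  by move: Jk; rewrite /gjunk; lia.
subst N; exists p1; split=> // r' r'm ne; apply: (NC_others no) => //; last lia.
by rewrite /inrows; lia.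
Qed.

Lemma base_on a b v : Bs f a b v -> on (trail s) a b v.
Proof. by move/(gf_base F) => h1; rewrite (gf_trail F); apply: on_prefix. Qed.

Lemma late_dec : late n m x (on (processed s)) \/ ~ late n m x (on (processed s)).
Proof.
have [/hasP [l hl ll]|no] := boolP (has (fun l : literal V =>
    if l.2 then [&& x < n, vrow l.1 == m & vcol l.1 == x]
    else (vcol l.1 == m) && (vrow l.1 < m)) (lits (processed s))).
  left; exists (vrow l.1), (vcol l.1), l.2; rewrite (on_lit _ (codeE l)); split=> //.
  by case: (l.2) ll => /=; lia.
right=> -[a [b [v [/onP [l hl [<- <- <-]] ll]]]]; case/hasP: no; exists l => //.
by move: ll; case: (l.2) => /=; lia.
Qed.

Lemma gfacts : gamma_facts n j m x q ind (on (trail s)) (on (processed s)) (lastp s).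
Proof.
have [jm mn m2 qm qj qmax xm indx okp okc _ _ _] := G.
have hx : ind -> x < m /\ x <> j /\ x <> q by move=> /indx/xm.
have trE : trail s = processed s ++ drop (qhead s) (trail s) by rewrite cat_take_drop.
split.
- exact: on_code.
- exact: trail_in.
- exact: on_processed.
- exact: (gf_junk F).
- exact: late_dec.
- exact: (gf_full F).
- move=> a b v /on_split [t1 [e [t2 [E c]]]] jk.
  case: (trail_cases E c) => [/BfE[cr _]|[? ? ?]|[p1 [_ _ [N [_ _ _ al]]]]].
  + exfalso; move: cr jk; rewrite /gcore /gjunk /coreT /coreF; case: v {c}; lia.
  + by exfalso; subst; move: jk; rewrite /gjunk; case: ifP; lia.
  case: (gamma_alw_inv al) => [[_ []]|[[_ []]|[[_ _ _]|[[_ [_ []]]|[[_ [xn []]]|[]]]]]] //;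
    by move=> *; exfalso; subst; move: jk; rewrite /gjunk; lia.
- case=> [[xn]|] /on_split [t1 [e [t2 [E c]]]];
  case: (trail_cases E c) => [/BfE[cr _]|[? ? ?]|[p1 [_ _ [N [_ _ _ al]]]]] //.
  + by have := core_row_m cr; rewrite ltnn.
  + case: (gamma_alw_inv al) => [[_ [//]]|[[_ [_ ? _]]|[[//]|[[? _]|[[? _]|[_ jk]]]]]] //.
      by have := xm xn; lia.
    by move: jk; rewrite /gjunk; lia.
  + by move: cr; rewrite /gcore /coreF; lia.
  + by lia.
  + case: (gamma_alw_inv al) => [[_ [? _ _]]|[[_ [//]]|[[//]|[[? _]|[[? _]|[_ jk]]]]]] //.
      by lia.
    by move: jk; rewrite /gjunk; lia.
- move=> nl pv a b v [pr [e [pE c]]].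
  have [t1 [e1 [t2 [E1 c1]]]] := on_split pv.
  rewrite pE in E1; case: (rcons_split E1) => [[_ E _]|[t2' _ prE]].
    by subst e1; have [<- <- <-] := code_fun c1 c.
  have E : trail s = pr ++ e :: drop (qhead s) (trail s) by rewrite -cat_rcons -pE.
  have E1' : trail s = t1 ++ e1 :: (t2' ++ e :: drop (qhead s) (trail s)).
    by rewrite [LHS]E prE -catA.
  have [p1 [t1E _ _ pF]] := pivot_prefix E1' c1.
  have nopr : on pr a b v -> False by apply: pos_uniq w E c.
  have lateI : late_lit n m x a b v -> False.
    by move=> ll; apply: nl; exists a, b, v; split=> //; rewrite pE; apply/on_rcons; right.
  case: (trail_cases E c) => [/(gf_base F) h1|[Ea Eb Ev]|[p2 [_ _ [N [_ _ _ al]]]]].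
  + by case: nopr; rewrite prE t1E -catA; apply: on_prefix.
  + case: nopr; rewrite prE t1E -catA /= on_cat; apply/orP; right.
    by rewrite Ea Eb Ev; apply: (on_mid [::]); apply: gf_code F.
  case: (gamma_alw_inv al) =>
    [[_ [Ea Eb Ev]]|[[_ []]|[[am _ _ Eb Ev]|[[_ [_ [Ea Eb Ev]]]|[[_ [xn [_ Ea Eb Ev]]]|[_ jk]]]]]] //.
  + by case: nopr; rewrite Ea Eb Ev prE; apply/on_prefix/pF.
  + by case: lateI; subst.
  + by case: lateI; subst.
  + by case: lateI; subst.
- by move=> a b v [pr [e [-> c]]]; apply/on_rcons; right.
- exact: (gf_last F).
- move=> /on_split [t1 [e [t2 [E c]]]] r rm rj.
  by have [p1 [_ _ _ pF]] := pivot_prefix E c; rewrite E; apply/on_prefix/pF.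
- by move=> xn; apply: base_on; apply/BfE; split=> //; lia.
- by move=> r rm rj rq; apply: base_on; apply/BfE; split=> //; left.
Qed.

End AtState.
Lemma gamma_uip s tr0 d post : wfs (OP n) s -> learned s = learnt n h ->
  gfin_at s tr0 d post -> (forall i, i < m -> on (trail s) i m false) ->
  uip1 (trail s) (cls n (NC m m)) = cls n (NC j m.-1).
Proof.
move=> ws ls F full.
have [jm mn m2 qm qj qmax xm indx okp okc _ _ _] := G.
have hx : ind -> x < m /\ x <> j /\ x <> q by move=> /indx/xm.
have w := ws.1.
have gf := gfacts ws F.
have pv : on (trail s) m j true.
  by apply: on_processed; apply: (g_pivot gf); right; apply: full.
have [t1 [e0 [t2 [E c0]]]] := on_split pv.
have [mid [t1E pE r0 pF]] := pivot_prefix ws F E c0.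
have trE : trail s = tr0 ++ d :: mid ++ e0 :: t2 by rewrite E t1E -catA.
have nomid a b v : on (d :: mid) a b v -> (a = q /\ b <> m /\ v = false) \/ b = j /\ v = false /\ a = q \/ junk a b v.
  case/on_split=> u1 [e [u2 [Eu ce]]].
  have Et : trail s = (tr0 ++ u1) ++ e :: (u2 ++ e0 :: t2).
    by rewrite trE -[d :: _]/((d :: mid) ++ e0 :: t2) Eu -!catA.
  case: u1 Eu Et => [|d' u1] /= [Ed Eu] Et.
    left; subst e; have [<- <- <-] := code_fun (gf_code F) ce; split=> //; split=> //.
    by case: ifP => i; lia.
  subst d' mid.
  have t1E' : t1 = (tr0 ++ d :: u1) ++ e :: u2 by rewrite t1E -catA.
  have nopv : on (tr0 ++ d :: u1) m j true -> False.
    by move=> o; apply: (pos_uniq w E c0); rewrite t1E'; apply: on_prefix.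
  have Ep : post = u1 ++ e :: (u2 ++ e0 :: t2) by rewrite pE -catA.
  have [N [a' [b' [v' [ok r c' al]]]]] := gf_post F Ep.
  have [? ? ?] := code_fun ce c'; subst a' b' v'.
  have no := reason_others n1 gh ok w Et r ce.
  case: (gamma_alw_inv al) =>
    [[_ [Ea Eb Ev]]|[[_ [Ea Eb Ev]]|[[am _ EN Eb Ev]|[[_ [EN [Ea Eb Ev]]]|[[_ [xn [EN Ea Eb Ev]]]|[_ jk]]]]]].
  - by right; left.
  - by subst; case: (pos_uniq w E c0); rewrite t1E'; apply: on_mid.
  - case: nopv; subst; apply: (no m j false); rewrite /= ?eqxx ?orbT //; by case; lia.
  - by case: nopv; subst; case: EN => EN; subst;
      apply: (no m j false); rewrite /= ?eqxx ?orbT //; by case; lia.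
  - case: nopv; subst; apply: (no m j false); rewrite /= ?eqxx ?orbT //; by case; lia.
  by right; right.
pose S1 (a b : nat) (v : bool) := [&& a == q, (b == m) || (b == j) & v].
pose S2 (a b : nat) (v : bool) := if v then [&& b == m, a < m & a != q] else (a == m) && (b == j).
have nin_m i : nin (NC m m) i m true = (i < m).
  by rewrite /= /inrows eqxx; lia.
rewrite trE in w *.
apply: (uip1_codes (h := h) (Np := NC j m) (S1 := S1) (S2 := S2) (ua := q) (ub := j) (uv := true)
   n1 gh w (gf_dec F) _ okc r0 c0).
- by rewrite -pE; apply: post_all_some F.
- move=> a b v an bn; rewrite /= /inrows; split.
    by move=> ?; split; [lia|case; lia].
  case=> /and3P[/eqP -> hr ->] ne; have am : a <> m by move=> E1; apply: ne; rewrite E1.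
  lia.
- by move=> a b v; rewrite /S1 /S2; case: v; lia.
- move=> a b v ss /(gf_base F) /BfE []; move: ss; rewrite /S1 /S2 /gcore /coreF /coreT.
  by case: v => /=; lia.
- move=> a b v ss /nomid; move: ss; rewrite /S2 /gjunk; case: v => /=; lia.
- move=> a b v ss /nomid; move: ss (qmax m.-1); rewrite /S1 /= /inrows /gjunk; case: v => /=; lia.
- move=> a b v /= /and3P[/eqP -> hr ->] /nomid; rewrite /gjunk /= => hm.
  by have -> : a = q by lia.
- move=> S p1 e p2 a b v hS Ep ce Sab.
  have Et : trail s = (t1 ++ e0 :: p1) ++ e :: p2 by rewrite E Ep -catA.
  have Epost : post = (mid ++ e0 :: p1) ++ e :: p2 by rewrite pE Ep -catA.
  have [N [a' [b' [v' [ok r c' al]]]]] := gf_post F Epost.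
  have [? ? ?] := code_fun ce c'; subst a' b' v'.
  have dup : on (t1 ++ e0 :: p1) a b v -> False by apply: (pos_uniq ws.1 Et ce).
  have qj1 : on (t1 ++ e0 :: p1) q j false by apply/on_prefix/pF.
  have mj1 : on (t1 ++ e0 :: p1) m j true by apply: on_mid.
  have [Eq|nq] := eqVneq a q.
    subst a; have bm : b = m /\ v = false.
      case: hS => ES; subst S; move: Sab; rewrite /S1 /S2.
        case/and3P=> _ /orP[/eqP -> hv|/eqP Eb hv]; first by split=> //; case: v hv {ce c' al dup}.
        by case: v hv ce c' al dup => // _ _ _ _ dup; case: dup; rewrite Eb.
      by case: (v) => /=; lia.
    case: bm => Eb Ev; subst b v.
    have [EN ES] : N = NA q m j /\ S = S1.
      split; last by case: hS => ES //; subst S; move: Sab; rewrite /S2 /=; lia.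
      case: (gamma_alw_inv al) => [[_ []]|[[_ []]|[[]|[[_ [_ []]]|[[_ [xn []]]|[_ jk]]]]]] //; try lia.
      by move: jk; rewrite /gjunk; lia.
    subst N S; exists (NA q m j); split=> //.
      move=> a b v /= nn ne; case: v nn ne => /= nn ne; last first.
        constructor 2; rewrite /S2; case: (eqVneq b m) nn ne => [->|] nn ne; last lia.
        by case: ne; congr (_, _, _); lia.
      by constructor 1; rewrite /S1; lia.
    exists q, j, true; rewrite /= /S1 !eqxx !orbT; split=> //; case; lia.
  have ES : S = S2 by case: hS => // ES; move: Sab nq; rewrite ES /S1; case/and3P=> ->.
  subst S; clear hS.
  have mjF : S2 m j false by rewrite /S2 /= !eqxx.
  case: (gamma_alw_inv al) =>
    [[_ [Ea Eb Ev]]|[[_ [Ea Eb Ev]]|[[am aj EN Eb Ev]|[[_ [EN [Ea Eb Ev]]]|[[_ [xn [EN Ea Eb Ev]]]|[_ jk]]]]]].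
  - by rewrite Ea eqxx in nq.
  - by subst; case: dup.
  - subst N b v; exists (NA a m j); split=> //.
      move=> a' b' v' /= nn ne; case: v' nn ne => /= nn ne; last first.
        constructor 2; rewrite /S2; case: (eqVneq b' m) nn ne => [->|] nn ne; last lia.
        by case: ne; congr (_, _, _); lia.
      by constructor 3; rewrite /inrows; lia.
    exists m, j, false; rewrite /= !eqxx !orbT; split=> //; case; lia.
  - have EC : cls n N = cls n (NB m j).
      case: EN => -> //; apply/setP=> l; rewrite !in_cls /=; lia.
    subst a b v; exists (NB m j); split; rewrite -?EC //.
    + by split=> //; lia.
    + move=> a' b' v' /= nn ne; constructor 2; case: v' nn ne => /= nn ne; first lia.
      rewrite /S2; case: (eqVneq a' m) nn ne => [->|am'] nn ne; first lia.
      by case: ne; congr (_, _, _); lia.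
    by exists m, j, false; rewrite /= !eqxx; split=> //; case; lia.
  - by subst; move: Sab; rewrite /S2 /=; have := xm xn; lia.
  by move: Sab jk; rewrite /S2 /gjunk; case: (v) => /=; lia.
- by rewrite -trE => a b v; rewrite /= => /and3P[/eqP -> hr ->]; apply: full; move: hr; rewrite /inrows; lia.
- move=> a b v /= /and3P[/eqP -> hr ->]; rewrite /S1 /S2 !eqxx /=.
  have [Eq|nq] := eqVneq a q; first by constructor 1.
  by constructor 2; move: hr; rewrite /inrows; lia.
- by exists q, m, true; rewrite nin_m qm /S1 !eqxx.
by exists j, m, true; rewrite nin_m jm /S2 eqxx jm; split=> //; apply/eqP; lia.
Qed.

Variables (dr dc : nat -> nat).
Hypotheses (drf : dr f = q) (dcf : dc f = if ind then x else j).
Hypothesis dec_xj : forall i, i <= f -> x < n -> ~ (dr i = x /\ dc i = j).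

Lemma gamma_start s : wfs (OP n) s -> learned s = learnt n h ->
  snap Bs dr dc (trail s) -> final_start f Bs dr dc s -> gfin s.
Proof.
move=> ws ls sn [s0 [x0 [[qu qs lev] onB cx Es]]].
have [jm mn m2 qm qj qmax xm indx okp okc _ _ _] := G.
have hx : ind -> x < m /\ x <> j /\ x <> q by move=> /indx/xm.
have pE : processed s = trail s0.
  by rewrite Es processed_push ?qs // /processed qs take_size.
have trE : trail s = trail s0 ++ [:: Entry (x0, false) (dlevel (trail s0)).+1 None].
  by rewrite Es /= cats1.
have nojunk a b v : Bs f a b v -> ~ junk a b v.
  by move=> /BfE []; rewrite /gcore /gjunk /coreT /coreF; case: v; lia.
exists (trail s0), (Entry (x0, false) (dlevel (trail s0)).+1 None), [::]; split=> //.
- by rewrite /= -drf -dcf.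
- by case.
- by rewrite Es /= qs.
- move=> t1 e t2 a b v; rewrite trE => E ce jk; exfalso.
  have : on (trail s) a b v by rewrite trE E; apply: on_mid.
  rewrite trE on_cat => /orP[/onB/nojunk//|/onP [l]]; rewrite inE => /eqP -> cl.
  have [Ea Eb Ev] := code_fun cx cl; move: jk; rewrite -Ea -Eb -Ev /gjunk dcf.
  by case: ifP; lia.
- move=> [a [b [v []]]]; rewrite pE => /onB /BfE []; rewrite /gcore /late_lit /coreT /coreF.
  by case: v; lia.
- by move=> a b v; rewrite pE => /onB; apply: nojunk.
move=> xn [pr [e [E ce]]]; have [xm' [xj xq]] := xm xn.
have : on (trail s0) x j false by apply/onB/BfE; split=> //; left.
case/on_split=> t1 [e2 [t2 [E2 c2]]].
rewrite pE in E; have E2' := E2; rewrite E in E2'.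
case: (rcons_split E2') => [[_ Ee _]|[t2' _ prE]].
  by subst e2; have [] := code_fun ce c2.
have w := ws.1; rewrite trE in w; have w0 := wft_catl w.
have subc a b v : on t1 a b v -> core a b v /\ ~ (a = j /\ b = x /\ v = true).
  move=> o; split; first by have /BfE[] : Bs f a b v by apply/onB; rewrite E2; apply: on_prefix.
  case=> Ea [Eb Ev]; rewrite Ea Eb Ev in o; apply: (pos_uniq (t1 := pr) (e := e) (t2 := [::]) w0 _ ce).
    by rewrite E cats1.
  by rewrite prE; apply: on_prefix.
case re: (ereason e2) => [C|]; last first.
  have Et : trail s = t1 ++ e2 :: (t2 ++ [:: Entry (x0, false) (dlevel (trail s0)).+1 None]).
    by rewrite trE E2 -catA.
  have [_ c3] := sn _ _ _ Et re; have [Ex Ej _] := code_fun c2 c3.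
  apply: (@dec_xj (dlevel t1)) => //; rewrite -lev E2 dlevel_cat; exact: leq_addr.
have [dC eC _] := wft_reason w0 E2 re.
have [N ok EC] := (clause_ofP C gh ls).1 dC; subst C.
have no := reason_others n1 gh ok w0 E2 re c2.
move: eC; rewrite in_cls; case: c2 => -> -> ->; case: N ok no {re dC} => [i k l|i k|a k] ok no /=; rewrite ?andbF ?orbF ?andbT //.
- have [o1 o2 o3] := NA_others no; case: ok => [[hi hk hl] [ik kl il]].
  case/orP=> /andP[/eqP Ei /eqP Ek].
    have : on t1 j l true by rewrite Ek; apply: o2; congruence.
    by case/subc => -[_ [_ Ex]]; lia.
  have : on t1 i x true by rewrite Ei; apply: o1; congruence.
  by case/subc => -[_ [Ex _]]; lia.
- have [o1 o2] := NB_others no; case: ok => hi hk ik.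
  case/orP=> /andP[/eqP Ei /eqP Ek].
    by have /subc [_ []] : on t1 j x true by rewrite Ei Ek; apply: o2; congruence.
  by have /subc [_ []] : on t1 j x true by rewrite Ei Ek; apply: o1; congruence.
Qed.

Lemma gfin_lev s tr0 d post : wfs (OP n) s -> gfin_at s tr0 d post -> 0 < dlevel (trail s).
Proof. by move=> ws F; rewrite (gf_trail F) dlevel_cat /= (gf_dec F) addnCA. Qed.

Lemma gamma_full s tr0 d post : wfs (OP n) s -> learned s = learnt n h ->
  quiescent (OP n) s -> gfin_at s tr0 d post -> on (processed s) m j true ->
  forall i, i < m -> on (trail s) i m false.
Proof.
move=> ws ls qu F pv i im.
have [jm mn m2 qm qj qmax xm indx okp okc _ _ _] := G.
have hx : ind -> x < m /\ x <> j /\ x <> q by move=> /indx/xm.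
have pF r : r < m -> r <> j -> on (processed s) r j false.
  have [t1 [e [t2 [E c]]]] := on_split pv.
  have Et : trail s = t1 ++ e :: (t2 ++ drop (qhead s) (trail s)).
    by rewrite -[LHS](cat_take_drop (qhead s)) -/(processed s) E -catA.
  have [_ [_ _ _ p1]] := pivot_prefix ws F Et c.
  by move=> rm rj; rewrite E; apply/on_prefix/p1.
have nT : on (trail s) i m true -> False.
  move/(trail_in ws F); rewrite /gcore /late_lit /gjunk /coreT /=; lia.
have [Eij|/eqP ij] := eqVneq i j.
  subst i; suff : on (trail s) j m true || on (trail s) j m false by case/orP.
  apply: (nq_assigned n1 gh ls qu (N := NB m j) (v := false)).
  - by split=> //; lia.
  - by rewrite /= !eqxx orbT.
  move=> a' b' v' /= nn ne; have [Ea Eb Ev] : [/\ a' = m, b' = j & v' = false].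
    case: v' nn ne => nn ne; first lia.
    have [E|am] := eqVneq a' m; first by subst; split=> //; lia.
    by case: ne; congr (_, _, _); lia.
  by subst.
suff : on (trail s) i m true || on (trail s) i m false by case/orP.
apply: (nq_assigned n1 gh ls qu (N := NA i m j) (v := false)).
- by split; split; lia.
- by rewrite /= !eqxx.
move=> a' b' v' /= /or3P[]/and3P[/eqP -> /eqP -> hv] ne; case: v' hv ne => // _ ne.
by apply: pF.
Qed.

Lemma gamma_step s c : wfs (OP n) s -> learned s = learnt n h ->
  snap Bs dr dc (trail s) -> gfin s -> op_step delta h s c ->
  (exists s', [/\ c = Running s', wfs (OP n) s', learned s' = learnt n h,
     snap Bs dr dc (trail s') & gfin s']) \/
  0 < dlevel (trail s) /\ c = Running (restart s (cls n (NC j m.-1))).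
Proof.
move=> ws ls sn [tr0 [d [post F]]] st.
have [jm mn m2 qm qj qmax xm indx okp okc _ _ _] := G.
have hx : ind -> x < m /\ x <> j /\ x <> q by move=> /indx/xm.
have gf := gfacts ws F.
have lev := gfin_lev ws F.
have closed : quiescent (OP n) s -> qhead s = size (trail s) -> False.
  move=> qu qs; have up := upc_trail n1 gh qu qs ls.
  have pE : processed s = trail s by rewrite /processed qs take_size.
  have rows r : r < m -> r <> j -> on (trail s) r j false.
    move=> rm rj; have [Er|/eqP rq] := eqVneq r q; last exact: (g_F gf).
    subst r; have dq : on (trail s) q (if ind then x else j) false.
      by rewrite (gf_trail F); apply: on_mid; apply: gf_code F.
    case: (ind) dq hx indx => // dq hx' indx'; have xn := indx' isT; have [? [? ?]] := hx' isT.
    have [_ _ h3] := upc_A (i := q) (j := j) (k := x) up ltac:(lia) ltac:(lia) xn ltac:(lia) ltac:(lia) ltac:(lia).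
    by apply: h3 => //; apply: (g_x gf).
  have pv : on (trail s) m j true.
    apply: (upc_C up okp) => [|r' hr ne]; first by rewrite /inrows; lia.
    by apply: rows; move: hr; rewrite /inrows; lia.
  have full := gamma_full ws ls qu F; rewrite pE in full.
  apply: (nq_notfalse n1 gh ls qu okc); rewrite pE => a b v /= /and3P[/eqP -> hr ->].
  by apply: full => //; move: hr; rewrite /inrows; lia.
case: st ls => {c}.
- move=> N l ok un us ls; left; eexists; split; first reflexivity.
  + exact: (wfs_push_cls n1 gh ls ws ok un).
  + by [].
  + exact: snap_push.
  have al := gamma_unit n1 G gf ok un us.
  set e := Entry _ _ _; have ps := processed_push e ws.2.
  exists tr0, d, (rcons post e); split; rewrite ?ps; try exact: (gf_dec F); try exact: (gf_lev F);
    try exact: (gf_base F); try exact: (gf_code F); try exact: (gf_size F); try exact: (gf_junk F).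
  + by rewrite /= (gf_trail F) -cats1 -catA /= cats1.
  + move=> p1 e1 p2 E; rewrite /ealw ps; case: (rcons_split E) => [[_ -> _]|[p2' _ E2]].
      by exists N, (vrow l.1), (vcol l.1), l.2.
    exact: (gf_post F E2).
  + move=> t1 e1 t2 a b v /= E c1 jk; case: (rcons_split E) => [[-> Ee _]|[t2' _ E2]].
      subst e1; have [? ? ?] := code_fun c1 (codeE l); subst.
      by apply: (gf_full F); exact: (alw_junk_late n1 G al jk).
    exact: (gf_pos F E2 c1 jk).
  + by move=> L i im; apply/on_rcons; left; apply: (gf_full F).
  + by move=> xn [pr [e1 []]]; rewrite ps => E c1; apply: (gf_last F xn); exists pr, e1.
- move=> qu lt ls; left; eexists; split; first reflexivity; try by [].
    by case: ws => w _; split.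
  have [e [t2 [E ps]]] := processed_dequeue lt.
  set s' := State _ _ _ in ps *.
  have mono a b v : on (processed s) a b v -> on (processed s') a b v.
    by rewrite ps => o; apply/on_rcons; left.
  have ce := codeE (elit e).
  have E0 := E; rewrite (gf_trail F) in E0.
  have [u pu] : exists u, processed s = tr0 ++ u.
    by apply: (prefix_processed (gf_trail F)); apply: gf_size F.
  have noB a b v : code (elit e) a b v -> ~ Bs f a b v.
    move=> c1 /(gf_base F) o; apply: (pos_uniq ws.1 E c1); rewrite pu; exact: on_prefix.
  exists tr0, d, post; split; try exact: (gf_dec F); try exact: (gf_lev F);
    try exact: (gf_base F); try exact: (gf_code F); try exact: (gf_trail F); try exact: (gf_pos F).
  + move=> p1 e1 p2 /(gf_post F) [N [a [b [v [ok r c1 al]]]]]; exists N, a, b, v; split=> //.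
    exact: gamma_alw_mono al.
  + by rewrite /= (leq_trans (gf_size F)).
  + move=> [a [b [v []]]]; rewrite ps => /on_rcons [o|c1] ll.
      by apply: (gf_full F); exists a, b, v.
    apply: (gamma_full ws ls qu F).
    case: (trail_cases ws F E c1) => [/(noB _ _ _ c1)//|[Ea Eb Ev]|[p1 [_ _ [N [_ _ no al]]]]].
      by subst; move: ll; rewrite /late_lit; case: ifP => //; lia.
    case: (gamma_alw_inv al) =>
      [[_ [Ea Eb Ev]]|[[_ [Ea Eb Ev]]|[[am aj EN Eb Ev]|[[//]|[[//]|[_ jk]]]]]].
    * by subst; move: ll; rewrite /late_lit; lia.
    * by subst; move: ll; rewrite /late_lit => -[/xm]; lia.
    * subst; apply: (no m j false); rewrite /= ?eqxx ?orbT //; case; lia.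
    by move: ll jk; rewrite /late_lit /gjunk; case: (v); lia.
  + move=> a b v; rewrite ps => /on_rcons [o|c1] jk; first exact: (gf_junk F o jk).
    have full := gf_pos F E c1 jk.
    apply: (nq_notfalse n1 gh ls qu okc) => a' b' v' /= /and3P[/eqP -> hr ->].
    by apply: full; move: hr; rewrite /inrows; lia.
  move=> xn [pr [e1 []]]; rewrite ps => /rcons_inj [_ Ee] c1; subst e1.
  case: (trail_cases ws F E c1) => [/(noB _ _ _ c1)//|[//]|[p1 [_ _ [N [_ _ no al]]]]].
  case: (gamma_alw_inv al) =>
      [[_ []]//|[[_ []]|[[]//|[[_ [_ []]]//|[[_ [_ []]]|[_ jk]]]]]]; try lia.
  by move: jk; rewrite /gjunk; lia.
- move=> N ok nf us _ ls; right; split=> //.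
  have [EN full] := gamma_false n1 gh G gf ok nf us; subst N.
  by rewrite (gamma_uip ws ls F full).
- by move=> N _ _ _ lz; rewrite lz in lev.
- by move=> x0 qu qs; case: (closed qu qs).
by move=> qu qs; case: (closed qu qs).
Qed.

End Gamma.

(** * The conflict level when m is the last node but one *)

Section BetaNat.

Variables (n : nat) (h : seq (nat * nat)) (j m q : nat).
Hypotheses (n1 : 1 < n) (gh : goodh n h).

Record beta_params : Prop := BetaParams {
  b_jm : j < m; b_mn : n = m.+2; b_qm : q < m; b_qj : q <> j;
  b_qmax : forall r, r < m -> r <> j -> r <= q;
  b_Kpivot : okN n h (NC j m);
  b_Km : forall k, okN n h (NC m k) -> k = m.+1;
  b_Kz : forall k, okN n h (NC m.+1 k) -> k = m.+1;
  b_Kother : forall a k r, okN n h (NC a k) -> a <> m -> a <> m.+1 -> inrows a k r ->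
    (forall r', inrows a k r' -> r' <> r -> a = j /\ r' < m) ->
    [/\ a = j, k = m & r = m]
}.

Hypothesis G : beta_params.

Definition betaT a b := (a = m /\ b = j) \/ (a = m.+1 /\ (b = m \/ b = j)).
Definition betaF a b := b = j /\ a < m /\ a <> j \/ b = m /\ a < m \/ b = m.+1.
Definition beta_in a b (v : bool) := if v then betaT a b else betaF a b.

(* Literals of the last node [m.+1] that need P(m.+1,m). *)
Definition beta_z a b (v : bool) := if v then a = m.+1 /\ b <> m else b = m.+1.

Record beta_facts (t p : nat -> nat -> bool -> bool) : Prop := BetaFacts {
  b_code : forall a b v, t a b v -> [/\ a < n, b < n & a != b];
  b_in : forall a b v, t a b v -> beta_in a b v;
  b_p : forall a b v, p a b v -> t a b v;
  b_zm : forall a b v, t a b v -> beta_z a b v -> t m.+1 m true;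
  b_full : forall a, p a m.+1 false -> forall i, i < m.+1 -> t i m.+1 false
}.

Variables (t p : nat -> nat -> bool -> bool) (lp : nat -> nat -> bool -> Prop).
Hypothesis H : beta_facts t p.
Hypothesis Hlp : forall a b v, lp a b v -> p a b v.

Lemma beta_unit N a b v : okN n h N -> nunit t N a b v ->
  nothers p N a b v \/ nvisited lp N ->
  beta_in a b v /\ (beta_z a b v -> t m.+1 m true).
Proof.
have [jm mn qm qj qmax okp hKm hKz hKo] := G.
have bT a' b' : t a' b' true -> betaT a' b' by apply: (b_in H).
have bF a' b' : t a' b' false -> betaF a' b' by apply: (b_in H).
have z1 a' b' : t a' b' true -> a' = m.+1 -> t m.+1 m true.
  by have [->|/eqP bm] := eqVneq b' m => T Ea; [rewrite -Ea|apply: (b_zm H T)].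
have z2 a' b' : t a' b' false -> b' = m.+1 -> t m.+1 m true by move=> T; apply: (b_zm H T).
case: N => [i k l|i k|c k] ok [nn u1 u2 no] us.
- have [[hi hk hl] [ik kl il]] := ok; have [o1 o2 o3] := NA_others no.
  case/or3P: nn => /and3P[/eqP E1 /eqP E2]; case: v {no us} o1 o2 o3 => // o1 o2 o3 _; subst a b.
  + have T1 := o2 ltac:(congruence); have T2 := o3 ltac:(congruence).
    have C1 := bT _ _ T1; have C2 := bF _ _ T2; have D1 := z1 _ _ T1.
    rewrite /beta_in /beta_z /betaF; move: C1 C2; rewrite /betaT /betaF => C1 C2.
    by split; [lia|move=> ?; apply: D1; lia].
  + have T1 := o1 ltac:(congruence); have T2 := o3 ltac:(congruence).
    have C1 := bT _ _ T1; have C2 := bF _ _ T2; have D1 := z2 _ _ T2.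
    rewrite /beta_in /beta_z /betaF; move: C1 C2; rewrite /betaT /betaF => C1 C2.
    by split; [lia|move=> ?; apply: D1; lia].
  + have T1 := o1 ltac:(congruence); have T2 := o2 ltac:(congruence).
    have C1 := bT _ _ T1; have C2 := bT _ _ T2; have D1 := z1 _ _ T1.
    rewrite /beta_in /beta_z /betaT; move: C1 C2; rewrite /betaT => C1 C2.
    by split; [lia|move=> ?; apply: D1; lia].
- have [hi hk ik] := ok; have [o1 o2] := NB_others no.
  case/orP: nn => /and3P[/eqP E1 /eqP E2]; case: v {no us} o1 o2 => // o1 o2 _; subst a b.
  + have T1 := o2 ltac:(congruence); have C1 := bT _ _ T1; have D1 := z1 _ _ T1.
    rewrite /beta_in /beta_z /betaF; move: C1; rewrite /betaT => C1.
    by split; [lia|move=> ?; apply: D1; lia].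
  + have T1 := o1 ltac:(congruence); have C1 := bT _ _ T1; have D1 := z1 _ _ T1.
    rewrite /beta_in /beta_z /betaF; move: C1; rewrite /betaT => C1.
    by split; [lia|move=> ?; apply: D1; lia].
case/and3P: nn => /eqP E hr; case: v u1 no us => // u1 no us _; subst b.
have {}no := NC_others no.
have [cz|/eqP cz] := eqVneq c m.+1.
  subst c; exfalso; have Ek := hKz _ ok; subst k.
  have nop a' : p a' m.+1 false -> False.
    move=> /(b_full H) full; case/negP: u2; apply: full; move: hr; rewrite /inrows; lia.
  case: us => [/NC_others us|/NC_visited [r' _ /Hlp /nop] //].
  have [r' [h1 h2]] : exists r', inrows m.+1 m.+1 r' /\ r' <> a.
    by have [r0|r0] := eqVneq a 0; [exists 1|exists 0]; rewrite /inrows; lia.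
  exact: nop (us _ h1 h2).
have [cm|/eqP cm] := eqVneq c m.
  subst c; have Ek := hKm _ ok; subst k.
  have [az|/eqP az] := eqVneq a m.+1; last first.
    have := bF _ _ (no m.+1 ltac:(rewrite /inrows; lia) ltac:(lia)); rewrite /betaF; lia.
  by rewrite /beta_in /betaT /beta_z; split; lia.
have [-> _ ->] := hKo _ _ _ ok cm cz hr (fun r' h1 h2 => ltac:(have := bF _ _ (no r' h1 h2); rewrite /betaF; lia)).
by rewrite /beta_in /betaT /beta_z; split; lia.
Qed.

Lemma beta_false N : okN n h N -> nfalse t N -> N = NC m.+1 m.+1.
Proof.
have [jm mn qm qj qmax okp hKm hKz hKo] := G.
have bT a' b' : t a' b' true -> betaT a' b' by apply: (b_in H).
have bF a' b' : t a' b' false -> betaF a' b' by apply: (b_in H).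
case: N => [i k l|i k|a k] ok nf.
- have [[hi hk hl] [ik kl il]] := ok; exfalso.
  have := bT _ _ (nf i k false ltac:(by rewrite /= !eqxx)).
  have := bT _ _ (nf k l false ltac:(by rewrite /= !eqxx orbT)).
  have := bF _ _ (nf i l true ltac:(by rewrite /= !eqxx !orbT)).
  by rewrite /betaT /betaF; lia.
- have [hi hk ik] := ok; exfalso.
  have := bT _ _ (nf i k false ltac:(by rewrite /= !eqxx)).
  have := bT _ _ (nf k i false ltac:(by rewrite /= !eqxx orbT)).
  by rewrite /betaT; lia.
have {}nf r : inrows a k r -> betaF r a.
  by move=> hr; apply/bF/(nf r a true); rewrite /= eqxx hr.
have [r0 hr0] : exists r, inrows a k r.
  by have [r [b [v /= /and3P[_ hr _]]]] := nin_ex n1 gh ok; exists r.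
have [am1|/eqP am1] := eqVneq a m.+1; first by subst a; rewrite (hKz _ ok).
have [am|/eqP am] := eqVneq a m.
  subst a; have Ek := hKm _ ok; subst k.
  by have := nf m.+1 ltac:(rewrite /inrows; lia); rewrite /betaF; lia.
have [Ea Ek Er] := hKo _ _ r0 ok am am1 hr0 (fun r' h1 h2 => ltac:(have := nf r' h1; rewrite /betaF; lia)).
by have := nf _ hr0; rewrite /betaF; lia.
Qed.

(* The two disjoint families of literals met by conflict analysis. *)
Definition beta1 (a b : nat) (v : bool) := [&& a == q, [|| b == j, b == m | b == m.+1] & v].
Definition beta2 (a b : nat) (v : bool) :=
  if v then (a != q) && ((b == m) && (a < m) || (b == m.+1))
  else (a == m) && (b == j) || (a == m.+1).

Lemma beta_reason N a b v : okN n h N -> nin N a b v -> a <> b -> nothers t N a b v ->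
  beta_in a b v -> (v = false -> a = q -> b <> j) -> (v = true -> a = m -> b <> j) ->
  forall S, S = beta1 \/ S = beta2 -> S a b (~~ v) ->
  (forall a' b' v', nin N a' b' v' -> (a', b', v') <> (a, b, v) ->
     [\/ beta1 a' b' v', beta2 a' b' v' | nin (NC j m.-1) a' b' v']) /\
  exists a' b' v', [/\ nin N a' b' v', (a', b', v') <> (a, b, v) & S a' b' v'].
Proof.
have [jm mn qm qj qmax okp hKm hKz hKo] := G.
move=> ok nn ab no ein neq nep S hS Sab.
have bT a' b' : t a' b' true -> betaT a' b' by apply: (b_in H).
have bF a' b' : t a' b' false -> betaF a' b' by apply: (b_in H).
have qm1 := qmax m.-1.
have S1 : S = beta1 -> a = q by move=> E; move: Sab; rewrite E; case/and3P=> /eqP.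
have aq b' : a = q -> [|| b' == j, b' == m | b' == m.+1] -> beta1 a b' true.
  by move=> -> h1; rewrite /beta1 eqxx h1.
have two a1 b1 v1 a2 b2 v2 :
    (forall a' b' v', nin N a' b' v' -> (a', b', v') <> (a, b, v) ->
      (a', b', v') = (a1, b1, v1) \/ (a', b', v') = (a2, b2, v2)) ->
    nin N a1 b1 v1 -> (a1, b1, v1) <> (a, b, v) -> nin N a2 b2 v2 -> (a2, b2, v2) <> (a, b, v) ->
    beta2 a1 b1 v1 -> (a = q -> beta1 a2 b2 v2) ->
    (a <> q -> beta2 a2 b2 v2 || nin (NC j m.-1) a2 b2 v2) ->
    (forall a' b' v', nin N a' b' v' -> (a', b', v') <> (a, b, v) ->
     [\/ beta1 a' b' v', beta2 a' b' v' | nin (NC j m.-1) a' b' v']) /\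
    exists a' b' v', [/\ nin N a' b' v', (a', b', v') <> (a, b, v) & S a' b' v'].
  move=> all n1' ne1 n2' ne2 U1 U2 U3; split.
    move=> a' b' v' nn' ne'; case: (all _ _ _ nn' ne') => -[E1 E2 E3]; rewrite E1 E2 E3.
      by constructor 2.
    have [/U2|/eqP/U3/orP[]] := eqVneq a q; by [constructor 1|constructor 2|constructor 3].
  case: hS => ES; last by exists a1, b1, v1; rewrite ES.
  by exists a2, b2, v2; rewrite ES; split=> //; apply/U2/S1.
have S2 : v = true -> S = beta2.
  by move=> Ev; case: hS => // ES; move: Sab; rewrite ES /beta1 Ev /= !andbF.
clear Sab hS S1.
case: N ok nn no two => [i k l|i k|c k] ok nn no two.
- have [[hi hk hl] [ik kl il]] := ok; have [o1 o2 o3] := NA_others no.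
  case/or3P: (nn) => /and3P[/eqP E1 /eqP E2];
    case: v {no nn} o1 o2 o3 ein neq nep S2 two => // o1 o2 o3 ein neq nep S2 two _; subst a b.
  + have := bT _ _ (o2 ltac:(congruence)); have := bF _ _ (o3 ltac:(congruence)).
    rewrite /betaT /betaF => C2 C1; apply: (two k l false i l true).
    * move=> a' b' v' /= /or3P[]/and3P[/eqP -> /eqP -> hv]; case: v' hv => // _; auto.
    * by rewrite /= !eqxx orbT.
    * by congruence.
    * by rewrite /= !eqxx !orbT.
    * by congruence.
    * by rewrite /beta2; clear -C1 C2; lia.
    * by move=> E; apply: aq => //; clear -C1; lia.
    by rewrite /beta2 /= /inrows => iq; clear -C1 C2 iq qm1 qm qj jm; lia.
  + have := bT _ _ (o1 ltac:(congruence)); have := bF _ _ (o3 ltac:(congruence)).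
    rewrite /betaT /betaF => C2 C1.
    have [Ei Ek El] : [/\ i = m, k = j & l = m.+1] by clear -C1 C2 ik kl il jm; split; lia.
    subst i k l; apply: (two m j false m m.+1 true).
    * move=> a' b' v' /= /or3P[]/and3P[/eqP -> /eqP -> hv]; case: v' hv => // _; auto.
    * by rewrite /= !eqxx.
    * by congruence.
    * by rewrite /= !eqxx !orbT.
    * by congruence.
    * by rewrite /beta2 !eqxx.
    * by move=> E; case: qj.
    by rewrite /beta2 eqxx orbT andbT (_ : m != q) //; apply/eqP; lia.
  + have := bT _ _ (o1 ltac:(congruence)); have := bT _ _ (o2 ltac:(congruence)).
    rewrite /betaT => C2 C1.
    have [Ei Ek El] : [/\ i = m.+1, k = m & l = j] by clear -C1 C2 ik kl il jm; split; lia.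
    subst i k l; apply: (two m.+1 m false m j false).
    * move=> a' b' v' /= /or3P[]/and3P[/eqP -> /eqP -> hv]; case: v' hv => // _; auto.
    * by rewrite /= !eqxx.
    * by congruence.
    * by rewrite /= !eqxx !orbT.
    * by congruence.
    * by rewrite /beta2 !eqxx orbT.
    * by lia.
    by rewrite /beta2 !eqxx.
- have [hi hk ik] := ok; have [o1 o2] := NB_others no.
  have aux i' k' : t i' k' true -> k' <> q /\ beta2 i' k' false.
    move=> /bT; rewrite /betaT /beta2 => C1; clear -C1 qm qj; lia.
  case/orP: (nn) => /and3P[/eqP E1 /eqP E2];
    case: v {no nn} o1 o2 ein neq nep S2 two => // o1 o2 ein neq nep S2 two _; subst a b.
  + have [C1 C2] := aux _ _ (o2 ltac:(congruence)); apply: (two k i false k i false).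
    * by move=> a' b' v' /= /orP[]/and3P[/eqP -> /eqP -> hv]; case: v' hv => // _; auto.
    * by rewrite /= !eqxx orbT.
    * by congruence.
    * by rewrite /= !eqxx orbT.
    * by congruence.
    * by [].
    * by move=> E; case: C1.
    by rewrite C2.
  + have [C1 C2] := aux _ _ (o1 ltac:(congruence)); apply: (two i k false i k false).
    * by move=> a' b' v' /= /orP[]/and3P[/eqP -> /eqP -> hv]; case: v' hv => // _; auto.
    * by rewrite /= !eqxx.
    * by congruence.
    * by rewrite /= !eqxx.
    * by congruence.
    * by [].
    * by move=> E; case: C1.
    by rewrite C2.
case/and3P: (nn) => /eqP E hr hv; subst b; rewrite hv in no ein nep S2 two nn *.
have {}no r' h1 h2 := bF _ _ (NC_others no (r' := r') h1 h2).
have ES := S2 erefl; have {}nep := nep erefl; clear two S2 neq.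
move: ein; rewrite /= /betaT => ein.
have cz : c <> m.+1 by clear -ein jm; lia.
have cm : c = m.
  have [//|/eqP cm] := eqVneq c m; exfalso.
  have oth r' : inrows c k r' -> r' <> a -> c = j /\ r' < m.
    move=> h1 h2; have := no r' h1 h2; rewrite /betaF; clear -cm cz; lia.
  by have [Ec _ Er] := hKo _ _ _ ok cm cz hr oth; apply: nep.
subst c; have Ek := hKm _ ok; subst k; have Ea : a = m.+1 by clear -ein jm; lia.
subst a; split.
  move=> a' b' v' /= /and3P[/eqP -> hr' hv']; case: v' hv' => // _ ne; apply/or3P.
  have am : a' <> m.+1 by move=> E; apply: ne; rewrite E.
  have am' : a' < m by move: hr'; rewrite /inrows; clear -am; lia.
  rewrite /beta1 /beta2 eqxx am' orbT /=.
  by case: (a' == q).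
exists j, m, true; rewrite ES /beta2 /= /inrows !eqxx jm /=; split.
- by clear -jm; lia.
- by case; clear -jm; lia.
by rewrite andbT; apply/eqP => E; case: qj.
Qed.

End BetaNat.

Section Beta.

Variables (n : nat) (R : realFieldType) (delta : R) (h : seq (nat * nat)).
Variables (j m q : nat).
Variables (f : nat) (Bs : nat -> nat -> nat -> bool -> Prop) (dr dc : nat -> nat).
Notation V := (opvar n).
Hypotheses (n1 : 1 < n) (gh : goodh n h).
Hypothesis G : beta_params n h j m q.
Hypothesis BfE : forall a b v, Bs f a b v <-> [/\ v = false, b = j, a < m, a <> j & a <> q].
Implicit Types (s : state V) (e : entry V).

Record bfin_at s tr0 d post : Prop := BfinAt {
  bf_trail : trail s = tr0 ++ d :: post;
  bf_dec : ereason d = None;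
  bf_lev : dlevel tr0 = f;
  bf_base : forall a b v, on tr0 a b v <-> Bs f a b v;
  bf_code : code (elit d) q j false;
  bf_some : all (fun e => isSome (ereason e)) post;
  bf_in : forall a b v, on (trail s) a b v -> beta_in j m a b v;
  bf_pos : forall t1 e t2 a b v, trail s = t1 ++ e :: t2 -> code (elit e) a b v ->
    beta_z m a b v -> on t1 m.+1 m true;
  bf_full : forall a, on (processed s) a m.+1 false ->
    forall i, i < m.+1 -> on (trail s) i m.+1 false
}.

Definition bfin s := exists tr0 d post, bfin_at s tr0 d post.

Section AtState.

Variables (s : state V) (tr0 : seq (entry V)) (d : entry V) (post : seq (entry V)).
Hypotheses (ws : wfs (OP n) s) (ls : learned s = learnt n h).
Hypothesis F : bfin_at s tr0 d post.

Let w : wft (clause_of (OP n) s) (trail s) := ws.1.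

Lemma bfacts : beta_facts n j m (on (trail s)) (on (processed s)).
Proof.
split.
- exact: on_code.
- exact: (bf_in F).
- exact: on_processed.
- move=> a b v /on_split [t1 [e [t2 [E c]]]] bz.
  by rewrite E; apply/on_prefix; apply: (bf_pos F E c bz).
exact: (bf_full F).
Qed.

Lemma bf_row r : r < m -> r <> j -> on (tr0 ++ [:: d]) r j false.
Proof.
move=> rm rj; have [->|/eqP rq] := eqVneq r q; first by apply: on_mid; apply: bf_code F.
by apply/on_prefix/(bf_base F)/BfE.
Qed.

Lemma bf_reason t1 e t2 a b v : trail s = t1 ++ e :: t2 -> code (elit e) a b v ->
  (v = false -> b <> j) ->
  exists p1 N, [/\ t1 = tr0 ++ d :: p1, post = p1 ++ e :: t2, okN n h N &
    [/\ ereason e = Some (cls n N), nin N a b v & nothers (on t1) N a b v]].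
Proof.
move=> E c vb; have E0 := E; rewrite (bf_trail F) in E0.
case: (cat_split E0) => [[u [E1 _]]|[u [E1 E2]]].
  have /BfE[Ev Eb _ _ _] : Bs f a b v by apply/(bf_base F); rewrite E1; apply: on_mid.
  by case: (vb Ev).
case: u E1 E2 => [|d' p1] E1 /= [Ed Ep].
  by subst e; have [_ Eb Ev] := code_fun (bf_code F) c; case: (vb (esym Ev)).
subst d'; have := bf_some F; rewrite Ep all_cat /= => /and3P[_ re _].
case re' : (ereason e) re => [C|//] _.
have [dC eC _] := wft_reason w E re'.
have [N ok EC] := (clause_ofP C gh ls).1 dC; subst C.
exists p1, N; split=> //; split=> //.
  by move: eC; rewrite in_cls; case: c => -> -> ->.
exact: reason_others n1 gh ok w E re' c.
Qed.

Lemma bf_sub t1 t2 a b v : trail s = t1 ++ t2 -> on t1 a b v -> beta_in j m a b v.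
Proof. by move=> E o; apply: (bf_in F); rewrite E; apply: on_prefix. Qed.

Lemma bf_layer t1 e t2 r : trail s = t1 ++ e :: t2 -> code (elit e) r m false -> r < m ->
  on t1 m j true.
Proof.
have [jm mn qm qj qmax okp hKm hKz hKo] := G.
move=> E c rm; have [|p1 [N [_ _ ok [_ nn no]]]] := bf_reason E c; first by move=> _; lia.
have sub := bf_sub E.
case: N ok nn no => [i k l|i k|a k] ok nn no.
- have [[hi hk hl] [ik kl il]] := ok; have [o1 o2 o3] := NA_others no.
  case/or3P: nn => /and3P[/eqP E1 /eqP E2 //] _; subst.
  + have o := o2 ltac:(congruence); have := sub _ _ _ o; rewrite /= /betaT => C.
    by have <- : l = j by lia.
  + have := sub _ _ _ (o1 ltac:(congruence)); have := sub _ _ _ (o3 ltac:(congruence)).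
    by rewrite /= /betaT /betaF; lia.
- have [hi hk ik] := ok; have [o1 o2] := NB_others no.
  case/orP: nn => /and3P[/eqP E1 /eqP E2 _]; subst.
  + have o := o2 ltac:(congruence); have := sub _ _ _ o; rewrite /= /betaT => C.
    by have <- : i = j by lia.
  + have o := o1 ltac:(congruence); have := sub _ _ _ o; rewrite /= /betaT => C.
    by have <- : k = j by lia.
by move: nn; rewrite /= !andbF.
Qed.

Lemma bf_zm t1 e t2 : trail s = t1 ++ e :: t2 -> code (elit e) m.+1 m true ->
  forall r, r < m -> on t1 r m false.
Proof.
have [jm mn qm qj qmax okp hKm hKz hKo] := G.
move=> E c; have [//|p1 [N [_ _ ok [_ nn no]]]] := bf_reason E c.
have sub := bf_sub E.
case: N ok nn no => [i k l|i k|a k] ok nn no.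
- have [[hi hk hl] [ik kl il]] := ok; have [o1 o2 o3] := NA_others no.
  move: nn; rewrite /= !andbF !andbT /= => /andP[/eqP E1 /eqP E2]; subst i l.
  have := sub _ _ _ (o2 ltac:(congruence)).
  by rewrite /= /betaT; lia.
- by move: nn; rewrite /= !andbF.
move: nn => /= /and3P[/eqP Ea hr _]; subst a; have Ek := hKm _ ok; subst k.
by move=> r rm; apply: (NC_others no); rewrite /inrows; lia.
Qed.

Lemma bf_pivot t1 e t2 : trail s = t1 ++ e :: t2 -> code (elit e) m j true ->
  exists p1, [/\ t1 = tr0 ++ d :: p1, post = p1 ++ e :: t2 & ereason e = Some (cls n (NC j m))].
Proof.
have [jm mn qm qj qmax okp hKm hKz hKo] := G.
move=> E c; have [//|p1 [N [h1 h2 ok [re nn no]]]] := bf_reason E c.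
exists p1; split=> //; rewrite re; congr (Some (cls _ _)).
have sub := bf_sub E.
case: N ok nn no {re} => [i k l|i k|a k] ok nn no.
- have [[hi hk hl] [ik kl il]] := ok; have [o1 o2 o3] := NA_others no.
  move: nn; rewrite /= !andbF !andbT /= => /andP[/eqP E1 /eqP E2]; subst i l.
  have := sub _ _ _ (o1 ltac:(congruence)).
  by rewrite /= /betaT; lia.
- by move: nn; rewrite /= !andbF.
move: nn => /= /and3P[/eqP Ea hr _]; subst a.
have oth r' : inrows j k r' -> r' <> m -> j = j /\ r' < m.
  move=> g1 g2; have := sub _ _ _ (NC_others no g1 g2); rewrite /= /betaF; lia.
by have [_ -> _] := hKo j k m ok ltac:(lia) ltac:(lia) hr oth.
Qed.

Lemma bf_pivot_first t1 e t2 p1 a b v : trail s = t1 ++ e :: t2 -> t1 = tr0 ++ d :: p1 ->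
  code (elit e) a b v -> (a, b, v) = (m, j, true) \/ on t1 m j true.
Proof.
have [jm mn qm qj qmax okp hKm hKz hKo] := G.
move=> E t1E c.
have layer t a' : on t1 a' m false -> a' < m -> t = t1 -> on t1 m j true.
  case/on_split=> u1 [e1 [u2 [Eu c1]]] am _; rewrite Eu.
  have E1 : trail s = u1 ++ e1 :: (u2 ++ e :: t2) by rewrite E Eu -catA.
  by apply/on_prefix/(bf_layer E1 c1 am).
have zm : on t1 m.+1 m true -> on t1 m j true.
  case/on_split=> u1 [e1 [u2 [Eu c1]]].
  have E1 : trail s = u1 ++ e1 :: (u2 ++ e :: t2) by rewrite E Eu -catA.
  have o := bf_zm E1 c1 jm.
  by apply: (layer t1 j) => //; rewrite Eu; apply: on_prefix.
have bi : beta_in j m a b v by apply: (bf_in F); rewrite E; apply: on_mid.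
case: v bi c => [bi c|bi c].
  have [[Ea Eb]|[Ea Eb]] := bi; first by left; rewrite Ea Eb.
  right; have [Ebm|/eqP Ebm] := eqVneq b m.
    by rewrite Ea Ebm in c; apply: (layer t1 j) => //; apply: (bf_zm E c).
  by apply/zm/(bf_pos F E c).
right; have [[Eb [am aj]]|[[Eb am]|Eb]] := bi.
- exfalso; subst b; apply: (pos_uniq w E c); rewrite t1E -cat_rcons -cats1.
  by apply: on_prefix; apply: bf_row.
- by subst b; apply: (bf_layer E c).
by apply/zm/(bf_pos F E c).
Qed.

Lemma beta_uip : (forall i, i < m.+1 -> on (trail s) i m.+1 false) ->
  uip1 (trail s) (cls n (NC m.+1 m.+1)) = cls n (NC j m.-1).
Proof.
move=> full; have [jm mn qm qj qmax okp hKm hKz hKo] := G.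
have H := bfacts.
have pv : on (trail s) m j true.
  have [u1 [e1 [u2 [Eu c1]]]] := on_split (full m (leqnn _)).
  have /on_split [v1 [e2 [v2 [Ev c2]]]] : on u1 m.+1 m true by apply: (bf_pos F Eu c1).
  have E2 : trail s = v1 ++ e2 :: (v2 ++ e1 :: u2) by rewrite Eu Ev -catA.
  have /on_split [x1 [e3 [x2 [Ex c3]]]] := bf_zm E2 c2 jm.
  have E3 : trail s = x1 ++ e3 :: (x2 ++ e2 :: (v2 ++ e1 :: u2)) by rewrite E2 Ex -catA.
  by rewrite E3; apply/on_prefix/(bf_layer E3 c3 jm).
have [t1 [e0 [t2 [E c0]]]] := on_split pv.
have [mid [t1E pE r0]] := bf_pivot E c0.
have trE : trail s = tr0 ++ d :: mid ++ e0 :: t2 by rewrite E t1E -catA.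
have nomid a b v : on (d :: mid) a b v -> (a, b, v) = (q, j, false).
  case/on_split=> u1 [e [u2 [Eu ce]]].
  case: u1 Eu => [|d' u1] /= [Ed Eu].
    by subst e; have [<- <- <-] := code_fun (bf_code F) ce.
  subst d' mid; exfalso.
  have t1E' : t1 = (tr0 ++ d :: u1) ++ e :: u2 by rewrite t1E -catA.
  have Et : trail s = (tr0 ++ d :: u1) ++ e :: (u2 ++ e0 :: t2).
    by rewrite [LHS]E t1E' -!catA.
  case: (bf_pivot_first Et erefl ce) => [[Ea Eb Ev]|o].
    by subst; apply: (pos_uniq w E c0); rewrite t1E'; apply: on_mid.
  by apply: (pos_uniq w E c0); rewrite t1E'; apply: on_prefix.
have okf : okN n h (NC m.+1 m.+1) by split; [lia|left; lia].
have w' := w; rewrite trE in w' *.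
apply: (uip1_codes (h := h) (Np := NC j m) (S1 := beta1 j m q) (S2 := beta2 j m q) (ua := q) (ub := j)
  (uv := true) n1 gh w' (bf_dec F) _ okf r0 c0).
- by rewrite -pE; apply: bf_some F.
- move=> a b v an bn; rewrite /= /inrows; split.
    by move=> ?; split; [lia|case; lia].
  case=> /and3P[/eqP -> hr ->] ne; have am : a <> m by move=> E1; apply: ne; rewrite E1.
  lia.
- by move=> a b v; rewrite /beta1 /beta2; case: v; lia.
- move=> a b v ss /(bf_base F) /BfE []; move: ss; rewrite /beta1 /beta2.
  by case: v => //=; lia.
- move=> a b v ss /nomid [Ea Eb]; move: ss; rewrite Ea Eb /beta2.
  by case: v => //=; lia.
- move=> a b v ss /nomid [Ea Eb]; move: ss (qmax m.-1); rewrite Ea Eb /beta1 /= /inrows.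
  by case: v => //=; lia.
- by move=> a b v /= /and3P[_ _ ->] /nomid /= [-> ->].
- move=> S p1 e p2 a b v hS Ep ce Sab.
  have Et : trail s = (t1 ++ e0 :: p1) ++ e :: p2 by rewrite E Ep -catA.
  have dup : on (t1 ++ e0 :: p1) a b v -> False by apply: (pos_uniq w Et ce).
  have nq : v = false -> a = q -> b <> j.
    move=> Ev Ea Eb; apply: dup; rewrite Ev Ea Eb t1E; apply: on_prefix.
    by rewrite -cat_rcons -cats1; apply: on_prefix; apply: bf_row.
  have np : v = true -> a = m -> b <> j.
    by move=> Ev Ea Eb; apply: dup; rewrite Ev Ea Eb; apply: on_mid.
  have bi : beta_in j m a b v by apply: (bf_in F); rewrite Et; apply: on_mid.
  have vb : v = false -> b <> j.
    move=> Ev Eb; rewrite Ev Eb in bi dup nq; move: bi; rewrite /= /betaF => bi.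
    apply: dup; rewrite t1E; apply: on_prefix.
    by rewrite -cat_rcons -cats1; apply: on_prefix; apply: bf_row; lia.
  have [p3 [N [_ _ ok [re nn no]]]] := bf_reason Et ce vb.
  have nos : nothers (on (trail s)) N a b v.
    by move=> a' b' v' n1' n2'; rewrite Et; apply/on_prefix/no.
  have [_ _ /eqP ab] := nin_code n1 gh ok nn.
  have [s1 s2] := beta_reason n1 G H ok nn ab nos bi nq np hS Sab.
  by exists N.
- by rewrite -trE => a b v /= /and3P[/eqP -> hr ->]; apply: full; move: hr; rewrite /inrows; lia.
- move=> a b v /= /and3P[/eqP -> hr ->]; rewrite /beta1 /beta2 !eqxx !orbT /=.
  by have [Eq|nq] := eqVneq a q; [constructor 1|constructor 2].
- by exists q, m.+1, true; rewrite /beta1 /= /inrows !eqxx !orbT; split=> //; lia.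
exists j, m.+1, true; rewrite /beta2 /= /inrows !eqxx !orbT; split=> //; first lia.
by rewrite andbT; apply/eqP => E1; case: qj.
Qed.

End AtState.

Hypotheses (drf : dr f = q) (dcf : dc f = j).

Lemma beta_start s : wfs (OP n) s -> learned s = learnt n h ->
  final_start f Bs dr dc s -> bfin s.
Proof.
move=> ws ls [s0 [x0 [[qu qs lev] onB cx Es]]].
have [jm mn qm qj qmax okp hKm hKz hKo] := G.
have pE : processed s = trail s0.
  by rewrite Es processed_push ?qs // /processed qs take_size.
have trE : trail s = trail s0 ++ [:: Entry (x0, false) (dlevel (trail s0)).+1 None].
  by rewrite Es /= cats1.
rewrite drf dcf in cx.
have inF a b v : on (trail s) a b v -> [/\ b = j, v = false, a < m & a <> j].
  rewrite trE on_cat => /orP[/onB /BfE [? ? ? ? _] //|/onP [l]].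
  by rewrite inE => /eqP -> cl; have [<- <- <-] := code_fun cx cl.
exists (trail s0), (Entry (x0, false) (dlevel (trail s0)).+1 None), [::]; split=> //.
- by move=> a b v /inF [-> -> ? ?]; left.
- move=> t1 e t2 a b v E ce bz; exfalso.
  have /inF [Eb Ev _ _] : on (trail s) a b v by rewrite E; apply: on_mid.
  by move: bz; rewrite Eb Ev /beta_z; lia.
by move=> a /on_processed /inF [Eb _ _ _]; lia.
Qed.

Lemma bfin_lev s tr0 d post : bfin_at s tr0 d post -> 0 < dlevel (trail s).
Proof. by move=> F; rewrite (bf_trail F) dlevel_cat /= (bf_dec F) addnCA. Qed.

Lemma beta_full s tr0 d post : wfs (OP n) s -> learned s = learnt n h ->
  quiescent (OP n) s -> bfin_at s tr0 d post -> on (processed s) m.+1 m true ->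
  forall i, i < m.+1 -> on (trail s) i m.+1 false.
Proof.
move=> ws ls qu F zm i iz.
have [jm mn qm qj qmax okp hKm hKz hKo] := G.
have pF r : r < m -> on (processed s) r m false.
  have [t1 [e [t2 [E c]]]] := on_split zm.
  have Et : trail s = t1 ++ e :: (t2 ++ drop (qhead s) (trail s)).
    by rewrite -[LHS](cat_take_drop (qhead s)) -/(processed s) E -catA.
  by move=> rm; rewrite E; apply/on_prefix/(bf_zm ws ls F Et c).
have nT : on (trail s) i m.+1 true -> False.
  by move/(bf_in F); rewrite /= /betaT; lia.
have [Eij|/eqP ij] := eqVneq i m.
  subst i; suff : on (trail s) m m.+1 true || on (trail s) m m.+1 false by case/orP.
  apply: (nq_assigned n1 gh ls qu (N := NB m.+1 m) (v := false)).
  - by split=> //; lia.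
  - by rewrite /= !eqxx orbT.
  move=> a' b' v' /= nn ne; have [Ea Eb Ev] : [/\ a' = m.+1, b' = m & v' = false].
    case: v' nn ne => nn ne; first lia.
    have [E|am] := eqVneq a' m.+1; first by subst; split=> //; lia.
    by case: ne; congr (_, _, _); lia.
  by subst.
suff : on (trail s) i m.+1 true || on (trail s) i m.+1 false by case/orP.
apply: (nq_assigned n1 gh ls qu (N := NA i m.+1 m) (v := false)).
- by split; split; lia.
- by rewrite /= !eqxx.
move=> a' b' v' /= /or3P[]/and3P[/eqP -> /eqP -> hv] ne; case: v' hv ne => // _ ne.
by apply: pF; lia.
Qed.

Lemma beta_step s c : wfs (OP n) s -> learned s = learnt n h ->
  snap Bs dr dc (trail s) -> bfin s -> op_step delta h s c ->
  (exists s', [/\ c = Running s', wfs (OP n) s', learned s' = learnt n h,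
     snap Bs dr dc (trail s') & bfin s']) \/
  0 < dlevel (trail s) /\ c = Running (restart s (cls n (NC j m.-1))).
Proof.
move=> ws ls sn [tr0 [d [post F]]] st.
have [jm mn qm qj qmax okp hKm hKz hKo] := G.
have H := bfacts F.
have lev := bfin_lev F.
have okm : okN n h (NC m m.+1) by split; [lia|left; lia].
have okz : okN n h (NC m.+1 m.+1) by split; [lia|left; lia].
have closed : quiescent (OP n) s -> qhead s = size (trail s) -> False.
  move=> qu qs; have up := upc_trail n1 gh qu qs ls.
  have pE : processed s = trail s by rewrite /processed qs take_size.
  have rows r : r < m -> r <> j -> on (trail s) r j false.
    move=> rm rj; rewrite (bf_trail F) -cat_rcons -cats1; apply: on_prefix.
    exact: (bf_row F).
  have pv : on (trail s) m j true.
    apply: (upc_C up okp) => [|r' hr ne]; first by rewrite /inrows; lia.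
    by apply: rows; move: hr; rewrite /inrows; lia.
  have lay r : r < m -> on (trail s) r m false.
    move=> rm; have [->|/eqP rj] := eqVneq r j.
      by apply: (upc_B up _ _ _ pv); lia.
    have [_ _ h3] := upc_A (i := r) (j := m) (k := j) up ltac:(lia) ltac:(lia) ltac:(lia)
      ltac:(lia) ltac:(lia) ltac:(lia).
    by apply: h3 => //; apply: rows.
  have zm : on (trail s) m.+1 m true.
    apply: (upc_C up okm) => [|r' hr ne]; first by rewrite /inrows; lia.
    by apply: lay; move: hr; rewrite /inrows; lia.
  have full := beta_full ws ls qu F; rewrite pE in full.
  apply: (nq_notfalse n1 gh ls qu okz); rewrite pE => a b v /= /and3P[/eqP -> hr ->].
  by apply: full => //; move: hr; rewrite /inrows; lia.
case: st ls => {c}.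
- move=> N l ok un us ls; left; eexists; split; first reflexivity.
  + exact: (wfs_push_cls n1 gh ls ws ok un).
  + by [].
  + exact: snap_push.
  have lpp a b v : lastp s a b v -> on (processed s) a b v.
    by case=> pr [e [-> c]]; apply/on_rcons; right.
  have [al1 al2] := beta_unit n1 G H lpp ok un us.
  set e := Entry _ _ _; have ps := processed_push e ws.2.
  exists tr0, d, (rcons post e); split; rewrite ?ps; try exact: (bf_dec F); try exact: (bf_lev F);
    try exact: (bf_base F); try exact: (bf_code F).
  + by rewrite /= (bf_trail F) -cats1 -catA /= cats1.
  + by rewrite all_rcons /=; apply: bf_some F.
  + move=> a b v /on_rcons [/(bf_in F) //|c1].
    by have [<- <- <-] := code_fun (codeE l) c1.
  + move=> t1 e1 t2 a b v /= E c1 bz; case: (rcons_split E) => [[-> Ee _]|[t2' _ E2]].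
      by subst e1; have [Ea Eb Ev] := code_fun (codeE l) c1; apply: al2; rewrite Ea Eb Ev.
    exact: (bf_pos F E2 c1 bz).
  + by move=> a o i im; apply/on_rcons; left; apply: (bf_full F o).
- move=> qu lt ls; left; eexists; split; first reflexivity; try by [].
    by case: ws => w _; split.
  have [e [t2 [E ps]]] := processed_dequeue lt.
  set s' := State _ _ _ in ps *.
  exists tr0, d, post; split; try exact: (bf_dec F); try exact: (bf_lev F); try exact: (bf_some F);
    try exact: (bf_base F); try exact: (bf_code F); try exact: (bf_trail F); try exact: (bf_pos F);
    try exact: (bf_in F).
  move=> a; rewrite ps => /on_rcons [o|c1]; first exact: (bf_full F o).
  by apply: (beta_full ws ls qu F); apply: (bf_pos F E c1).
- move=> N ok nf us _ ls; right; split=> //.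
  have EN := beta_false n1 gh G H ok nf; subst N.
  rewrite (beta_uip ws ls F) // => i im.
  by apply: (nf i m.+1 true); rewrite /= /inrows eqxx; lia.
- by move=> N _ _ _ lz; rewrite lz in lev.
- by move=> x0 qu qs; case: (closed qu qs).
by move=> qu qs; case: (closed qu qs).
Qed.

End Beta.

(** * Rounds *)

(* The row at position [i], counted from 0, of column [j]. *)
Definition rho j i := i + (j <= i).

Lemma another_row a k r : 1 < k -> exists2 r', inrows a k r' & r' <> r.
Proof.
move=> k2; pose r1 := rho a 0; pose r2 := rho a 1.
by have [E|E] := eqVneq r r1; [exists r2|exists r1]; move: E; rewrite /inrows /r1 /r2 /rho; lia.
Qed.

Section Beats.

Variable h : seq (nat * nat).

Definition beats a b a' b' :=
  (exists h1 p h2, [/\ h = h1 ++ p :: h2, occ a b p, ~~ occ a' b' p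
     & {in h2, forall p', occ a b p' = occ a' b' p'}]) \/
  ({in h, forall p, occ a b p = occ a' b' p} /\ (b < b' \/ b = b' /\ a < a')).

Lemma beats_last h' j m i a' b' : h = rcons h' (j, m) ->
  (forall k, (j, k) \in h -> m <= k) -> i < m ->
  ~ (b' = j /\ a' <> j /\ a' < rho j i) -> (a', b') <> (rho j i, j) -> a' <> b' ->
  beats (rho j i) j a' b'.
Proof.
rewrite /rho => hE mk im nB ne ab.
have [o|no] := boolP (occ a' b' (j, m)).
  right; move: o; rewrite /occ /= => /andP[/eqP Eb]; subst b'; rewrite /inrows => o.
  split; last first.
    right; split=> //; suff : a' <> i + (j <= i) by lia.
    by move=> E; apply: ne; rewrite E.
  move=> [a k] hk; rewrite /occ /inrows /=; case: eqP => //= Ea; subst a.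
  have := mk _ hk; lia.
left; exists h', (j, m), [::]; rewrite cats1; split=> //.
by rewrite /occ /inrows /= eqxx; lia.
Qed.

Lemma beats_nil j i a' b' : h = [::] -> j = 0 ->
  ~ (b' = j /\ a' <> j /\ a' < rho j i) -> (a', b') <> (rho j i, j) -> a' <> b' ->
  beats (rho j i) j a' b'.
Proof.
rewrite /rho => hE jE nB ne ab; subst j; right; split; first by move=> p; rewrite hE in_nil.
have [Eb|/eqP b0] := eqVneq b' 0; last by left; lia.
right; split=> //; suff : a' <> i + 1 by lia.
by move=> E; apply: ne; rewrite E Eb.
Qed.

Lemma beats_block x i a' b' h1 h2 : h = h1 ++ (x, i) :: h2 ->
  {in h2, forall p, p.1 = x /\ p.2 < i} -> x < i ->
  (b' = x -> i < a') -> beats i x a' b'.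
Proof.
move=> hE h2P xi ba; left; exists h1, (x, i), h2; split=> //.
- by rewrite /occ /inrows /= eqxx; lia.
- by rewrite /occ /inrows /=; have [E|//] := eqVneq b' x; have := ba E; lia.
move=> [a k] /h2P /= [-> ki]; rewrite /occ /inrows /= eqxx /=.
by have [E|_] := eqVneq b' x; [have := ba E|]; lia.
Qed.

End Beats.

Section Plans.

Variables (n : nat) (R : realFieldType) (delta : R).
Hypotheses (d0 : (0 < delta)%R) (d2 : (delta <= 2^-1)%R).
Notation V := (opvar n).
Variable h : seq (nat * nat).
Hypotheses (n1 : 1 < n) (gh : goodh n h).

Lemma beats_branch (B : nat -> nat -> bool -> Prop) a b :
  a < n -> b < n -> a <> b -> ~ B a b true -> ~ B a b false ->
  (forall a' b', a' < n -> b' < n -> a' <> b' -> ~ B a' b' true -> ~ B a' b' false ->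
     (a', b') <> (a, b) -> beats h a b a' b') ->
  forall s : state V, learned s = learnt n h ->
    (forall a b v, on (trail s) a b v <-> B a b v) ->
    exists x, [/\ branch delta (col_major n) s = Some x, ~~ assigned (trail s) x,
                  vrow x = a & vcol x = b].
Proof.
move=> an bn /eqP ab nT nF H s ls onB.
have [x [xa xb]] := opvar_ex an bn ab.
have ass y : assigned (trail s) y = on (trail s) (vrow y) (vcol y) true || on (trail s) (vrow y) (vcol y) false.
  exact: (assigned_on _ (l := (y, true)) (codeE _)).
have ux : ~~ assigned (trail s) x.
  by rewrite ass xa xb negb_or; apply/andP; split; apply/negP => /onB.
exists x; split=> //; apply: (branch_some gh ls ux) => y.
rewrite ass negb_or => /andP[/negP u1 /negP u2] yx.
case: (H (vrow y) (vcol y)); rewrite ?vrow_lt ?vcol_lt //.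
- exact/eqP/vrow_neq_vcol.
- by move/onB.
- by move/onB.
- by case=> E1 E2; apply: yx; apply: opvar_eq; rewrite ?xa ?xb.
- case=> h1 [p [h2 [E o1 o2 o3]]]; left; rewrite E xa xb.
  exact: score_lt d0 d2 _ _ _ _ _ _ _ o1 o2 o3.
case=> eq lt; right; split; first by apply: score_eq => p /eq E; rewrite xa xb E.
by rewrite /colmajor_lt xa xb; lia.
Qed.

Section Direct.

Variables (j m : nat).
Hypotheses (jm : j < m) (mn : m < n) (m2 : 1 < m)
  (Kj : forall k, okN n h (NC j k) -> m <= k)
  (K2 : forall a k, okN n h (NC a k) -> a <> j -> 1 < k)
  (Hb : forall i a' b', i < m.-1 -> ~ (b' = j /\ a' <> j /\ a' < rho j i) ->
     (a', b') <> (rho j i, j) -> a' <> b' -> beats h (rho j i) j a' b').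

Definition direct_set i a b v := [/\ v = false, b = j, a <> j & a < rho j i].

Lemma direct_plan : plan n delta h m.-2 direct_set (rho j) (fun _ => j).
Proof.
split.
- move=> i im; apply: upc_intro; rewrite /direct_set.
  + by move=> a b c *; split=> -[].
  + by move=> a b *; exfalso; match goal with H : [/\ true = false, _, _ & _] |- _ => case: H end.
  move=> a k r ok hr no; exfalso; have [Ea|/eqP aj] := eqVneq a j; last first.
    have [r' h1 h2] := another_row a r (K2 ok aj).
    by have [_ /aj] := no _ h1 h2.
  subst a; have km := Kj ok.
  have [r' [h1 h2 h3]] : exists r', [/\ inrows j k r', r' <> r & rho j i <= r'].
    by have [E|E] := eqVneq r (rho j i); [exists (rho j i.+1)|exists (rho j i)];
      move: E; rewrite /inrows /rho; split; lia.
  by have [_ _ _] := no _ h1 h2; lia.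
- by move=> i _ a b [].
- by move=> i im a b v [-> -> aj lt]; split=> //; move: lt; rewrite /rho; lia.
- by move=> i im; split=> //; rewrite /rho; lia.
- move=> i im A uA cA sub prev a b v [-> -> aj lt]; case: i im sub prev lt => [|i] im sub prev lt.
    by move: lt; rewrite /rho; lia.
  have [h1 h2] := prev isT; have [->//|/eqP ai] := eqVneq a (rho j i).
  by apply: h1; split=> //; move: lt ai; rewrite /rho /=; lia.
move=> i im; apply: beats_branch.
- by rewrite /rho; lia.
- by lia.
- by rewrite /rho; lia.
- by case.
- by case; rewrite ltnn.
move=> a' b' an bn ab _ nF ne; apply: Hb => //; first lia.
by case=> E1 [E2 E3]; apply: nF; split.
Qed.

End Direct.

Section Tail.

Variables (m : nat).
Hypotheses (mn : m < n) (m3 : 2 < m)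
  (K0 : forall k, okN n h (NC 0 k) -> m <= k)
  (K2 : forall a k, okN n h (NC a k) -> a <> 1 -> 1 < k)
  (K1 : forall a k, okN n h (NC a k) -> 0 < k)
  (K11 : okN n h (NC 1 1))
  (Hb : forall i a' b', 0 < i < m.-1 -> ~ (b' = 0 /\ a' <> 0 /\ a' < rho 0 i) ->
     (a', b') <> (rho 0 i, 0) -> a' <> b' -> beats h (rho 0 i) 0 a' b').

Definition tail_set i a b (v : bool) :=
  if v then a = 0 /\ b = 1 else b = 0 /\ a <> 0 /\ a < i.+2.

Lemma tail_plan : plan n delta h (m - 3) tail_set (fun i => i.+2) (fun _ => 0).
Proof.
split.
- move=> i im; apply: upc_intro; rewrite /tail_set.
  + by move=> a b c *; split; lia.
  + by move=> a b *; lia.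
  move=> a k r ok hr no.
  have [Ea|/eqP a1] := eqVneq a 1.
    subst a; have k0 := K1 ok.
    have [//|/eqP r0] := eqVneq r 0.
    have := no 0; rewrite /inrows; lia.
  exfalso; have [Ea|/eqP aj] := eqVneq a 0; last first.
    have [r' h1 h2] := another_row a r (K2 ok a1).
    by have [/aj] := no _ h1 h2.
  subst a; have km := K0 ok.
  have [r' [h1 h2 h3]] : exists r', [/\ inrows 0 k r', r' <> r & i.+2 <= r'].
    by have [E|E] := eqVneq r i.+2; [exists i.+3|exists i.+2]; move: E; rewrite /inrows; split; lia.
  by have := no _ h1 h2; lia.
- by move=> i _ a b /=; lia.
- by move=> i im a b [] //=; lia.
- by move=> i im /=; lia.
- move=> i im A uA cA sub prev.
  have T1 : A 0 1 true.
    by apply: (upc_C uA K11) => [|r]; rewrite /inrows; lia.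
  have F1 : A 1 0 false by apply: (upc_B uA) T1; lia.
  case=> [|a] b [] /=; [by case=> _ ->|by lia|by lia|].
  case=> -> [_ lt]; case: i im sub prev lt => [|i] im sub prev lt.
    by have -> : a = 0 by lia.
  have [h1 h2] := prev isT; have [->//|/eqP ai] := eqVneq a.+1 i.+2.
  by apply: h1 => /=; lia.
move=> i im; apply: beats_branch => /=; try lia.
move=> a' b' an bn ab nT nF ne; have -> : i.+2 = rho 0 i.+1 by rewrite /rho; lia.
apply: Hb => //; first by lia.
  by rewrite /rho; lia.
by rewrite (_ : rho 0 i.+1 = i.+2) // /rho; lia.
Qed.

End Tail.

Section Indirect.

Variables (x c m : nat).
Let g := c - (x < c).
Hypotheses (mn : m < n) (m3 : 2 < m) (xc : x = c.+1 \/ x = 0 /\ 0 < c) (gm : g.+2 < m) (xm : x < m.-1)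
  (Kx : forall k, okN n h (NC x k) -> g < k)
  (Kxg : okN n h (NC x g.+1))
  (Kc : forall k, okN n h (NC c k) -> m <= k)
  (K2 : forall a k, okN n h (NC a k) -> a <> x -> 1 < k)
  (Hb1 : forall i a' b', i < g -> ~ (b' = x /\ a' <> x /\ a' < rho x i) ->
     (a', b') <> (rho x i, x) -> a' <> b' -> beats h (rho x i) x a' b')
  (Hb2 : forall i a' b', g + 2 <= i < m -> (b' = x -> i < a') -> beats h i x a' b').

(* The first [g] decisions lead to P(c,x); the next ones propagate to column [c]. *)
Definition ind_set i a b (v : bool) :=
  if i < g then v = false /\ b = x /\ a <> x /\ a < rho x i
  else if v then a = c /\ b = x
  else b = x /\ a <> x /\ a <> c /\ a < i.+2 \/ b = c /\ a <> c /\ a < i.+2.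

Definition ind_row i := if i < g then rho x i else i.+2.

Lemma ind_plan : plan n delta h (m - 3) ind_set ind_row (fun _ => x).
Proof.
have gE : g = c - (x < c) by [].
have xcF : x <> c by lia.
split.
- move=> i im; apply: upc_intro; rewrite /ind_set; case: (ltnP i g) => ig /=.
  + by move=> a b d *; split; lia.
  + by move=> a b d *; split; lia.
  + by move=> a b *; lia.
  + by move=> a b *; lia.
  + move=> a k r ok hr no; exfalso; have [Ea|/eqP ax] := eqVneq a x; last first.
      have [r' h1 h2] := another_row a r (K2 ok ax).
      by have [_ [/ax]] := no _ h1 h2.
    subst a; have km := Kx ok.
    have [r' [h1 h2 h3]] : exists r', [/\ inrows x k r', r' <> r & rho x i <= r'].
      by have [E|E] := eqVneq r (rho x i); [exists (rho x i.+1)|exists (rho x i)];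
        move: E; rewrite /inrows /rho; split; lia.
    by have := no _ h1 h2; lia.
  move=> a k r ok hr no; have [Ea|/eqP ax] := eqVneq a x.
    subst a; have km := Kx ok.
    have [//|/eqP rc] := eqVneq r c.
    by have := no c; rewrite /inrows; lia.
  exfalso; have [Ea|/eqP ac] := eqVneq a c.
    subst a; have km := Kc ok.
    have [r' [h1 h2 h3]] : exists r', [/\ inrows c k r', r' <> r & i.+2 <= r'].
      by have [E|E] := eqVneq r i.+2; [exists i.+3|exists i.+2]; move: E; rewrite /inrows; split; lia.
    by have := no _ h1 h2; lia.
  have [r' h1 h2] := another_row a r (K2 ok ax).
  by have := no _ h1 h2; lia.
- by move=> i _ a b; rewrite /ind_set; case: (ltnP i g) => /=; lia.
- by move=> i im a b v; rewrite /ind_set /rho; case: (ltnP i g) => ?; case: (ltnP i.+1 g) => ?; case: v => /=; lia.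
- by move=> i im; rewrite /ind_set /ind_row /rho; case: (ltnP i g) => ?; case: (ltnP i.+1 g) => ? /=; lia.
- move=> i im A uA cA sub prev.
  have [ig|ig] := ltnP i g.
    move=> a b v; rewrite /ind_set ig => -[-> [-> [ax lt]]].
    case: i im sub prev lt ig => [|i] im sub prev lt ig.
      by move: lt; rewrite /rho; lia.
    have [h1 h2] := prev isT; have i1g : i < g by lia.
    have [E|/eqP E] := eqVneq a (ind_row i); first by rewrite E.
    by apply: h1; move: E lt; rewrite /= /ind_set /ind_row i1g /rho; lia.
  have lowF r : r < c -> r <> x -> A r x false.
    case: i im sub prev ig => [|i] im sub prev ig rc rx; first lia.
    have [h1 h2] := prev isT.
    have [E|/eqP E] := eqVneq r (ind_row i); first by rewrite E.
    apply: h1; move: E; rewrite /= /ind_set /ind_row /rho; case: (ltnP i g) => ? /=; lia.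
  have T1 : A c x true.
    apply: (upc_C uA Kxg) => [|r hr rc]; first by rewrite /inrows; lia.
    by apply: lowF; move: hr; rewrite /inrows; lia.
  have xF : A x c false by apply: (upc_B uA) T1; lia.
  have row r : r <> x -> r <> c -> r < i.+2 -> A r x false.
    move=> rx rc lt; have [rlc|rgc] := ltnP r c; first exact: lowF.
    case: i im sub prev lt ig => [|i] im sub prev lt ig; first lia.
    have [h1 h2] := prev isT.
    have [E|/eqP E] := eqVneq r (ind_row i); first by rewrite E.
    by apply: h1; move: E; rewrite /= /ind_set /ind_row /rho; case: (ltnP i g) => ? /=; lia.
  move=> a b v; rewrite /ind_set ltnNge ig /=; case: v => [[-> ->]//|].
  case=> [[-> [ax [ac lt]]]|[-> [ac lt]]]; first exact: row.
  have [->//|/eqP ax] := eqVneq a x.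
  have [_ _ h3] := upc_A (i := a) (j := c) (k := x) uA ltac:(lia) ltac:(lia) ltac:(lia) ltac:(lia) ltac:(lia) ltac:(lia).
  by apply: h3 => //; apply: row.
move=> i im; apply: beats_branch; rewrite /ind_row /ind_set; case: (ltnP i g) => ig; try (rewrite /rho /=; lia).
  move=> a' b' an bn ab nT nF ne; apply: Hb1 => //; lia.
move=> a' b' an bn ab nT nF ne; apply: Hb2; first lia.
move=> Eb; subst b'; suff : a' <> i.+2 by lia.
by move=> E; apply: ne; rewrite E.
Qed.

End Indirect.

End Plans.

Section Phases.

Variables (n : nat) (R : realFieldType) (delta : R).
Hypotheses (d0 : (0 < delta)%R) (d2 : (delta <= 2^-1)%R).
Notation V := (opvar n).

(* From any state with learned clauses [h] and no decision, where level 0 is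
   propagated within [B0], the solver learns C(j,k) next. *)
Definition phase_ok (h : seq (nat * nat)) (B0 : nat -> nat -> bool -> Prop) (j k : nat) :=
  exists f Bs dr dc (Fin : state V -> Prop),
  [/\ plan n delta h f Bs dr dc,
      forall a b v, Bs 0 a b v <-> B0 a b v,
      forall s, wfs (OP n) s -> learned s = learnt n h -> snap Bs dr dc (trail s) ->
        final_start f Bs dr dc s -> Fin s
    & forall s c, wfs (OP n) s -> learned s = learnt n h -> snap Bs dr dc (trail s) ->
        Fin s -> op_step delta h s c ->
        (exists s', [/\ c = Running s', wfs (OP n) s', learned s' = learnt n h,
           snap Bs dr dc (trail s') & Fin s']) \/
        0 < dlevel (trail s) /\ c = Running (restart s (cls n (NC j k)))].

Definition no_unit (a b : nat) (v : bool) := False.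
Definition unit01 (a b : nat) (v : bool) := if v then a = 0 /\ b = 1 else a = 1 /\ b = 0.

Section OnePhase.

Variable h : seq (nat * nat).
Hypotheses (n1 : 1 < n) (gh : goodh n h).

Lemma phase_direct j m : j < m -> m < n -> 1 < m ->
  (forall k, okN n h (NC j k) -> m <= k) -> okN n h (NC j m) ->
  (forall k, okN n h (NC m k) -> m <= k) -> okN n h (NC m m) ->
  (forall a k, okN n h (NC a k) -> a <> j -> 1 < k) ->
  (forall i a' b', i < m.-1 -> ~ (b' = j /\ a' <> j /\ a' < rho j i) ->
     (a', b') <> (rho j i, j) -> a' <> b' -> beats h (rho j i) j a' b') ->
  phase_ok h no_unit j m.-1.
Proof.
move=> jm mn m2 Kj Kjm Km Kmm K2 Hb.
have G : gamma_params n h j m n (rho j m.-2) false.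
  split=> //; try (rewrite /rho; lia).
  - by move=> k ok; apply: (K2 _ _ ok); lia.
  move=> a k r ok am hr no; left.
  have [Ea|/eqP aj] := eqVneq a j; last first.
    have [r' h1 h2] := another_row a r (K2 _ _ ok aj).
    by have := no _ h1 h2; rewrite /coreF; lia.
  subst a; have mk := Kj _ ok.
  have rm : r = m.
    have [//|/eqP rm] := eqVneq r m.
    have : coreF j m n false m j by apply: no; [rewrite /inrows|]; lia.
    by rewrite /coreF; lia.
  split=> //; have [//|/eqP km] := eqVneq k m.
  have : coreF j m n false m.+1 j by apply: no; [rewrite /inrows|]; lia.
  by rewrite /coreF; lia.
have BfE a b v : direct_set j m.-2 a b v <-> gcore n j m n false a b v /\ a <> rho j m.-2.
  rewrite /direct_set /gcore /coreT /coreF /rho; split.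
    by case=> -> -> aj lt; split; [left|]; lia.
  case: v => -[h1 h2]; first lia.
  by split=> //; lia.
exists m.-2, (direct_set j), (rho j), (fun _ => j), (gfin (n := n) h j m n (rho j m.-2) false m.-2 (direct_set j)).
split.
- exact: direct_plan.
- by move=> a b v; rewrite /direct_set /no_unit /rho; split=> //; case; lia.
- by move=> s ws ls sn; apply: gamma_start => //; lia.
by move=> s c ws ls sn; apply: gamma_step.
Qed.

Lemma phase_tail m : m < n -> 2 < m ->
  (forall k, okN n h (NC 0 k) -> m <= k) -> okN n h (NC 0 m) ->
  (forall k, okN n h (NC m k) -> m <= k) -> okN n h (NC m m) ->
  (forall a k, okN n h (NC a k) -> a <> 1 -> 1 < k) ->
  (forall a k, okN n h (NC a k) -> 0 < k) -> okN n h (NC 1 1) ->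
  (forall i a' b', 0 < i < m.-1 -> ~ (b' = 0 /\ a' <> 0 /\ a' < rho 0 i) ->
     (a', b') <> (rho 0 i, 0) -> a' <> b' -> beats h (rho 0 i) 0 a' b') ->
  phase_ok h unit01 0 m.-1.
Proof.
move=> mn m3 K0 K0m Km Kmm K2 K1 K11 Hb.
have G : gamma_params n h 0 m 1 m.-1 false.
  split=> //; try lia.
  - by move=> k ok; apply: (K2 _ _ ok); lia.
  move=> a k r ok am hr no.
  have [Ea|/eqP a1] := eqVneq a 1.
    subst a; right; rewrite /coreT; have [->|/eqP r0] := eqVneq r 0; first lia.
    have := K1 _ _ ok; have := no 0; rewrite /inrows /coreF; lia.
  left; have [Ea|/eqP aj] := eqVneq a 0; last first.
    have [r' h1 h2] := another_row a r (K2 _ _ ok a1).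
    by have := no _ h1 h2; rewrite /coreF; lia.
  subst a; have mk := K0 _ ok.
  have rm : r = m.
    have [//|/eqP rm] := eqVneq r m.
    have : coreF 0 m 1 false m 0 by apply: no; [rewrite /inrows|]; lia.
    by rewrite /coreF; lia.
  split=> //; have [//|/eqP km] := eqVneq k m.
  have : coreF 0 m 1 false m.+1 0 by apply: no; [rewrite /inrows|]; lia.
  by rewrite /coreF; lia.
have BfE a b v : tail_set (m - 3) a b v <-> gcore n 0 m 1 false a b v /\ a <> m.-1.
  by rewrite /tail_set /gcore /coreT /coreF; case: v; lia.
exists (m - 3), tail_set, (fun i => i.+2), (fun _ => 0),
  (gfin (n := n) h 0 m 1 m.-1 false (m - 3) tail_set).
split.
- exact: tail_plan.
- by move=> a b v; rewrite /tail_set /unit01; case: v; lia.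
- by move=> s ws ls sn; apply: gamma_start => //; lia.
by move=> s c ws ls sn; apply: gamma_step => //; lia.
Qed.

Lemma phase_ind x c m : let g := c - (x < c) in
  m < n -> 2 < m -> x = c.+1 \/ x = 0 /\ 1 < c -> g.+2 < m -> x < m.-1 ->
  (forall k, okN n h (NC x k) -> g < k) -> okN n h (NC x g.+1) ->
  (forall k, okN n h (NC c k) -> m <= k) -> okN n h (NC c m) ->
  (forall k, okN n h (NC m k) -> m <= k) -> okN n h (NC m m) ->
  (forall a k, okN n h (NC a k) -> a <> x -> 1 < k) ->
  (forall i a' b', i < g -> ~ (b' = x /\ a' <> x /\ a' < rho x i) ->
     (a', b') <> (rho x i, x) -> a' <> b' -> beats h (rho x i) x a' b') ->
  (forall i a' b', g + 2 <= i < m -> (b' = x -> i < a') -> beats h i x a' b') ->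
  phase_ok h (if g == 0 then unit01 else no_unit) c m.-1.
Proof.
move=> g mn m3 xc gm xm Kx Kxg Kc Kcm Km Kmm K2 Hb1 Hb2.
have gE : g = c - (x < c) by [].
have G : gamma_params n h c m x m.-1 true.
  split=> //; try lia.
  - by move=> k ok; apply: (K2 _ _ ok); lia.
  move=> a k r ok am hr no.
  have [Ea|/eqP ax] := eqVneq a x.
    subst a; right; rewrite /coreT; have [->|/eqP rc] := eqVneq r c; first lia.
    have := Kx _ ok; have := no c; rewrite /inrows /coreF; lia.
  left; have [Ea|/eqP ac] := eqVneq a c; last first.
    have [r' h1 h2] := another_row a r (K2 _ _ ok ax).
    by have := no _ h1 h2; rewrite /coreF; lia.
  subst a; have mk := Kc _ ok.
  have rm : r = m.
    have [//|/eqP rm] := eqVneq r m.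
    have : coreF c m x true m c by apply: no; [rewrite /inrows|]; lia.
    by rewrite /coreF; lia.
  split=> //; have [//|/eqP km] := eqVneq k m.
  have : coreF c m x true m.+1 c by apply: no; [rewrite /inrows|]; lia.
  by rewrite /coreF; lia.
have BfE a b v : ind_set x c (m - 3) a b v <-> gcore n c m x true a b v /\ a <> m.-1.
  rewrite /ind_set /gcore /coreT /coreF (_ : (m - 3 < c - (x < c)) = false); last by lia.
  by case: v; lia.
have drf : ind_row x c (m - 3) = m.-1 by rewrite /ind_row; case: ltnP; lia.
exists (m - 3), (ind_set x c), (ind_row x c), (fun _ => x),
  (gfin (n := n) h c m x m.-1 true (m - 3) (ind_set x c)).
split.
- by apply: ind_plan => //; lia.
- move=> a b v; rewrite /ind_set -/g; case: (posnP g) => [g0|g0].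
    by rewrite /unit01; case: v; lia.
  by rewrite /no_unit /rho; lia.
- by move=> s ws ls sn; apply: gamma_start => //; move=> i _ _ [_ E]; lia.
by move=> s c' ws ls sn; apply: gamma_step.
Qed.

Lemma phase_beta j : j < n - 2 -> 3 < n ->
  (forall k, okN n h (NC j k) -> n - 2 <= k) -> okN n h (NC j (n - 2)) ->
  (forall a k, okN n h (NC a k) -> n - 3 < a -> k = n.-1) ->
  (forall a k, okN n h (NC a k) -> a <> j -> 1 < k) ->
  (forall i a' b', i < (n - 2).-1 -> ~ (b' = j /\ a' <> j /\ a' < rho j i) ->
     (a', b') <> (rho j i, j) -> a' <> b' -> beats h (rho j i) j a' b') ->
  phase_ok h no_unit j (n - 2).-1.
Proof.
move=> jn n4 Kj Kjm Kn K2 Hb; pose m := n - 2; have mE : m = n - 2 by [].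
rewrite -/m in jn Kj Kjm Hb *.
have G : beta_params n h j m (rho j m.-2).
  split=> //; try (rewrite /rho; lia).
  - by move=> k ok; rewrite (Kn _ _ ok); lia.
  - by move=> k ok; rewrite (Kn _ _ ok); lia.
  move=> a k r ok am az hr no.
  have [Ea|/eqP aj] := eqVneq a j; last first.
    have [r' h1 h2] := another_row a r (K2 _ _ ok aj).
    by have [/aj] := no _ h1 h2.
  subst a; have mk := Kj _ ok.
  have rm : r = m.
    have [//|/eqP rm] := eqVneq r m.
    have [_ C] : j = j /\ m < m by apply: no; [rewrite /inrows|]; lia.
    lia.
  split=> //; have [//|/eqP km] := eqVneq k m.
  have [_ C] : j = j /\ m.+1 < m by apply: no; [rewrite /inrows|]; lia.
  lia.
have BfE a b v : direct_set j m.-2 a b v <->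
    [/\ v = false, b = j, a < m, a <> j & a <> rho j m.-2].
  by rewrite /direct_set /rho; split=> -[]; [move=> -> -> | move=> -> ->] => *; split=> //; lia.
exists m.-2, (direct_set j), (rho j), (fun _ => j), (bfin (n := n) j m (rho j m.-2) m.-2 (direct_set j)).
split.
- by apply: direct_plan => //; lia.
- by move=> a b v; rewrite /direct_set /no_unit /rho; split=> //; case; lia.
- by move=> s ws ls sn; apply: (beta_start (h := h)).
by move=> s c ws ls sn; apply: beta_step => //; lia.
Qed.

End OnePhase.

End Phases.

(** * The whole run *)

Section Targets.

Variable n : nat.
Hypothesis n6 : 6 <= n.

Definition in_target (p : nat * nat) : bool :=
  ((p.1 == 0) && (2 <= p.2) || (0 < p.1 <= n - 3) && (p.1 <= p.2)) && (p.2 <= n - 2).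

Definition before (p q : nat * nat) : bool :=
  let hd r := (r.1 == 0) && (n - 3 <= r.2) in
  let tl r := (r.1 == 0) && (r.2 < n - 3) in
  [|| hd p && hd q && (q.2 < p.2), hd p && ~~ hd q,
      (0 < p.1) && (0 < q.1) && ((q.1 < p.1) || (q.1 == p.1) && (q.2 < p.2)),
      (0 < p.1) && tl q | tl p && tl q && (q.2 < p.2)].

Definition targets : seq (nat * nat) :=
  [:: (0, n - 2); (0, n - 3)]
  ++ [seq (j.-1, k) | j <- downto (n - 2) 2, k <- downto (n - 2) (j - 1)]
  ++ [seq (0, k) | k <- downto (n - 4) 2].

Lemma mem_downto a b i : (i \in downto a b) = (b <= i <= a).
Proof. by rewrite mem_rev mem_iota; lia. Qed.

Lemma pairwise_downto a b : pairwise (fun i j => j < i) (downto a b).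
Proof.
rewrite -sorted_pairwise; last by move=> y x z /= h1 h2; apply: ltn_trans h1.
rewrite /downto rev_sorted; exact: iota_ltn_sorted.
Qed.

Lemma mem_targets p : (p \in targets) = in_target p.
Proof.
rewrite /targets !mem_cat !inE; apply/idP/idP.
  case/or3P=> [/orP[]/eqP ->|/allpairsPdep [j [k [hj hk ->]]]|/mapP [k hk ->]]; rewrite /in_target /=.
  - by lia.
  - by lia.
  - by move: hj hk; rewrite !mem_downto; case: eqP; lia.
  - by move: hk; rewrite mem_downto; lia.
case: p => a k; rewrite /in_target /=; case: eqP => [->|a0] hk.
  have [h1|h1] := ltnP k (n - 3).
    apply/orP; right; apply/orP; right; apply/mapP; exists k => //.
    by rewrite mem_downto; lia.
  by apply/orP; left; rewrite !xpair_eqE; lia.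
apply/orP; right; apply/orP; left; apply/allpairsPdep; exists a.+1, k.
by rewrite !mem_downto; split=> //; lia.
Qed.

Lemma pairwise_targets : pairwise before targets.
Proof.
rewrite /targets !pairwise_cat; apply/and3P; split; last (apply/and3P; split).
- apply/allrelP=> p q; rewrite !inE mem_cat => /orP[]/eqP -> /orP[/allpairsPdep [j [k [hj hk ->]]]|/mapP [k hk ->]];
    rewrite /before /=; move: hk; try move: hj; rewrite !mem_downto; lia.
- by rewrite /= /before /=; lia.
- apply/allrelP=> p q /allpairsPdep [j [k [hj hk ->]]] /mapP [k' hk' ->].
  by move: hj hk hk'; rewrite !mem_downto /before /=; lia.
- have : all (fun j => 1 < j) (downto (n - 2) 2) by apply/allP=> j; rewrite mem_downto; lia.
  have := pairwise_downto (n - 2) 2; elim: (downto (n - 2) 2) => //= j s IH /andP[js ps] /andP[j1 s1].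
  rewrite pairwise_cat IH // andbT pairwise_map; apply/andP; split.
    apply/allrelP=> p q /mapP [k _ ->] /allpairsPdep [j' [k' [hj' _ ->]]].
    by have := allP js _ hj'; have := allP s1 _ hj'; rewrite /before /=; lia.
  apply: sub_pairwise (pairwise_downto _ _) => k k' /=; rewrite /before /=; lia.
rewrite pairwise_map; have : all (fun k => k < n - 3) (downto (n - 4) 2).
  by apply/allP=> k; rewrite mem_downto; lia.
have := pairwise_downto (n - 4) 2; elim: (downto (n - 4) 2) => //= k s IH /andP[ks ps] /andP[k1 s1].
rewrite IH // andbT; apply/allP=> k' hk'.
by have := allP ks _ hk'; have := allP s1 _ hk'; rewrite /before /=; lia.
Qed.

Lemma targets_learnt : learnt n targets = op_learned n.
Proof.
rewrite /learnt /targets /op_learned !map_cat; congr (_ ++ (_ ++ _)); last by rewrite -map_comp.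
rewrite map_allpairs.
have : all (fun j => 1 < j) (downto (n - 2) 2) by apply/allP=> j; rewrite mem_downto; lia.
by elim: (downto (n - 2) 2) => //= j s IH /andP[j1 /IH ->]; rewrite prednK; last lia.
Qed.

Lemma targets_good : goodh n targets.
Proof. by move=> a k; rewrite mem_targets /in_target /=; case: eqP => [->|a0]; split; lia. Qed.

Section Split.

Variables (h : seq (nat * nat)) (p : nat * nat) (rest : seq (nat * nat)).
Hypothesis E : targets = h ++ p :: rest.

Lemma mem_split_targets q : (q \in h) = in_target q && before q p.
Proof.
have := pairwise_targets; rewrite E pairwise_cat /= => /and3P[/allrelP hr _ /andP[/allP pr _]].
rewrite -mem_targets E mem_cat inE.
have [hq|nq] /= := boolP (q \in h); first by rewrite (hr _ _ hq) // inE eqxx.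
apply/esym/negP=> /andP[/orP[/eqP ->|/pr]]; first by rewrite /before /=; lia.
by rewrite /before /=; lia.
Qed.

Lemma split_at q : in_target q -> before q p -> exists h1 h2, h = h1 ++ q :: h2 /\
  forall y, y \in h2 -> [/\ in_target y, before q y & before y p].
Proof.
move=> tq bq; have hq : q \in h by rewrite mem_split_targets tq.
case/path.splitPr: hq E => h1 h2 E'; exists h1, h2; split=> // y hy.
have := pairwise_targets; rewrite E' -catA pairwise_cat /= => /and3P[_ _ /andP[/allP qr]].
rewrite pairwise_cat => /and3P[/allrelP hr _ _]; split.
- by rewrite -mem_targets E' !mem_cat inE hy !orbT.
- by apply: qr; rewrite mem_cat hy.
by apply: hr; rewrite // inE eqxx.
Qed.

Lemma split_last q : in_target q -> before q p ->
  (forall y, in_target y -> before q y -> before y p -> False) ->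
  exists h', h = rcons h' q.
Proof.
move=> tq bq no; have [h1 [h2 [-> H]]] := split_at tq bq.
case: h2 H => [|y h2] H; first by exists h1; rewrite cats1.
by have [|h3 h4 h5] := H y; [rewrite inE eqxx|case: (no y)].
Qed.

End Split.

End Targets.

Section AllPhases.

Variables (n : nat) (R : realFieldType) (delta : R).
Hypotheses (n6 : 6 <= n) (d0 : (0 < delta)%R) (d2 : (delta <= 2^-1)%R).

Definition level0 (h : seq (nat * nat)) : nat -> nat -> bool -> Prop :=
  if (1, 1) \in h then unit01 else no_unit.

Ltac arith := rewrite /in_target /before /=; lia.
Ltac kfacts_with KE := solve [lia | by apply/KE; arith | by move=> ? /KE; arith | by move=> ? ? /KE; arith
  | by move=> ? ? /KE ? ?; arith].
Ltac kfacts := match goal with KE : forall a k, okN _ _ _ <-> _ |- _ => kfacts_with KE end.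

Lemma phase_all h j k rest : targets n = h ++ (j, k) :: rest ->
  phase_ok n delta h (level0 h) j k.
Proof.
move=> E.
have n1 : 1 < n by lia.
have gh : goodh n h by move=> a k' hk; apply: (targets_good n6); rewrite E mem_cat hk.
have KE a k' : okN n h (NC a k') <->
    a < n /\ (k' = n.-1 \/ in_target n (a, k') && before n (a, k') (j, k)).
  by rewrite /= (mem_split_targets n6 E).
have l0 : level0 h = if in_target n (1, 1) && before n (1, 1) (j, k) then unit01 else no_unit.
  by rewrite /level0 (mem_split_targets n6 E).
have tk : in_target n (j, k) by rewrite -(mem_targets n6) E mem_cat inE eqxx orbT.
have tk' : ((j == 0) && (2 <= k) || (0 < j <= n - 3) && (j <= k)) && (k <= n - 2) by [].
have last0 x m : in_target n (x, m) -> before n (x, m) (j, k) ->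
    (forall a k', in_target n (a, k') -> before n (x, m) (a, k') -> before n (a, k') (j, k) -> False) ->
    exists h', h = rcons h' (x, m).
  by move=> h1 h2 h3; apply: (split_last n6 E h1 h2) => -[a k']; apply: h3.
have memh a k' : (a, k') \in h -> in_target n (a, k') && before n (a, k') (j, k).
  by rewrite (mem_split_targets n6 E).
have block x i a' b' : in_target n (x, i) -> before n (x, i) (j, k) ->
    (forall a k', in_target n (a, k') -> before n (x, i) (a, k') -> before n (a, k') (j, k) ->
       a = x /\ k' < i) -> x < i -> (b' = x -> i < a') -> beats h i x a' b'.
  move=> h1 h2 h3 xi ba; have [u1 [u2 [hE hP]]] := split_at n6 E h1 h2.
  apply: (beats_block hE) => // -[a k'] /hP [g1 g2 g3]; exact: h3.
have [j0|/eqP j0] := eqVneq j 0; last first.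
  have l0' : level0 h = no_unit.
    by move: tk; rewrite l0 /in_target /before /=; case: ifP => // H tk; exfalso; lia.
  rewrite l0'.
  have [Ek|[Ek|Ek]] : k = n - 2 \/ k = n - 3 \/ k <= n - 4 by move: tk; rewrite /in_target /=; lia.
  - have -> : k = n.-1.-1 by lia.
    have [Ej|jn] : j = n - 3 \/ j < n - 3 by move: tk; rewrite /in_target /=; lia.
      have [h' hE] : exists h', h = rcons h' (0, n - 3).
        by apply: last0; last move=> a k'; arith.
      have -> : no_unit = if j - (0 < j) == 0 then unit01 else no_unit by rewrite ifF //; lia.
      apply: (phase_ind d0 d2 n1 gh); try kfacts.
      + move=> i a' b' ig; apply: (beats_last (h' := h') (m := (j - (0 < j)).+1)) => //; try lia.
          by rewrite hE; congr (rcons _ (_, _)); lia.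
        by move=> k' /memh; arith.
      by move=> i a' b' hi; apply: block; try arith; move=> a k'; arith.
    have [h' hE] : exists h', h = rcons h' (j.+1, j.+1).
      by apply: last0; last move=> a k'; arith.
    have -> : no_unit = if j - (j.+1 < j) == 0 then unit01 else no_unit by rewrite ifF //; lia.
    apply: (phase_ind d0 d2 n1 gh); try kfacts.
    + move=> i a' b' ig; apply: (beats_last (h' := h') (m := (j - (j.+1 < j)).+1)) => //; try lia.
        by rewrite hE; congr (rcons _ (_, _)); lia.
      by move=> k' /memh; arith.
    by move=> i a' b' hi; apply: block; try arith; move=> a k'; arith.
  - have [h' hE] : exists h', h = rcons h' (j, n - 2).
      by apply: last0; last move=> a k'; arith.
    have -> : k = (n - 2).-1 by lia.
    apply: (phase_beta d0 d2 n1 gh); try kfacts.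
    move=> i a' b' ig; apply: (beats_last (h' := h') (m := n - 2)) => //; try lia.
    by move=> k' /memh; arith.
  have [h' hE] : exists h', h = rcons h' (j, k.+1).
    by apply: last0; last move=> a k'; arith.
  have -> : k = k.+1.-1 by [].
  apply: (phase_direct d0 d2 n1 gh); try kfacts.
  move=> i a' b' ig; apply: (beats_last (h' := h') (m := k.+1)) => //; try lia.
  by move=> k' /memh; arith.
subst j.
have [Ek|[Ek|[Ek|Ek]]] : k = n - 2 \/ k = n - 3 \/ k = n - 4 \/ k <= n - 5.
  by move: tk; rewrite /in_target /=; lia.
- have -> : level0 h = no_unit.
    by move: tk; rewrite l0 /in_target /before /=; case: ifP => // H tk; exfalso; lia.
  have hE : h = [::].
    by case: (h) memh => // -[a k'] h' /(_ a k'); rewrite inE eqxx => /(_ isT); arith.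
  have -> : k = n.-1.-1 by lia.
  apply: (phase_direct d0 d2 n1 gh); try kfacts.
  by move=> i a' b' ig; apply: beats_nil.
- have -> : level0 h = no_unit.
    by move: tk; rewrite l0 /in_target /before /=; case: ifP => // H tk; exfalso; lia.
  have [h' hE] : exists h', h = rcons h' (0, n - 2).
    by apply: last0; last move=> a k'; arith.
  have -> : k = (n - 2).-1 by lia.
  apply: (phase_beta d0 d2 n1 gh); try kfacts.
  move=> i a' b' ig; apply: (beats_last (h' := h') (m := n - 2)) => //; try lia.
  by move=> k' /memh; arith.
- have -> : level0 h = unit01.
    by move: tk; rewrite l0 /in_target /before /=; case: ifP => // H tk; exfalso; lia.
  have [h' hE] : exists h', h = rcons h' (1, 1).
    by apply: last0; last move=> a k'; arith.
  have -> : k = (n - 3).-1 by lia.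
  have -> : unit01 = if 0 - (1 < 0) == 0 then unit01 else no_unit by [].
  apply: (phase_ind (x := 1) (c := 0) (m := n - 3) d0 d2 n1 gh); try kfacts.
  + by move=> i a' b' hi; apply: block; try arith; move=> a k'; arith.
have -> : level0 h = unit01.
  by move: tk; rewrite l0 /in_target /before /=; case: ifP => // H tk; exfalso; lia.
have [h' hE] : exists h', h = rcons h' (0, k.+1).
  by apply: last0; last move=> a k'; arith.
have -> : k = k.+1.-1 by [].
apply: (phase_tail d0 d2 n1 gh); try kfacts.
move=> i a' b' ig; apply: (beats_last (h' := h') (m := k.+1)) => //; try lia.
by move=> k' /memh; arith.
Qed.

End AllPhases.

Lemma Acc_measure (T : Type) (r : T -> T -> Prop) (P : T -> Prop) (mu : T -> nat) :
  (forall x y, P x -> r y x -> P y /\ mu y < mu x) -> forall x, P x -> Acc r x.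
Proof.
move=> H x; have [k] := ubnP (mu x); elim: k x => [x|k IH x lt Px]; first by rewrite ltn0.
constructor=> y ryx; have [Py ltm] := H _ _ Px ryx.
by apply: IH => //; apply: leq_trans ltm _.
Qed.

Section Assembly.

Variables (n : nat) (R : realFieldType) (delta : R).
Hypotheses (n6 : 6 <= n) (d0 : (0 < delta)%R) (d2 : (delta <= 2^-1)%R).
Notation V := (opvar n).
Implicit Types (s : state V) (tr : seq (entry V)) (c : config V).

Let n1 : 1 < n. Proof. by lia. Qed.

Lemma first_decision tr : 0 < dlevel tr -> exists t1 e t2,
  [/\ tr = t1 ++ e :: t2, ereason e = None & all (fun e => isSome (ereason e)) t1].
Proof.
elim: tr => //= e tr IH; case re : (ereason e) => [C|] /=.
  rewrite add0n => /IH [t1 [e' [t2 [-> h1 h2]]]].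
  by exists (e :: t1), e', t2; rewrite /= re.
by exists [::], e, tr.
Qed.

Lemma wft_size DB tr : wft DB tr -> size tr <= #|{: V}|.
Proof.
move=> w; suff u : uniq [seq l.1 | l <- lits tr].
  by have := max_card (mem [seq l.1 | l <- lits tr]); rewrite (card_uniqP u) !size_map.
elim/last_ind: tr w => // tr e IH; rewrite -cats1 => w.
rewrite cats1 lits_rcons map_rcons rcons_uniq (IH (wft_catl w)) andbT.
by case: (w _ _ _ erefl).
Qed.

Definition ph_inv h B0 (j k : nat) s := exists f Bs dr dc (Fin : state V -> Prop),
  [/\ plan n delta h f Bs dr dc,
      forall a b v, Bs 0 a b v <-> B0 a b v,
      forall s, wfs (OP n) s -> learned s = learnt n h -> snap Bs dr dc (trail s) ->
        final_start f Bs dr dc s -> Fin s,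
      forall s c, wfs (OP n) s -> learned s = learnt n h -> snap Bs dr dc (trail s) ->
        Fin s -> op_step delta h s c ->
        (exists s', [/\ c = Running s', wfs (OP n) s', learned s' = learnt n h,
           snap Bs dr dc (trail s') & Fin s']) \/
        0 < dlevel (trail s) /\ c = Running (restart s (cls n (NC j k)))
    & [/\ wfs (OP n) s, learned s = learnt n h, snap Bs dr dc (trail s)
        & base_inv f Bs s \/ Fin s]].

Lemma ph_start h B0 j k s : phase_ok n delta h B0 j k -> wfs (OP n) s ->
  learned s = learnt n h -> dlevel (trail s) = 0 ->
  (forall a b v, on (trail s) a b v -> B0 a b v) -> ph_inv h B0 j k s.
Proof.
move=> [f [Bs [dr [dc [Fin [P1 P2 P3 P4]]]]]] ws ls lev on0.
exists f, Bs, dr, dc, Fin; split=> //; split=> //.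
  move=> t1 e t2 E re; exfalso; move: lev; rewrite E dlevel_cat /= re /=; lia.
by left; split; [rewrite lev|move=> a b v /on0 /P2; rewrite lev].
Qed.

Lemma ph_step h B0 j k s c : goodh n (rcons h (j, k)) -> ph_inv h B0 j k s ->
  cdcl_step delta (OP n) (col_major n) (Running s) c ->
  (exists2 s', c = Running s' & ph_inv h B0 j k s') \/
  exists s', [/\ c = Running s', learned s' = learnt n (rcons h (j, k)), wfs (OP n) s',
    dlevel (trail s') = 0 & forall a b v, on (trail s') a b v -> B0 a b v].
Proof.
move=> gh' [f [Bs [dr [dc [Fin [P1 P2 P3 P4 [ws ls sn bf]]]]]]].
have gh : goodh n h by move=> a b hab; apply: gh'; rewrite mem_rcons inE hab orbT.
move=> /(op_stepP n1 gh ls) st.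
case: bf => [base|fin].
  left; have [s' [-> ws' ls' sn' bf']] := base_step n1 gh P1 ws ls sn base st.
  exists s' => //; exists f, Bs, dr, dc, Fin; split=> //; split=> //.
  by case: bf' => [?|fs]; [left|right; apply: P3].
case: (P4 _ _ ws ls sn fin st) => [[s' [-> ws' ls' sn' fin']]|[lev ->]].
  by left; exists s' => //; exists f, Bs, dr, dc, Fin; split=> //; split=> //; right.
right; eexists; split; first reflexivity.
- rewrite /= ls /learnt map_rcons /= colclauseE //.
  by have [] := gh' j k; rewrite // mem_rcons inE eqxx.
- have [t1 [e [t2 [E re al]]]] := first_decision lev.
  have w := ws.1; rewrite E in w; have tE := filter_level0 w al re.
  split; last by rewrite /=.
  rewrite /= E tE; apply: wft_sub (wft_catl w) => C.
  by rewrite /clause_of /= mem_rcons inE => /orP[->|->]; rewrite ?orbT.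
- have [t1 [e [t2 [E re al]]]] := first_decision lev.
  have w := ws.1; rewrite E in w.
  by rewrite /= E (filter_level0 w al re) dlevel_all_some.
have [t1 [e [t2 [E re al]]]] := first_decision lev.
have w := ws.1; rewrite E in w.
move=> a b v; rewrite /= E (filter_level0 w al re).
have [h1 _] := sn _ _ _ E re.
by move=> /h1; rewrite (dlevel_all_some al) => /P2.
Qed.

Lemma level0_mono h p : forall a b v, level0 h a b v -> level0 (rcons h p) a b v.
Proof.
move=> a b v; rewrite /level0 mem_rcons inE.
by case: ifP => h1; case: ifP => //; rewrite ?orbT // => h2; rewrite h2 in h1.
Qed.

Definition final_inv s := [/\ learned s = learnt n (targets n), wfs (OP n) s & dlevel (trail s) = 0].

Definition inv c := match c with
  | Running s => (exists h p rest, targets n = h ++ p :: rest /\ ph_inv h (level0 h) p.1 p.2 s)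
      \/ final_inv s
  | Unsat cs => cs = learnt n (targets n)
  | Sat _ => False
  end.

Let gt : goodh n (targets n) := targets_good n6.

Lemma final_closed s : final_inv s -> quiescent (OP n) s -> qhead s = size (trail s) -> False.
Proof.
move=> [ls [w _] _] qu qs; have up := upc_trail n1 gt qu qs ls.
have K a k : in_target n (a, k) -> a < n -> okN n (targets n) (NC a k).
  by move=> ha an; split=> //; right; rewrite (mem_targets n6).
have T01 : on (trail s) 0 1 true.
  by apply: (upc_C up (K 1 1 _ _)) => [|||r]; rewrite /in_target /inrows /=; lia.
have F10 : on (trail s) 1 0 false by apply: (upc_B up) T01; lia.
have T20 : on (trail s) 2 0 true.
  apply: (upc_C up (K 0 2 _ _)) => [|||r]; rewrite /in_target /inrows /=; try lia.
  by move=> h1 h2; have -> : r = 1 by lia.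
have F02 : on (trail s) 0 2 false by apply: (upc_B up) T20; lia.
have F12 : on (trail s) 1 2 false.
  have [_ _ h3] := upc_A (i := 1) (j := 2) (k := 0) up ltac:(lia) ltac:(lia) ltac:(lia)
    ltac:(lia) ltac:(lia) ltac:(lia).
  exact: h3.
have T02 : on (trail s) 0 2 true.
  apply: (upc_C up (K 2 2 _ _)) => [|||r]; rewrite /in_target /inrows /=; try lia.
  by move=> h1 h2; have -> : r = 1 by lia.
exact: on_consistent w T02 F02.
Qed.

Lemma inv_step s c : inv (Running s) -> cdcl_step delta (OP n) (col_major n) (Running s) c ->
  inv c.
Proof.
case=> [[h [p [rest [E ph]]]]|fin] st.
  have gh : goodh n (rcons h (p.1, p.2)).
    by move=> a k hk; apply: gt; rewrite E -cat_rcons mem_cat; case: (p) hk => ? ? ->.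
  case: (ph_step gh ph st) => [[s' -> ph']|[s' [-> ls' ws' lev' on']]].
    by left; exists h, p, rest.
  have E' : targets n = rcons h p ++ rest by rewrite cat_rcons.
  have {}ls' : learned s' = learnt n (rcons h p) by rewrite ls'; case: (p).
  case: rest E E' => [|q rest] E E'.
    by right; split=> //; rewrite E' cats0.
  left; exists (rcons h p), q, rest; split=> //.
  apply: ph_start => //; last by move=> a b v /on'; apply: level0_mono.
  by apply: (phase_all n6 d0 d2 (rest := rest)); rewrite E'; case: (q).
have closed := final_closed fin; have [ls ws lev] := fin.
have := op_stepP n1 gt ls st.
case=> {c st} [N l ok un us|qu lt|N _ _ _ lv|N _ _ _ _|x qu qs|qu qs].
- right; split=> //; last by rewrite /= -cats1 dlevel_cat lev.
  exact: (wfs_push_cls n1 gt ls ws ok un).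
- by right; split=> //; case: ws => w _; split.
- by rewrite lev in lv.
- by [].
- by case: (closed qu qs).
by case: (closed qu qs).
Qed.

Lemma inv_wfs s : inv (Running s) -> wfs (OP n) s /\ size (learned s) <= size (targets n).
Proof.
case=> [[h [p [rest [E ph]]]]|[ls ws _]]; last by rewrite ls size_map.
move: ph => [f [Bs [dr [dc [Fin [_ _ _ _ [ws ls _ _]]]]]]].
by split=> //; rewrite ls size_map E size_cat; lia.
Qed.

Definition measure s := (size (targets n) - size (learned s)) * (2 * #|{: V}|).+1 +
  (2 * #|{: V}| - (size (trail s) + qhead s)).

Lemma measure_step s s' : inv (Running s) -> inv (Running s') ->
  cdcl_step delta (OP n) (col_major n) (Running s) (Running s') -> measure s' < measure s.
Proof.
move=> /inv_wfs [[w q] sz] /inv_wfs [[w' q'] sz'].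
have := wft_size w; have := wft_size w'; rewrite /measure.
move: (size (targets n)) sz sz' => T sz sz'.
move E : (Running s) => c1; move E' : (Running s') => c2 z' z st.
case: st E E' => //.
- move=> s0 C l _ _ _ [E] [E']; subst s0 s'; rewrite /= size_rcons in z' q' *.
  by lia.
- by move=> s0 _ lt [E] [E']; subst s0 s'; rewrite /= in z' q' *; lia.
- move=> s0 C _ _ _ _ [E] [E']; subst s0 s'; rewrite /restart /= ?size_rcons in z' q' sz' *.
  have -> : T - size (learned s) = (T - (size (learned s)).+1).+1 by lia.
  by rewrite mulSn; lia.
- move=> s0 x _ _ _ [E] [E']; subst s0 s'; rewrite /= size_rcons in z' q' *.
  by lia.
Qed.

Lemma step_running c c' : cdcl_step delta (OP n) (col_major n) c c' ->
  exists s, c = Running s.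
Proof. by case=> s *; exists s. Qed.

Definition cmeasure c := if c is Running s then (measure s).+1 else 0.

Lemma inv_acc c : inv c -> Acc (fun c' c => cdcl_step delta (OP n) (col_major n) c c') c.
Proof.
apply: (Acc_measure (mu := cmeasure)) => c1 c2 i st.
have [s E] := step_running st; subst c1.
have i2 := inv_step i st; split=> //.
by case: c2 st i2 => // s2 st i2; apply: measure_step st.
Qed.

Lemma inv_init : inv (init V).
Proof.
left; case E : (targets n) => [|p rest]; first by [].
exists [::], p, rest; split=> //; apply: ph_start => //.
- by apply: (phase_all n6 d0 d2 (rest := rest)); rewrite E; case: (p).
- by split=> //; exact: wft_nil.
Qed.

Lemma inv_reachable c : reachable delta (OP n) (col_major n) c -> inv c.
Proof.
move=> r; suff aux : forall c1 c2, clos_refl_trans _ (cdcl_step delta (OP n) (col_major n)) c1 c2 ->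
    inv c1 -> inv c2 by apply: aux r inv_init.
move=> c1 c2; elim=> {c1 c2} [c1 c2 st|//|c1 c2 c3 _ h1 _ h2 /h1/h2 //].
by have [s E] := step_running st; subst c1 => /inv_step; apply.
Qed.

End Assembly.

Theorem theorem4 (R : realFieldType) (n : nat) (delta : R)
    (hn : 6 <= n) (delta_gt0 : (0 < delta)%R) (delta_le : (delta <= 2^-1)%R) :
  terminating delta (OP n) (col_major n) /\
  (forall c : config (opvar n),
     reachable delta (OP n) (col_major n) c ->
     halted delta (OP n) (col_major n) c ->
     c = Unsat (op_learned n)).
Proof.
split; first exact/inv_acc/inv_init.
move=> c /(inv_reachable hn delta_gt0 delta_le); case: c => [s|cs|//] i hl.
  have [ws _] := inv_wfs hn delta_gt0 delta_le i.
  have [c st] := halted_cases delta ws (@col_major_mem n).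
  by case: (hl _ st).
by rewrite i targets_learnt.
Qed.
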